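(* Let $n\ge1$ and let $x_1,\dots,x_n,t\in\mathbb C\setminus\{0\}$. The following determinant evaluations hold (all determinants over $1\le i,j\le n$): $$\det\left(x_i^{j-1}\theta((-1)^{n-1}p^{j-1}tx_i^n;p^n)\right)=\frac{(p;p)_\infty^{n}}{(p^n;p^n)_\infty^n}\,\theta(tx_1\cdots x_n)\,W_{A_{n-1}}(x),$$ $$\det\left(x_i^{j-n}\theta(p^{j-1}x_i^{2n-1};p^{2n-1})-x_i^{n+1-j}\theta(p^{j-1}x_i^{1-2n};p^{2n-1})\right)=\frac{2(p;p)_\infty^{n}}{(p^{2n-1};p^{2n-1})_\infty^n}\,W_{B_n}(x),$$ $$\det\left(x_i^{j-n-1}\theta(p^{j-1}x_i^{2n};p^{2n})-x_i^{n+1-j}\theta(p^{j-1}x_i^{-2n};p^{2n})\right)=\frac{2(p^2;p^2)_\infty(p;p)_\infty^{n-1}}{(p^{2n};p^{2n})_\infty^n}\,W_{B_n^\vee}(x),$$ $$\det\left(x_i^{j-n-1}\theta(-p^{j}x_i^{2n+2};p^{2n+2})-x_i^{n+1-j}\theta(-p^{j}x_i^{-2n-2};p^{2n+2})\right)=\frac{(p;p)_\infty^{n}}{(p^{2n+2};p^{2n+2})_\infty^n}\,W_{C_n}(x),$$ $$\det\left(x_i^{j-n}\theta(-p^{j-\frac12}x_i^{2n};p^{2n})-x_i^{n+1-j}\theta(-p^{j-\frac12}x_i^{-2n};p^{2n})\right)=\frac{(p^{\frac12};p^{\frac12})_\infty(p;p)_\infty^{n-1}}{(p^{2n};p^{2n})_\infty^n}\,W_{C_n^\vee}(x),$$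 $$\det\left(x_i^{j-n}\theta(-p^{j}x_i^{2n+1};p^{2n+1})-x_i^{n+1-j}\theta(-p^{j}x_i^{-2n-1};p^{2n+1})\right)=\frac{(p;p)_\infty^n}{(p^{2n+1};p^{2n+1})_\infty^n}\,W_{BC_n}(x)$$ and, for $n\geq 2$, $$\det\left(x_i^{j-n}\theta(-p^{j-1}x_i^{2n-2};p^{2n-2})+x_i^{n-j}\theta(-p^{j-1}x_i^{2-2n};p^{2n-2})\right)=\frac{4(p;p)_\infty^n}{(p^{2n-2};p^{2n-2})_\infty^n}\,W_{D_n}(x).$$
   Context: Fix $p\in\mathbb C$ with $0<|p|<1$ and a choice of square root $p^{1/2}$. Put $(a;q)_\infty=\prod_{j\ge0}(1-aq^j)$, $\theta(x;q)=(x;q)_\infty(q/x;q)_\infty$ for $x\ne0$, $\theta(x)=\theta(x;p)$, and $\theta(xy^{\pm})=\theta(xy)\theta(x/y)$; here $p^{j-1/2}=p^{j-1}p^{1/2}$. The Macdonald denominators are, for $x=(x_1,\dots,x_n)$: $$W_{A_{n-1}}(x)=\prod_{1\le i<j\le n}x_j\theta(x_i/x_j),\qquad W_{D_n}(x)=\prod_{1\le i<j\le n}x_i^{-1}\theta(x_ix_j^\pm),$$ $$W_{B_n}(x)=\prod_{i=1}^n\theta(x_i)\, W_{D_n}(x),\qquad W_{B_n^\vee}(x)=\prod_{i=1}^nx_i^{-1}\theta(x_i^2;p^2)\,W_{D_n}(x),$$ $$W_{C_n}(x)=\prod_{i=1}^nx_i^{-1}\theta(x_i^2)\,W_{D_n}(x),\qquad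 W_{C_n^\vee}(x)=\prod_{i=1}^n\theta(x_i;p^{1/2})\,W_{D_n}(x),$$ $$W_{BC_n}(x)=\prod_{i=1}^n\theta(x_i)\theta(px_i^2;p^2)\,W_{D_n}(x).$$ *)

(* Defs.v *)
From HB Require Import structures.
From mathcomp Require Import all_boot all_order all_algebra.
From mathcomp Require Export complex.
From mathcomp Require Import all_classical all_reals all_analysis.
Import Order.TTheory GRing.Theory Num.Theory.
Import numFieldNormedType.Exports.

Set Implicit Arguments.
Unset Strict Implicit.
Unset Printing Implicit Defensive.

Local Open Scope classical_set_scope.
Local Open Scope ring_scope.

(* Over an abstract [numFieldType] the topology is the one of the norm; it is
   used below with [K := R[i]], [R : realType], i.e. the complex numbers, for
   which the library declares no topology under the name [complex R] itself. *)
Section Theta.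
Variable K : numFieldType.
Implicit Types a q x y : K.

Definition qpoch a q : K :=
  lim ((fun N : nat => \prod_(0 <= j < N) (1 - a * q ^+ j)) @ \oo).

Definition theta x q : K := qpoch x q * qpoch (q / x) q.

(* theta(x y^{+-}; q) *)
Definition thetapm x y q : K := theta (x * y) q * theta (x / y) q.

End Theta.

(* The parameter [r] of [W_Cv] stands for the chosen square root of [p]. *)
Section MacdonaldDenominators.
Variables (K : numFieldType) (n : nat).
Implicit Types (p r : K) (x : 'I_n -> K).

Definition W_A p x : K :=
  \prod_(i < n) \prod_(j < n | (i < j)%N) (x j * theta (x i / x j) p).

Definition W_D p x : K :=
  \prod_(i < n) \prod_(j < n | (i < j)%N) ((x i)^-1 * thetapm (x i) (x j) p).

Definition W_B p x : K := (\prod_(i < n) theta (x i) p) * W_D p x.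

Definition W_Bv p x : K :=
  (\prod_(i < n) ((x i)^-1 * theta (x i ^+ 2) (p ^+ 2))) * W_D p x.

Definition W_C p x : K :=
  (\prod_(i < n) ((x i)^-1 * theta (x i ^+ 2) p)) * W_D p x.

Definition W_Cv p r x : K := (\prod_(i < n) theta (x i) r) * W_D p x.

Definition W_BC p x : K :=
  (\prod_(i < n) (theta (x i) p * theta (p * x i ^+ 2) (p ^+ 2))) * W_D p x.

End MacdonaldDenominators.

(* Main.v *)
Require Import Defs.
From mathcomp Require Import all_boot all_order all_algebra.
From mathcomp Require Import fingroup perm cyclic separable cyclotomic.
From mathcomp Require Import all_classical all_reals all_analysis.
From mathcomp Require Import zify ring lra.
Import Order.TTheory GRing.Theory Num.Theory numFieldNormedType.Exports.

(** Each identity says that two alternating functions of [x_1, ..., x_n] are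
    proportional, and gives the constant.

    Fix [N] and [c], and call [h] a theta function of degree [N] if it is given
    on the punctured plane by a Laurent series with coefficients [a_k] such that
    [a_(k+N) = - c p^k a_k]. The recursion determines the series from [N]
    consecutive coefficients, so these functions are spanned by the functions
    [x^m theta(c p^m x^N; p^N)], one for each residue of [m] modulo [N]
    ([laurent_span]). The factors [theta(a x; p)] have degree 1, and degrees add
    under multiplication because the recursions pass to the convolution of the
    coefficients ([theta_laurent], [laurentM], [conv_recursion]). For the degree
    1 case it is enough to expand [(x; q)_oo], from its functional equation
    [F(x) = (1 - x) F(q x)]; the value of the constant in the triple product
    identity is never used.

    As a function of one variable, each denominator [W] is a power of the
    variable times a product of [N] factors [theta(a x; p)]
    ([prod_theta_span]). For the types other than A it is moreover odd or even
    under [x -> 1/x], up to a power of [x]. Reflection permutes the spanning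
    functions ([theta_basis_reflect]), and (anti)symmetrization leaves exactly
    [n] of them, which are the columns of the matrix. Hence [W] and the
    determinant are, in each variable, combinations of the same [n] functions;
    being alternating, they are proportional ([alternating_proportional]).

    The constant is found at points [b_i] with [b_i^N = 1] or [b_i^N = -1], the
    sign being such that no column vanishes; in type A they are a common multiple
    of the [n]-th roots of unity. There the theta factor of an entry
    depends on the column only, and the determinant becomes a product of theta
    constants times a classical Weyl denominator ([alternant_nodes],
    [weyl_det]). The same Weyl denominator splits off from [W(b)]
    ([W_D_nodes]); what remains is an infinite product over [l] of a polynomial
    in [q = p^l], namely the product of the [1 - q b_i^(+-1) b_j^(+-1)] over
    [i < j]. Its square is essentially a product over all ordered pairs of
    nodes and inverses of nodes, which telescopes to factors [1 - q^k]
    ([nodepair_sqr]); the square root is taken among polynomials in [q], where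
    the value 1 at [q = 0] fixes the sign ([polyfun_eq_sqr]).

    Everything before the theorem holds over any algebraically closed numeric
    field in which geometrically dominated series converge. *)

Set Implicit Arguments.
Unset Strict Implicit.
Unset Printing Implicit Defensive.

Local Open Scope ring_scope.

(** Completeness in the only form that is needed. It is a property of an abstract
    numeric field so that limits are always taken in the topology of the norm. *)
Definition geometric_complete (K : numFieldType) :=
  forall (u : nat -> K) (C d : K), 0 <= d -> d < 1 ->
    (forall k, `|u k| <= C * d ^+ k) -> cvgn (series u).

(** The real and imaginary parts are dominated by the same geometric series. *)
Lemma geometric_complete_complex (R : realType) : geometric_complete R[i].
Proof.
move=> u C d d0 d1 hu.
have [e de] : exists e : R, d = e%:C%C.
  by exists (complex.Re d); case: d d0 {d1 hu} => a b; rewrite lecE /= => /andP[/eqP -> _].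
have C0 : 0 <= C.
  by apply: le_trans (_ : `|u 0%N| <= _) => //; have := hu 0%N; rewrite expr0 mulr1.
have [c Cc] : exists c : R, C = c%:C%C.
  by exists (complex.Re C); case: C C0 {hu} => a b; rewrite lecE /= => /andP[/eqP -> _].
have e0 : 0 <= e by move: d0; rewrite de lecE /= => /andP[].
have e1 : e < 1 by move: d1; rewrite de ltcE /= => /andP[].
have c0 : 0 <= c by move: C0; rewrite Cc lecE /= => /andP[].
have bnd k : `|complex.Re (u k)| <= c * e ^+ k /\ `|complex.Im (u k)| <= c * e ^+ k.
  have := hu k; rewrite de Cc -rmorphXn -rmorphM /= normc_def lecR => h.
  have p : 0 <= c * e ^+ k by rewrite mulr_ge0 // exprn_ge0.
  have h1 : complex.Re (u k) ^+ 2 + complex.Im (u k) ^+ 2 <= (c * e ^+ k) ^+ 2.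
    by rewrite -ler_sqrt ?sqr_ge0 // sqrtr_sqr (ger0_norm p).
  split; rewrite -(ger0_norm p) -ler_sqr ?nnegrE // !real_normK ?num_real //;
    apply: le_trans h1; [rewrite lerDl|rewrite lerDr]; exact: sqr_ge0.
have cv (v : nat -> R) : (forall k, `|v k| <= c * e ^+ k) -> cvgn (series v).
  move=> hv; apply: normed_cvg; apply: (@series_le_cvg _ _ (geometric c e)) => //.
  - by move=> n; exact: normr_ge0.
  - by move=> n; exact: mulr_ge0 c0 (exprn_ge0 _ e0).
  - by apply: is_cvg_geometric_series; rewrite ger0_norm.
have cr := cv _ (fun k => (bnd k).1).
have ci := cv _ (fun k => (bnd k).2).
set a := limn (series (fun k => complex.Re (u k))) in cr.
set b := limn (series (fun k => complex.Im (u k))) in ci.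
apply: (cvgP ((a +i* b)%C : (R[i] : numFieldType))).
apply/cvgrPdist_le => eps eps0.
have [r re] : exists r : R, eps = r%:C%C.
  by exists (complex.Re eps); case: eps eps0 => x y; rewrite ltcE /= => /andP[/eqP -> _].
have r0 : 0 < r by move: eps0; rewrite re ltcE /= => /andP[].
have r20 : 0 < r / 2 by rewrite divr_gt0.
move/cvgrPdist_le: cr => /(_ _ r20) cr.
move/cvgrPdist_le: ci => /(_ _ r20) ci.
near=> n.
have hr : `|a - series (fun k => complex.Re (u k)) n| <= r / 2 by near: n.
have hi : `|b - series (fun k => complex.Im (u k)) n| <= r / 2 by near: n.
have -> : (a +i* b)%C - series u n = ((a - series (fun k => complex.Re (u k)) n) +i* (b - series (fun k => complex.Im (u k)) n))%C.
  apply/eqP; rewrite eq_complex /= /series /=.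
  by rewrite !raddfB !raddf_sum /= !eqxx.
move: hr hi; set A := a - _; set B := b - _ => hr hi.
have -> : (A +i* B)%C = A%:C%C + 'i%C * B%:C%C by apply/eqP; rewrite eq_complex /= !(mul0r, mulr0, mul1r, addr0, add0r, subr0) !eqxx.
apply: le_trans (ler_normD _ _) _.
rewrite normrM !normc_def /= !expr0n /= !addr0 add0r expr1n sqrtr1 mul1r !sqrtr_sqr -rmorphD re /= lecR.
by rewrite (splitr r) lerD.
Unshelve. all: by end_near.
Qed.

(** * Two-sided series *)

Section TwoSided.
Local Open Scope classical_set_scope.
Variable K : numFieldType.
Hypothesis Kc : geometric_complete K.
Implicit Types (u v : int -> K) (s t C : K).

Lemma cvg_uniq (v : nat -> K) (a b : K) : v @ \oo --> a -> v @ \oo --> b -> a = b.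
Proof. by move=> ha hb; apply: (cvg_unique (@norm_hausdorff _ K)) ha hb. Qed.

Lemma cvg_lim_eq (v : nat -> K) (a : K) : v @ \oo --> a -> limn v = a.
Proof. by move=> h; apply: cvg_lim => //; exact: norm_hausdorff. Qed.

Lemma eq_cvgn (f g : nat -> K) (l : K) : f =1 g -> f @ \oo --> l -> g @ \oo --> l.
Proof. by move=> /funext ->. Qed.

(** As [Negz i] is [- (i + 1)], the [M]-th partial sum below runs over
    [- M <= k < M]; such ranges split evenly into residue classes. *)
Definition zterm u (i : nat) : K := u i%:Z + u (Negz i).
Definition zsums u s := series (zterm u) @ \oo --> s.
(** One ratio suffices: the coefficients met below decrease so fast that the
    terms of their Laurent series satisfy this bound at every point. *)
Definition geomb C u := forall k : int, `|u k| <= C / 2 ^+ `|k|%N.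

Lemma geomb_ge0 C u : geomb C u -> 0 <= C.
Proof. by move=> /(_ 0); rewrite expr0 divr1; apply: le_trans. Qed.

Lemma zterm_bound C u i : geomb C u -> `|zterm u i| <= C * (3/2) / 2 ^+ i.
Proof.
move=> hu; apply: le_trans (ler_normD _ _) _.
apply: le_trans (lerD (hu i) (hu (Negz i))) _.
rewrite (_ : `|Negz i|%N = i.+1) // (_ : `|i%:Z|%N = i) // exprS invfM.
rewrite le_eqVlt; apply/orP; left; apply/eqP; field.
by rewrite expf_neq0 // pnatr_eq0.
Qed.

Lemma half_ge0 : (0 : K) <= 2^-1. Proof. by rewrite invr_ge0 ler0n. Qed.
Lemma half_lt1 : (2^-1 : K) < 1.
Proof. by rewrite invf_lt1 ?ltr0n // ltr1n. Qed.

Lemma expr_cvg0 (d : K) : `|d| < 1 -> (fun k => d ^+ k) @ \oo --> (0 : K).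
Proof.
move=> d1; apply: (@cvg_series_cvg_0 K K); apply: (Kc (C := 1) _ d1) => // k.
by rewrite mul1r normrX.
Qed.

Lemma zsums_exist C u : geomb C u -> exists s, zsums u s.
Proof.
move=> hu; exists (limn (series (zterm u))).
apply: (Kc (C := C * (3/2)) half_ge0 half_lt1) => k.
by rewrite exprVn; exact: zterm_bound.
Qed.

Lemma series_zterm_diff C u : geomb C u -> forall M D,
  `|series (zterm u) (M + D)%N - series (zterm u) M| <= C * 3 / 2 ^+ M - C * 3 / 2 ^+ (M + D).
Proof.
move=> hu M; elim=> [|D IH]; first by rewrite addn0 !subrr normr0.
rewrite addnS seriesSr.
apply: le_trans (_ : `|series (zterm u) (M + D)%N - series (zterm u) M| + `|zterm u (M + D)%N| <= _).
  by rewrite addrAC; exact: ler_normD.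
apply: le_trans (lerD IH (zterm_bound _ hu)) _.
rewrite le_eqVlt; apply/orP; left; apply/eqP; rewrite exprS; field.
by rewrite !expf_neq0 // pnatr_eq0.
Qed.

Lemma cvg_norm_le (v : nat -> K) s (a B : K) M :
  (forall n, (M <= n)%N -> `|v n - a| <= B) -> v @ \oo --> s -> `|s - a| <= B.
Proof.
move=> hB /cvgrPdist_le hs; apply/ler_addgt0Pr => e e0.
have [N _ hN] := hs e e0.
have h1 := hN (maxn N M) (leq_maxl _ _).
have h2 := hB (maxn N M) (leq_maxr _ _).
have -> : s - a = (v (maxn N M) - a) + (s - v (maxn N M)) by ring.
by apply: le_trans (ler_normD _ _) _; rewrite lerD.
Qed.

(** The rate is uniform in [u], which is what the exchange of sums needs. *)
Lemma zsums_tail C u s : geomb C u -> zsums u s -> forall M,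
  `|s - series (zterm u) M| <= C * 3 / 2 ^+ M.
Proof.
move=> hu hs M; apply: (cvg_norm_le (M := M) _ hs) => n hn.
rewrite -(subnKC hn); apply: le_trans (series_zterm_diff hu _ _) _.
by rewrite gerBl divr_ge0 ?mulr_ge0 ?exprn_ge0 ?ler0n ?(geomb_ge0 hu).
Qed.

Lemma zsums_norm C u s : geomb C u -> zsums u s -> `|s| <= C * 3.
Proof.
by move=> hu hs; have := zsums_tail hu hs 0; rewrite /series /= big_geq // subr0 expr0 divr1.
Qed.

Lemma zsums_uniq u s t : zsums u s -> zsums u t -> s = t.
Proof. exact: cvg_uniq. Qed.

Lemma zsums_ext u v s : (forall k, u k = v k) -> zsums u s -> zsums v s.
Proof. by move=> /funext ->. Qed.

Lemma zsumsD u v s t : zsums u s -> zsums v t -> zsums (fun k => u k + v k) (s + t).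
Proof.
move=> hu hv; apply: eq_cvgn (cvgD hu hv) => n.
rewrite -[LHS]/(series (zterm u) n + series (zterm v) n).
by rewrite /series /= -big_split; apply: eq_bigr => i _; rewrite /zterm /=; ring.
Qed.

Lemma zsumsZ c u s : zsums u s -> zsums (fun k => c * u k) (c * s).
Proof.
move=> hu; apply: eq_cvgn (cvgM (cvg_cst c) hu) => n.
rewrite -[LHS]/(c * series (zterm u) n).
by rewrite /series /= mulr_sumr; apply: eq_bigr => i _; rewrite /zterm mulrDr.
Qed.

Lemma cvg0_bound (B : K) (w : nat -> K) :
  (forall M, `|w M| <= B / 2 ^+ M) -> w @ \oo --> (0 : K).
Proof.
move=> hw.
have B0 : 0 <= B by have := hw 0%N; rewrite expr0 divr1; apply: le_trans.
have h : (fun M => B * 2^-1 ^+ M) @ \oo --> (B * 0 : K).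
  by apply: (cvgM (cvg_cst B)); apply: expr_cvg0; rewrite ger0_norm ?half_ge0 ?half_lt1.
rewrite mulr0 in h; apply/cvgrPdist_le => e e0.
move/cvgrPdist_le: h => /(_ e e0) [N _ hN]; exists N => // n hn.
have := hN n hn; rewrite /= !sub0r !normrN; apply: le_trans.
rewrite [X in _ <= X]ger0_norm ?mulr_ge0 ?exprn_ge0 ?half_ge0 // exprVn; exact: hw.
Qed.

Lemma geomb_shift C u : geomb C u -> geomb (C * 2) (fun k => u (k + 1)).
Proof.
move=> hu k; apply: le_trans (hu _) _; rewrite -mulrA ler_wpM2l ?(geomb_ge0 hu) //.
rewrite -[X in X <= _]mul1r ler_pdivlMr ?exprn_gt0 ?ltr0n // mul1r mulrC.
rewrite ler_pdivrMr ?exprn_gt0 ?ltr0n // -exprS ler_eXn2l ?ltr1n //; lia.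
Qed.

Lemma geomb_refl C u : geomb C u -> geomb (C * 2) (fun k => u (- 1 - k)).
Proof.
move=> hu k; apply: le_trans (hu _) _; rewrite -mulrA ler_wpM2l ?(geomb_ge0 hu) //.
rewrite -[X in X <= _]mul1r ler_pdivlMr ?exprn_gt0 ?ltr0n // mul1r mulrC.
rewrite ler_pdivrMr ?exprn_gt0 ?ltr0n // -exprS ler_eXn2l ?ltr1n //; lia.
Qed.

(** This reflection only swaps the two halves of each term; conjugating the
    shift by 1 with it gives the shift by -1. *)
Lemma zsums_refl u s : zsums u s -> zsums (fun k => u (- 1 - k)) s.
Proof.
apply: eq_cvgn => n; apply: eq_bigr => i _; rewrite /zterm addrC.
by congr (u _ + u _); lia.
Qed.

(** The partial sums of both sides differ by [u M - u (- M)], which tends to 0. *)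
Lemma zsums_shift1 C u s : geomb C u -> zsums u s -> zsums (fun k => u (k + 1)) s.
Proof.
move=> hu hs.
have e M : series (zterm u) M + (u M%:Z - u (- M%:Z)) = series (zterm (fun k => u (k + 1))) M.
  elim: M => [|M IH]; first by rewrite /series /= !big_geq // oppr0 subrr addr0.
  rewrite !seriesSr -IH /zterm.
  have -> : Negz M + 1 = - M%:Z by lia.
  have -> : M%:Z + 1 = M.+1%:Z by lia.
  have -> : - M.+1%:Z = Negz M by lia.
  ring.
apply: (eq_cvgn e); rewrite -[s]addr0; apply: cvgD => //.
apply: (cvg0_bound (B := C * 2)) => M; apply: le_trans (ler_normB _ _) _.
by have := lerD (hu M%:Z) (hu (- M%:Z)); rewrite abszN /= => /le_trans; apply;
  rewrite -mulrDl mulrDr !mulr1.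
Qed.

Definition geom u := exists C, geomb C u.

Lemma geom_shift_zsums (m : int) u s :
  geom u -> zsums u s -> geom (fun k => u (k + m)) /\ zsums (fun k => u (k + m)) s.
Proof.
have S1 v : geom v -> zsums v s -> geom (fun k => v (k + 1)) /\ zsums (fun k => v (k + 1)) s.
  move=> [C hC] hs; split; first by exists (C * 2); exact: geomb_shift.
  exact: zsums_shift1 hC hs.
have R v : geom v -> zsums v s -> geom (fun k => v (- 1 - k)) /\ zsums (fun k => v (- 1 - k)) s.
  move=> [C hC] hs; split; first by exists (C * 2); exact: geomb_refl.
  exact: zsums_refl.
move=> hg hs; elim: m => [|m [g1 z1]|m [g1 z1]].
- by under eq_fun do rewrite addr0.
- have <- : (fun k => u (k + 1 + m%:Z)) = (fun k => u (k + m.+1%:Z)).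
    by apply/funext => k; congr u; lia.
  exact: S1 g1 z1.
- have [g2 z2] := R _ g1 z1; have [g3 z3] := S1 _ g2 z2; have [g4 z4] := R _ g3 z3.
  have <- : (fun k => u (- 1 - (- 1 - k + 1) - m%:Z)) = (fun k => u (k - m.+1%:Z)).
    by apply/funext => k; congr u; lia.
  by split.
Qed.

Lemma series_zterm_norm C u M : geomb C u -> `|series (zterm u) M| <= C * 3.
Proof.
move=> hu; have := series_zterm_diff hu 0 M.
rewrite add0n {2}/series /= big_geq // subr0 expr0 divr1 => /le_trans; apply.
by rewrite gerBl divr_ge0 ?mulr_ge0 ?exprn_ge0 ?ler0n ?(geomb_ge0 hu).
Qed.

(** Both iterated sums are limits of the sums over the squares
    [- M <= k, l < M]: the error is a sum of row tails, hence [O(2^-M)]. *)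
Lemma zsums_fubini (u : int -> int -> K) (r t : int -> K) C s :
  (forall k l, `|u k l| <= C / 2 ^+ `|k|%N / 2 ^+ `|l|%N) ->
  (forall k, zsums (u k) (r k)) -> (forall l, zsums (fun k => u k l) (t l)) ->
  zsums r s -> zsums t s.
Proof.
pose S (v : int -> int -> K) M := series (zterm (fun k => series (zterm (v k)) M)) M.
have key (v : int -> int -> K) (w : int -> K) :
    (forall k l, `|v k l| <= C / 2 ^+ `|k|%N / 2 ^+ `|l|%N) ->
    (forall k, zsums (v k) (w k)) -> (fun M => series (zterm w) M - S v M) @ \oo --> (0 : K).
  move=> hv hw; apply: (cvg0_bound (B := C * 9)) => M.
  rewrite (_ : _ - _ = series (zterm (fun k => w k - series (zterm (v k)) M)) M); last first.
    by rewrite /S /series /= -sumrB; apply: eq_bigr => i _; rewrite /zterm; ring.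
  rewrite (_ : C * 9 / 2 ^+ M = (C * 3 / 2 ^+ M) * 3); last by ring.
  apply: series_zterm_norm => k.
  rewrite (_ : _ / _ / _ = C / 2 ^+ `|k|%N * 3 / 2 ^+ M); last by ring.
  by apply: zsums_tail (hw k) M => l; exact: hv.
move=> hu hr ht hs.
have h1 := key u r hu hr.
have h2 : (fun M => series (zterm t) M - S (fun l k => u k l) M) @ \oo --> (0 : K).
  apply: key ht => l k; rewrite mulrAC; exact: hu.
have SS M : S (fun l k => u k l) M = S u M.
  have L (v : int -> int -> K) : S v M = \sum_(0 <= i < M) \sum_(0 <= j < M)
      (v i%:Z j%:Z + v i%:Z (Negz j) + v (Negz i) j%:Z + v (Negz i) (Negz j)).
    apply: eq_bigr => i _; rewrite /zterm /series /= -big_split /=.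
    by apply: eq_bigr => j _; rewrite !addrA.
  rewrite !L exchange_big /=; apply: eq_bigr => i _; apply: eq_bigr => j _; ring.
have h3 : (fun M => series (zterm r) M - (series (zterm r) M - S u M) +
  (series (zterm t) M - S (fun l k => u k l) M)) @ \oo --> s.
  by have := cvgD (cvgB hs h1) h2; rewrite subr0 addr0; apply.
apply: (eq_cvgn _ h3) => M; rewrite SS; ring.
Qed.

(** A partial sum of length [N M] is exactly the sum of the partial sums of
    length [M] of the residue classes. *)
Lemma zsums_residues (N : nat) u s (t : nat -> K) : (0 < N)%N -> zsums u s ->
  (forall r, (r < N)%N -> zsums (fun l => u (r%:Z + N%:Z * l)) (t r)) ->
  s = \sum_(r < N) t r.
Proof.
move=> N0 hs ht.
have e M : series (zterm u) (N * M)%N =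
    \sum_(r < N) series (zterm (fun l => u (r%:Z + N%:Z * l))) M.
  elim: M => [|M IH].
    by rewrite muln0 /series /= big_geq // big1 // => r _; rewrite big_geq.
  under eq_bigr do rewrite seriesSr.
  have hP : \sum_(r < N) u (r + N * M)%N = \sum_(r < N) u (r%:Z + N%:Z * M%:Z).
    by apply: eq_bigr => r _; congr u; rewrite PoszD PoszM.
  have hN : \sum_(r < N) u (Negz (r + N * M)%N) = \sum_(r < N) u (r%:Z + N%:Z * Negz M).
    rewrite [LHS](reindex_inj rev_ord_inj) /=; apply: eq_bigr => r _; congr u.
    have := ltn_ord r; nia.
  rewrite big_split /= -IH mulnS addnC /series /= (big_cat_nat _ (n := (N * M)%N)) ?leq_addr //=.
  congr (_ + _); rewrite -{1}[(N * M)%N]add0n big_addn addnC addnK big_mkord.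
  by rewrite /zterm !big_split /= hP hN.
have h2 : (fun M => series (zterm u) (N * M)%N) @ \oo --> (\sum_(r < N) t r : K).
  have h3 : (fun M => \sum_(r < N) series (zterm (fun l => u (r%:Z + N%:Z * l))) M) @ \oo --> (\sum_(r < N) t r : K).
    apply: cvg_big => [|r _]; first exact: add_continuous.
    exact: ht.
  by apply: eq_cvgn h3 => M; rewrite e.
apply: cvg_uniq h2; move/cvgrPdist_le: hs => hs; apply/cvgrPdist_le => eps eps0.
have [n0 _ hn] := hs eps eps0; exists n0 => // M /= hM; apply: hn => /=.
by rewrite (leq_trans hM) // leq_pmull.
Qed.

End TwoSided.

(** * Laurent series with rapidly decreasing coefficients *)

Section Laurent.
Local Open Scope classical_set_scope.
Variable K : numFieldType.
Hypothesis Kc : geometric_complete K.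
Implicit Types (a b c : int -> K) (f g : K -> K).

(** Decay faster than every geometric sequence in both directions, so that the
    Laurent series converges on the whole punctured plane. *)
Definition rapid a := forall rho : K, 1 <= rho ->
  exists C : K, forall k : int, `|a k| * rho ^+ `|k|%N <= C.

Definition laurent a f :=
  rapid a /\ forall x, x != 0 -> zsums (fun k => a k * x ^ k) (f x).

Lemma normXz_bound (x : K) : x != 0 ->
  exists2 X : K, 1 <= X & forall k : int, `|x ^ k| <= X ^+ `|k|%N.
Proof.
move=> x0; have nx : 0 < `|x| by rewrite normr_gt0.
have nv : 0 < `|x|^-1 by rewrite invr_gt0.
pose X := 1 + `|x| + `|x|^-1.
have X1 : 1 <= X by rewrite /X -addrA lerDl addr_ge0 // ltW.
have X0 : 0 <= X by apply: le_trans X1; exact: ler01.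
have h1 : `|x| <= X by rewrite /X addrAC lerDr addr_ge0 // ltW.
have h2 : `|x|^-1 <= X by rewrite /X lerDr addr_ge0.
exists X => // - [] n.
  by rewrite -exprnP normrX; apply: lerXn2r; rewrite ?nnegrE.
rewrite NegzE -exprnN (_ : `|- n.+1%:Z|%N = n.+1); last by lia.
rewrite normrV ?unitfE ?expf_neq0 // normrX -exprVn.
by apply: lerXn2r; rewrite ?nnegrE // ltW.
Qed.

Lemma ler1_double (X : K) : 1 <= X -> 1 <= 2 * X.
Proof.
move=> X1; apply: (le_trans X1); rewrite ler_peMl ?ler1n //.
exact: le_trans X1.
Qed.

Lemma rapid_geom a x : x != 0 -> rapid a -> geom (fun k => a k * x ^ k).
Proof.
move=> x0 ra; have [X X1 hX] := normXz_bound x0.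
have X0 : 0 < X by apply: lt_le_trans X1; exact: ltr01.
have [C hC] := ra _ (ler1_double X1).
exists C => k; rewrite ler_pdivlMr ?exprn_gt0 ?ltr0n //; apply: le_trans (hC k).
by rewrite normrM -mulrA ler_wpM2l // exprMn mulrC ler_wpM2l ?exprn_ge0 ?ler0n.
Qed.

Lemma rapid_scale a y : y != 0 -> rapid a -> rapid (fun k => a k * y ^ k).
Proof.
move=> y0 ra rho r1; have [Y Y1 hY] := normXz_bound y0.
have Y0 : 0 <= Y by apply: le_trans Y1; exact: ler01.
have r0 : 0 <= rho by apply: le_trans r1; exact: ler01.
have [|C hC] := ra (Y * rho).
  by apply: (le_trans r1); rewrite ler_peMl.
exists C => k; apply: le_trans (hC k).
by rewrite normrM -mulrA ler_wpM2l // exprMn ler_wpM2r ?exprn_ge0.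
Qed.

Lemma laurent_scale a f y : y != 0 -> laurent a f ->
  laurent (fun k => a k * y ^ k) (fun x => f (y * x)).
Proof.
move=> y0 [ra ha]; split; first exact: rapid_scale.
move=> x x0; apply: zsums_ext (ha (y * x) _) => [k|]; last by rewrite mulf_neq0.
by rewrite expfzMl mulrA.
Qed.

Lemma laurent_inv a f : laurent a f -> laurent (fun k => a (- k)) (fun x => f x^-1).
Proof.
move=> [ra ha]; split.
  by move=> rho /ra [C hC]; exists C => k; have := hC (- k); rewrite abszN.
move=> x x0; have xV0 : x^-1 != 0 by rewrite invr_eq0.
have [C hC] := rapid_geom xV0 ra; have z1 := zsums_refl (ha _ xV0).
have g1 : geom (fun k => a (- 1 - k) * x^-1 ^ (- 1 - k)).
  by exists (C * 2); exact: (geomb_refl hC).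
have [_ ] := geom_shift_zsums Kc (- 1) g1 z1.
apply: zsums_ext => k; rewrite (_ : -1 - (k + -1) = - k); last by ring.
by rewrite exprz_inv opprK.
Qed.

(** The spare factor [2^-|k|] makes convolutions summable in [k]. *)
Lemma rapid_prod_bound a b : rapid a -> rapid b -> forall rho : K, 1 <= rho ->
  exists2 D : K, 0 <= D & forall k l, `|a k * b l| <= D / 2 ^+ `|k|%N / rho ^+ `|k|%N / rho ^+ `|l|%N.
Proof.
move=> ra rb rho r1; have r0 : 0 < rho by apply: lt_le_trans r1; exact: ltr01.
have [A hA] := ra _ (ler1_double r1).
have [B hB] := rb rho r1.
have A0 : 0 <= A by apply: le_trans (hA 0); rewrite mulr_ge0 // exprn_ge0 // mulr_ge0 ?ler0n ?ltW.
have B0 : 0 <= B by apply: le_trans (hB 0); rewrite mulr_ge0 // exprn_ge0 // ltW.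
exists (A * B) => [|k l]; first exact: mulr_ge0.
rewrite !ler_pdivlMr ?exprn_gt0 ?ltr0n // normrM.
have -> : `|a k| * `|b l| * rho ^+ `|l|%N * rho ^+ `|k|%N * 2 ^+ `|k|%N =
  (`|a k| * (2 * rho) ^+ `|k|%N) * (`|b l| * rho ^+ `|l|%N) by rewrite exprMn; ring.
by rewrite ler_pM // mulr_ge0 // exprn_ge0 // ?mulr_ge0 ?ler0n ?ltW.
Qed.

(** From [|N| <= |k| + |N - k|]. *)
Lemma conv_bound a b : rapid a -> rapid b -> forall rho : K, 1 <= rho ->
  exists2 D : K, 0 <= D & forall N k, `|a k * b (N - k)| <= D / 2 ^+ `|k|%N / rho ^+ `|N|%N.
Proof.
move=> ra rb rho r1; have [D D0 hD] := rapid_prod_bound ra rb r1.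
have r0 : 0 < rho by apply: lt_le_trans r1; exact: ltr01.
exists D => // N k; apply: le_trans (hD _ _) _.
rewrite -[X in X <= _]mulrA ler_wpM2l ?divr_ge0 ?exprn_ge0 ?ler0n //.
rewrite -invfM -exprD lef_pV2 ?posrE ?exprn_gt0 //; apply: ler_weXn2l => //; lia.
Qed.

Lemma conv_geom a b : rapid a -> rapid b -> forall N, geom (fun k => a k * b (N - k)).
Proof.
move=> ra rb N; have [D D0 hD] := conv_bound ra rb (lexx 1).
by exists D => k; have := hD N k; rewrite expr1n divr1.
Qed.

(** Exchange of sums for [a_k x^k b_(N-k) x^(N-k)]: summing over [N] first and
    shifting by [k] gives the product of the two sums. *)
Lemma laurentM a b f g : laurent a f -> laurent b g ->
  exists c, laurent c (fun x => f x * g x) /\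
    forall N, zsums (fun k => a k * b (N - k)) (c N).
Proof.
move=> [ra ha] [rb hb].
have /choice [c hc] : forall N : int, exists s, zsums (fun k => a k * b (N - k)) s.
  by move=> N; have [C hC] := conv_geom ra rb N; exact: zsums_exist hC.
exists c; split=> //; split.
  move=> rho r1; have [D D0 hD] := conv_bound ra rb r1.
  have r0 : 0 < rho by apply: lt_le_trans r1; exact: ltr01.
  exists (D * 3) => N; rewrite -ler_pdivlMr ?exprn_gt0 //.
  rewrite [X in _ <= X]mulrAC.
  apply: zsums_norm (hc N) => k; rewrite [X in _ <= X]mulrAC; exact: hD.
move=> x x0; have [X X1 hX] := normXz_bound x0.
have X0 : 0 < X by apply: lt_le_trans X1; exact: ltr01.
have X21 := ler1_double X1.
have [D D0 hD] := rapid_prod_bound ra rb X21.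
pose u k N := (a k * x ^ k) * (b (N - k) * x ^ (N - k)).
have bu k N : `|u k N| <= D / 2 ^+ `|k|%N / 2 ^+ `|N|%N.
  rewrite /u mulrACA -expfzDr // (addrC k) subrK; set l := N - k.
  have h1 : `|x ^ N| <= X ^+ `|k|%N * X ^+ `|l|%N.
    have -> : N = k + l by rewrite /l addrC subrK.
    by rewrite expfzDr // normrM ler_pM.
  rewrite normrM; apply: le_trans (ler_pM _ _ (hD _ _) h1) _ => //.
  rewrite !exprMn.
  have -> : D / 2 ^+ `|k| / (2 ^+ `|k| * X ^+ `|k|) / (2 ^+ `|l| * X ^+ `|l|) *
    (X ^+ `|k| * X ^+ `|l|) = D / 2 ^+ `|k| / (2 ^+ `|k| * 2 ^+ `|l|) :> K.
    by field; rewrite !expf_neq0 ?pnatr_eq0 // gt_eqF.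
  rewrite ler_wpM2l ?divr_ge0 ?exprn_ge0 ?ler0n // -exprD lef_pV2 ?posrE ?exprn_gt0 ?ltr0n //.
  by apply: ler_weXn2l; rewrite ?ler1n //; lia.
apply: (zsums_fubini (u := u) Kc bu (r := fun k => (a k * x ^ k) * g x)).
- move=> k; apply: zsumsZ.
  by have [] := geom_shift_zsums Kc (- k) (rapid_geom x0 rb) (hb x x0).
- move=> N; have := zsumsZ (c := x ^ N) (hc N); rewrite mulrC; apply: zsums_ext => k.
  by rewrite /u mulrACA -expfzDr // (addrC k) subrK mulrC.
- have := zsumsZ (c := g x) (ha x x0); rewrite mulrC; apply: zsums_ext => k.
  by rewrite mulrC.
Qed.

(** Shift the summation index by [M]: in [a_(k+M) b_(N-k+1)] the two powers of
    [p] multiply to [p^N], whatever [k] is. *)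
Lemma conv_recursion a b c (M : int) (p s t : K) : p != 0 -> rapid a -> rapid b ->
  (forall k, a (k + M) = s * p ^ k * a k) -> (forall k, b (k + 1) = t * p ^ k * b k) ->
  (forall N, zsums (fun k => a k * b (N - k)) (c N)) ->
  forall N, c (N + (M + 1)) = s * t * p ^ N * c N.
Proof.
move=> p0 ra rb ea eb hc N.
have [_ h1] := geom_shift_zsums Kc M (conv_geom ra rb _) (hc (N + (M + 1))).
apply: zsums_uniq h1 _; apply: zsums_ext (zsumsZ (c := s * t * p ^ N) (hc N)) => k.
rewrite ea (_ : N + (M + 1) - (k + M) = N - k + 1); last by ring.
rewrite eb -[N in p ^ N](subrK k) expfzDr //; ring.
Qed.

End Laurent.

(** * Laurent expansions of the q-Pochhammer symbol and of theta *)

Section Euler.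
Local Open Scope classical_set_scope.
Variable K : numFieldType.
Hypothesis Kc : geometric_complete K.
Variable q : K.
Hypotheses (q0 : q != 0) (q1 : `|q| < 1).

Lemma cvgn_shift N (v : nat -> K) (l : K) :
  (fun n => v (n + N)%N) @ \oo --> l <-> v @ \oo --> l.
Proof. by have := cvg_shiftn N v (nbhs l); rewrite /cvg_to => <-. Qed.

Lemma normXn_lt1 n : (0 < n)%N -> `|q ^+ n| < 1.
Proof. by case: n => // n _; rewrite normrX exprn_ilt1. Qed.

Lemma subr1X_neq0 n : (0 < n)%N -> 1 - q ^+ n != 0.
Proof.
move=> /normXn_lt1; apply: contraTneq => /eqP; rewrite subr_eq0 => /eqP <-.
by rewrite normr1 ltxx.
Qed.

(** The coefficients [(-1)^k q^(k(k-1)/2) / (q; q)_k] of Euler's expansion of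
    [(x; q)_oo], extended by 0. *)
Definition euler_coef (k : int) : K :=
  if k is Posz n then \prod_(j < n) (- q ^+ j / (1 - q ^+ j.+1)) else 0.

(** The equation [F(x) = (1 - x) F(q x)] read on coefficients. *)
Lemma euler_coefE (k : int) :
  euler_coef k = q ^ k * euler_coef k - q ^ (k - 1) * euler_coef (k - 1).
Proof.
case: k => [[|n]|n].
- by rewrite (_ : 0%:Z - 1 = Negz 0) //= big_ord0 expr0z mulr0 subr0 mulr1.
- rewrite (_ : n.+1%:Z - 1 = n%:Z); last by lia.
  rewrite /= big_ord_recr /= -!exprnP.
  set P := \prod_(_ < n) _; have := subr1X_neq0 (ltn0Sn n).
  by move=> h; field.
- by rewrite (_ : Negz n - 1 = Negz n.+1) /= ?mulr0 ?subr0 //; lia.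
Qed.

(** The ratio of consecutive terms is at most [rho |q|^k / (1 - |q|)], which is
    eventually below 1. *)
Lemma euler_coef_rapid : rapid euler_coef.
Proof.
move=> rho r1; have r0 : 0 < rho by apply: lt_le_trans r1; exact: ltr01.
pose w k : K := `|euler_coef k%:Z| * rho ^+ k.
have w0 k : 0 <= w k by rewrite mulr_ge0 // exprn_ge0 // ltW.
have e0 : 0 < (1 - `|q|) / rho by rewrite divr_gt0 // subr_gt0.
have /cvgrPdist_le /(_ _ e0) [k0 _ hk0] := expr_cvg0 Kc q1.
have step k : (k0 <= k)%N -> w k.+1 <= w k.
  move=> hk; have := hk0 k hk; rewrite /= sub0r normrN ler_pdivlMr // => h.
  rewrite /w /= big_ord_recr /= normrM (exprS rho).
  set P := `|\prod_(_ < k) _|.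
  rewrite (mulrC P) mulrACA.
  rewrite ler_piMl ?(mulr_ge0 _ (exprn_ge0 _ (ltW r0))) ?normr_ge0 //.
  have l1 : 1 - `|q| <= `|1 - q ^+ k.+1|.
    rewrite (le_trans _ (lerB_dist _ _)) // normr1 lerD2l lerN2 normrX.
    by rewrite exprS ler_piMr // exprn_ile1 // ltW.
  have l0 : 0 < `|1 - q ^+ k.+1| by rewrite normr_gt0 subr1X_neq0.
  by rewrite normrM normrN normrV ?unitfE -?normr_gt0 // mulrAC ler_pdivrMr // mul1r (le_trans h).
pose C := \sum_(j < k0.+1) w j.
have wC k : w k <= C.
  have small j : (j <= k0)%N -> w j <= C.
    move=> hj; rewrite /C (bigD1 (Ordinal (hj : (j < k0.+1)%N))) //= lerDl.
    by apply: sumr_ge0 => i _; exact: w0.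
  have [|hk] := leqP k k0; first exact: small.
  rewrite -(subnKC (ltnW hk)); elim: (k - k0)%N => [|d IH]; first by rewrite addn0 small.
  by rewrite addnS (le_trans _ IH) // step // leq_addr.
exists C => -[n|n]; first exact: wC.
by rewrite /= normr0 mul0r sumr_ge0.
Qed.

Let F (x : K) : K := limn (series (zterm (fun k => euler_coef k * x ^ k))).

Let Fsum x : x != 0 -> zsums (fun k => euler_coef k * x ^ k) (F x).
Proof.
move=> x0; have [C hC] := rapid_geom x0 euler_coef_rapid.
by have [s hs] := zsums_exist Kc hC; rewrite /F (cvg_lim_eq hs).
Qed.

Let Frec x : x != 0 -> F x = (1 - x) * F (q * x).
Proof.
move=> x0; have qx0 : q * x != 0 by rewrite mulf_neq0.
have h := Fsum qx0.
have [_ h1] := geom_shift_zsums Kc (- 1) (rapid_geom qx0 euler_coef_rapid) h.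
apply: zsums_uniq (Fsum x0) _.
rewrite mulrBl mul1r -mulNr.
apply: zsums_ext (zsumsD h (zsumsZ (c := - x) h1)) => k.
rewrite [in RHS]euler_coefE !expfzMl.
have -> : x ^ k = x * x ^ (k - 1) by rewrite -{2}[x]expr1z -expfzDr // addrC subrK.
ring.
Qed.

Let Fprod x M : x != 0 -> F x = \prod_(0 <= j < M) (1 - x * q ^+ j) * F (q ^+ M * x).
Proof.
move=> x0; elim: M => [|M IH]; first by rewrite big_geq // expr0 !mul1r.
rewrite IH big_nat_recr //= Frec ?mulf_neq0 ?expf_neq0 //.
by rewrite mulrA (mulrC x) mulrA -exprS.
Qed.

(** A quantitative form of the continuity of [F] at 0, where its value is 1. *)
Let Fnear0 : exists C : K, forall y, y != 0 -> `|y| <= 1 -> `|F y - 1| <= `|y| * C.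
Proof.
have [C hC] := euler_coef_rapid (ler1_double (lexx 1)).
exists (C * 3) => y y0 y1.
pose v k : K := if k is Posz n then euler_coef n.+1%:Z * y ^+ n else 0.
have C0 : 0 <= C by apply: le_trans (hC 0); rewrite mulr_ge0.
have gv : geomb C v.
  case=> n; last by rewrite normr0 divr_ge0 ?exprn_ge0.
  rewrite /v ler_pdivlMr ?exprn_gt0 ?ltr0n // normrM.
  apply: le_trans (hC n.+1%:Z); rewrite mulr1 -mulrA ler_wpM2l //.
  rewrite -[X in _ <= X]mul1r ler_pM ?exprn_ge0 //.
    by rewrite normrX exprn_ile1.
  by apply: ler_weXn2l; rewrite ?ler1n.
have [G hG] := zsums_exist Kc gv.
have hF : zsums (fun k => euler_coef k * y ^ k) (1 + y * G).
  apply/(cvgn_shift 1).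
  have hG' : (fun n => 1 + y * series (zterm v) n) @ \oo --> (1 + y * G : K).
    exact: cvgD (cvg_cst _) (cvgM (cvg_cst _) hG).
  apply: (eq_cvgn _ hG') => n; rewrite addn1 /series /=.
  rewrite big_nat_recl //= [zterm _ 0]/zterm /= big_ord0 mul0r addr0 mulr1; congr (_ + _).
  rewrite mulr_sumr; apply: eq_bigr => i _.
  by rewrite /zterm /v /= mul0r !addr0 mulrCA -exprS.
rewrite (zsums_uniq (Fsum y0) hF) addrC addKr normrM ler_wpM2l //.
exact: (zsums_norm gv hG).
Qed.

Let Flim x : x != 0 -> (fun M => F (q ^+ M * x)) @ \oo --> (1 : K).
Proof.
move=> x0; have [C hC] := Fnear0.
have h0 : (fun M => q ^+ M * x) @ \oo --> (0 : K).
  by rewrite -(mul0r x); apply: cvgM (expr_cvg0 Kc q1) (cvg_cst _).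
have C0 : 0 <= C.
  have := hC 1 (oner_neq0 _); rewrite normr1 lexx mul1r => /(_ isT).
  exact: le_trans.
apply/cvgrPdist_le => e e0.
have e2 : 0 < e / (C + 1) by rewrite divr_gt0 // ltr_wpDl.
have /cvgrPdist_le h := h0.
near=> M.
have h1 : `|q ^+ M * x| <= 1.
  by rewrite -normrN -sub0r; near: M; apply: h; exact: ltr01.
have h2 : `|q ^+ M * x| <= e / (C + 1).
  by rewrite -normrN -sub0r; near: M; apply: h.
rewrite distrC (le_trans (hC _ _ h1)) ?mulf_neq0 ?expf_neq0 //.
rewrite (le_trans (ler_wpM2r C0 h2)) // mulrAC ler_pdivrMr ?ltr_wpDl //.
by rewrite ler_wpM2l ?lerDl ?ltW.
Unshelve. all: by end_near.
Qed.

Lemma cvg_neq0_near (v : nat -> K) (l : K) : l != 0 -> v @ \oo --> l ->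
  exists N, forall n, (N <= n)%N -> v n != 0.
Proof.
move=> l0 /cvgrPdist_lt /(_ `|l|); rewrite normr_gt0 => /(_ l0) [N _ hN].
exists N => n hn; apply/eqP => vn; have := hN n hn.
by rewrite /= vn subr0 ltxx.
Qed.

(** In [F x = prod_(j < M) (1 - x q^j) * F (q^M x)] the last factor tends to 1. *)
Lemma qpoch_cvg x : (fun N => \prod_(0 <= j < N) (1 - x * q ^+ j)) @ \oo --> (qpoch x q : K).
Proof.
suff : exists l, (fun N => \prod_(0 <= j < N) (1 - x * q ^+ j)) @ \oo --> (l : K).
  by move=> [l hl]; rewrite /qpoch (cvg_lim_eq hl).
have [->|x0] := eqVneq x 0.
  exists 1; apply: eq_cvgn (cvg_cst (1 : K)) => n.
  by rewrite big1 // => i _; rewrite mul0r subr0.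
exists (F x / 1); have [N hN] := cvg_neq0_near (oner_neq0 _) (Flim x0).
apply/(cvgn_shift N).
have h : (fun n => F x / F (q ^+ (n + N) * x)) @ \oo --> (F x / 1 : K).
  have h' := (cvgn_shift N (fun n => F (q ^+ n * x)) 1).2 (Flim x0).
  exact: (cvgM (cvg_cst (F x)) (cvgV (oner_neq0 _) h')).
apply: eq_cvgn h => n; rewrite (Fprod (n + N) x0) mulfK //; apply: hN; exact: leq_addl.
Qed.

Lemma qpoch_sum x : x != 0 -> zsums (fun k => euler_coef k * x ^ k) (qpoch x q).
Proof.
move=> x0; suff -> : qpoch x q = F x by exact: Fsum.
have h : (fun N => \prod_(0 <= j < N) (1 - x * q ^+ j) * F (q ^+ N * x)) @ \oo --> (qpoch x q * 1 : K).
  exact: (cvgM (@qpoch_cvg x) (Flim x0)).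
rewrite -[LHS]mulr1; apply: (cvg_uniq h); apply: (eq_cvgn _ (cvg_cst (F x))) => n.
by rewrite -Fprod.
Qed.

Lemma qpoch_neq0 x : (forall j, x * q ^+ j != 1) -> qpoch x q != 0.
Proof.
move=> hx; have [x0|x0] := eqVneq x 0.
  suff -> : qpoch x q = 1 by exact: oner_neq0.
  apply: (cvg_uniq (@qpoch_cvg x)); apply: (eq_cvgn _ (cvg_cst (1 : K))) => n.
  by rewrite big1 // => i _; rewrite x0 mul0r subr0.
have -> : qpoch x q = F x by apply: zsums_uniq (qpoch_sum x0) (Fsum x0).
have [N hN] := cvg_neq0_near (oner_neq0 _) (Flim x0).
rewrite (Fprod N x0) mulf_neq0 ?hN // prodf_seq_neq0; apply/allP => j _ /=.
by rewrite subr_eq0 eq_sym hx.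
Qed.

Lemma qpoch_laurent : laurent euler_coef (fun x => qpoch x q).
Proof. by split; [exact: euler_coef_rapid|exact: qpoch_sum]. Qed.

Lemma theta_neq0 x : x != 0 -> (forall j : int, x != q ^ j) -> theta x q != 0.
Proof.
move=> x0 hx; rewrite /theta mulf_neq0 // qpoch_neq0 // => j.
  apply: contraNneq (hx (- j%:Z)) => e; apply/eqP.
  rewrite -invr_expz -exprnP; apply: (mulIf (expf_neq0 j q0)).
  by rewrite e mulVf // expf_neq0.
apply: contraNneq (hx (j.+1%:Z)) => e; apply/eqP.
by rewrite -exprnP exprS -[LHS]mulr1 -e; field.
Qed.

Lemma thetaN1_neq0 : theta (- 1) q != 0.
Proof.
have h j : (0 < j)%N -> - 1 != q ^+ j.
  by move=> /normXn_lt1; apply: contraTneq => <-; rewrite normrN1 ltxx.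
apply: theta_neq0; first by rewrite oppr_eq0 oner_eq0.
case=> [[|j]|j].
- by rewrite expr0z -subr_eq0 -opprD oppr_eq0 (pnatr_eq0 _ 2).
- exact: h.
- rewrite NegzE -exprnN; apply: contraNneq (h j.+1 isT) => e.
  by rewrite -[q ^+ _]invrK -e invrN1.
Qed.

(** Let [e] and [g] be the coefficients of [(x; q)_oo] and [(q/x; q)_oo], let [b]
    be the convolution of [e] and [g], and [c] that of [q^k e_k] and [g]. The
    functional equations of the two factors give [b_N = c_N - c_(N-1)] and
    [q^N b_N = c_N - c_(N+1)], whence the recursion. It would make [b] vanish
    identically if [b_0 = 0], but [theta(-1; q) <> 0]. *)
Lemma theta_laurent : exists2 b, laurent b (fun x => theta x q) &
  b 0 != 0 /\ forall k, b (k + 1) = - 1 * q ^ k * b k.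
Proof.
have Lf := qpoch_laurent.
have Lg : laurent (fun k => euler_coef (- k) * q ^ (- k)) (fun x => qpoch (q / x) q).
  exact: (laurent_inv Kc (laurent_scale q0 Lf)).
set g := fun k : int => _ in Lg.
have [b [Lb hb]] := laurentM Kc Lf Lg.
have [c [_ hc]] := laurentM Kc (laurent_scale q0 Lf) Lg.
have gc N := conv_geom (laurent_scale q0 Lf).1 Lg.1 N.
have hg k : q ^ k * g k = g k - g (k + 1).
  rewrite /g [in LHS]euler_coefE opprD !expfzDr // -!invr_expz.
  have h : q ^ k != 0 by rewrite expfz_neq0.
  by rewrite expr1z; field; rewrite h q0.
have e1 N : b N = c N - c (N - 1).
  apply: zsums_uniq (hb N) _.
  have [_ h1] := geom_shift_zsums Kc (- 1) (gc (N - 1)) (hc (N - 1)).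
  rewrite -[X in _ - X]mul1r -mulNr.
  apply: zsums_ext (zsumsD (hc N) (zsumsZ (c := - 1) h1)) => k.
  rewrite (_ : N - 1 - (k + - 1) = N - k); last by ring.
  rewrite [in RHS]euler_coefE; ring.
have e2 N : q ^ N * b N = c N - c (N + 1).
  apply: zsums_uniq (zsumsZ (c := q ^ N) (hb N)) _.
  rewrite -[X in _ - X]mul1r -mulNr.
  apply: zsums_ext (zsumsD (hc N) (zsumsZ (c := - 1) (hc (N + 1)))) => k.
  rewrite (_ : N + 1 - k = N - k + 1); last by ring.
  have := hg (N - k); rewrite expfzDr // -invr_expz => h.
  have qk : q ^ k != 0 by rewrite expfz_neq0.
  rewrite (_ : g (N - k + 1) = g (N - k) - q ^ N / q ^ k * g (N - k)); last by rewrite h; ring.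
  by field.
have rec k : b (k + 1) = - 1 * q ^ k * b k.
  by rewrite mulN1r mulNr e2 e1 addrK opprB.
exists b => //; split=> //; apply: contraTneq (thetaN1_neq0) => b0.
have bz (k : int) : b k = 0.
  elim: k => [//|k IH|k IH]; first by rewrite intS addrC rec IH mulr0.
  have := rec (- k.+1%:Z); rewrite (_ : - k.+1%:Z + 1 = - k%:Z); last by lia.
  rewrite IH => /esym/eqP; rewrite !mulf_eq0 oppr_eq0 oner_eq0 (negbTE (expfz_neq0 _ q0)) /=.
  by move/eqP.
have N0 : - 1 != 0 :> K by rewrite oppr_eq0 oner_eq0.
rewrite negbK; apply/eqP; apply: zsums_uniq (Lb.2 _ N0) _.
apply: eq_cvgn (cvg_cst (0 : K)) => n; rewrite /series /= big1 // => i _.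
by rewrite /zterm !bz !mul0r addr0.
Qed.

End Euler.

(** * Theta identities and theta functions of degree N *)

Section ThetaIdentities.
Local Open Scope classical_set_scope.
Variable K : numFieldType.
Hypothesis Kc : geometric_complete K.
Implicit Types (p q x y a : K).

Lemma qpoch_rec q x : q != 0 -> `|q| < 1 -> qpoch x q = (1 - x) * qpoch (q * x) q.
Proof.
move=> q0 q1; apply: (cvg_uniq (@qpoch_cvg _ Kc _ q0 q1 x)); apply/(cvgn_shift 1).
apply: (eq_cvgn _ (cvgM (cvg_cst (1 - x)) (@qpoch_cvg _ Kc _ q0 q1 (q * x)))) => n.
rewrite addn1 big_nat_recl //= expr0 mulr1; congr (_ * _).
by apply: eq_bigr => j _; rewrite exprS mulrCA mulrA.
Qed.

Lemma theta_compl q x : q != 0 -> x != 0 -> theta (q / x) q = theta x q.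
Proof.
move=> q0 x0; rewrite /theta mulrC.
have -> // : q / (q / x) = x by rewrite invf_div mulrCA mulfV // mulr1.
Qed.

Lemma theta_shift q x : q != 0 -> `|q| < 1 -> x != 0 ->
  theta (q * x) q = - x^-1 * theta x q.
Proof.
move=> q0 q1 x0; rewrite /theta (qpoch_rec x q0 q1).
have -> : q / (q * x) = x^-1 by rewrite invfM mulrA mulfV // mul1r.
rewrite (qpoch_rec x^-1 q0 q1); field.
exact: x0.
Qed.

Lemma thetaV q x : q != 0 -> `|q| < 1 -> x != 0 -> theta x^-1 q = - x^-1 * theta x q.
Proof.
move=> q0 q1 x0; rewrite -theta_shift // -[RHS]theta_compl ?mulf_neq0 //.
by rewrite invfM mulrA mulfV // mul1r.
Qed.

Lemma theta1 q : q != 0 -> `|q| < 1 -> theta 1 q = 0.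
Proof. by move=> q0 q1; rewrite /theta (qpoch_rec 1) // subrr !mul0r. Qed.

Lemma cvgn_prod (I : Type) (r : seq I) (v : I -> nat -> K) (l : I -> K) :
  (forall i, v i @ \oo --> l i) ->
  (fun n => \prod_(i <- r) v i n) @ \oo --> (\prod_(i <- r) l i : K).
Proof. by move=> h; apply: cvg_big => [|i _]; [exact: mul_continuous|exact: h]. Qed.

Lemma cvgn_sub (k : nat -> nat) (v : nat -> K) (l : K) :
  (forall n, n <= k n)%N -> v @ \oo --> l -> (fun n => v (k n)) @ \oo --> l.
Proof.
move=> hk /cvgrPdist_le h; apply/cvgrPdist_le => e e0.
have [n0 _ hn] := h e e0; exists n0 => // n /= hM; apply: hn => /=.
exact: leq_trans hM (hk n).
Qed.

(** The exponents [j + N l] with [j < N] run once through the natural numbers. *)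
Lemma qpoch_multisection p a N : p != 0 -> `|p| < 1 -> (0 < N)%N ->
  \prod_(j < N) qpoch (a * p ^+ j) (p ^+ N) = qpoch a p.
Proof.
move=> p0 p1 N0; have q0 : p ^+ N != 0 by rewrite expf_neq0.
have q1 := normXn_lt1 p1 N0.
have h : (fun M => \prod_(j < N) \prod_(0 <= i < M) (1 - a * p ^+ j * (p ^+ N) ^+ i)) @ \oo
     --> (\prod_(j < N) qpoch (a * p ^+ j) (p ^+ N) : K).
  by apply: cvgn_prod => j; exact: qpoch_cvg.
apply: (cvg_uniq h).
have h2 := cvgn_sub (k := fun M => (N * M)%N) _ (@qpoch_cvg _ Kc _ p0 p1 a).
apply: (eq_cvgn _ (h2 _)) => [M|n]; last by rewrite leq_pmull.
elim: M => [|M IH]; first by rewrite muln0 big_geq // big1 // => j _; rewrite big_geq.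
under [RHS]eq_bigr do rewrite big_nat_recr //=.
rewrite big_split /= -IH mulnS addnC (big_cat_nat _ (n := (N * M)%N)) ?leq_addr //=.
congr (_ * _); rewrite -{1}[(N * M)%N]add0n big_addn addnC addnK big_mkord.
by apply: eq_bigr => j _; rewrite exprD exprM mulrA.
Qed.

Lemma theta_multisection p a N : p != 0 -> `|p| < 1 -> (0 < N)%N -> a != 0 ->
  \prod_(j < N) theta (a * p ^+ j) (p ^+ N) = theta a p.
Proof.
move=> p0 p1 N0 a0; rewrite /theta big_split /= qpoch_multisection //; congr (_ * _).
rewrite -(qpoch_multisection (p / a) p0 p1 N0) (reindex_inj rev_ord_inj) /=.
apply: eq_bigr => j _; congr qpoch; have hj := ltn_ord j.
rewrite -{1}(subnK hj) addnS exprS exprD; have h : p ^+ (N - j.+1) != 0 by rewrite expf_neq0.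
by field; rewrite h a0.
Qed.

Lemma qpoch_sqr q x : q != 0 -> `|q| < 1 ->
  qpoch (x ^+ 2) (q ^+ 2) = qpoch x q * qpoch (- x) q.
Proof.
move=> q0 q1; have q20 : q ^+ 2 != 0 by rewrite expf_neq0.
have q21 := normXn_lt1 q1 (isT : 0 < 2)%N.
apply: (cvg_uniq (@qpoch_cvg _ Kc _ q20 q21 (x ^+ 2))).
apply: (eq_cvgn _ (cvgM (@qpoch_cvg _ Kc _ q0 q1 x) (@qpoch_cvg _ Kc _ q0 q1 (- x)))) => n.
rewrite -[LHS]/((\prod_(0 <= j < n) (1 - x * q ^+ j)) * (\prod_(0 <= j < n) (1 - - x * q ^+ j))).
by rewrite -big_split /=; apply: eq_bigr => j _; rewrite -exprM mulnC exprM; ring.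
Qed.

Lemma theta_sqr q x : q != 0 -> `|q| < 1 ->
  theta (x ^+ 2) (q ^+ 2) = theta x q * theta (- x) q.
Proof.
move=> q0 q1; rewrite /theta -expr_div_n !qpoch_sqr // invrN mulrN; ring.
Qed.

(** The bisection of the theta function with base [r]. *)
Lemma theta_sqrt p r x : p != 0 -> `|p| < 1 -> r ^+ 2 = p -> x != 0 ->
  theta x r = theta x p * theta (r * x) p.
Proof.
move=> p0 p1 hr x0.
have r0 : r != 0 by apply: contra_neq p0 => r0; rewrite -hr r0 expr0n.
have r1 : `|r| < 1.
  by rewrite -(@expr_lt1 _ 2) // -normrX hr.
by rewrite -(theta_multisection r0 r1 (isT : 0 < 2)%N x0) big_ord_recl big_ord1 /=
   expr0 mulr1 expr1 hr [x * r]mulrC.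
Qed.

End ThetaIdentities.

Section Span.
Local Open Scope classical_set_scope.
Variable K : numFieldType.
Hypothesis Kc : geometric_complete K.
Variable p : K.
Hypotheses (p0 : p != 0) (p1 : `|p| < 1).

(** The theta function of degree [N] whose Laurent exponents are congruent to [m]
    modulo [N]. *)
Definition theta_basis (N : nat) (c : K) (m : int) (x : K) : K :=
  x ^ m * theta (c * p ^ m * x ^+ N) (p ^+ N).

Lemma theta_basis_period N c m x : (0 < N)%N -> c != 0 -> x != 0 ->
  theta_basis N c (m + N%:Z) x = - (c * p ^ m)^-1 * theta_basis N c m x.
Proof.
move=> N0 c0 x0; have pm : p ^ m != 0 by rewrite expfz_neq0.
rewrite /theta_basis !expfzDr // -!exprnP.
rewrite (_ : c * (p ^ m * p ^+ N) * x ^+ N = p ^+ N * (c * p ^ m * x ^+ N)); last by ring.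
rewrite (theta_shift Kc) ?expf_neq0 ?mulf_neq0 ?normXn_lt1 ?expf_neq0 //.
have xN : x ^+ N != 0 by rewrite expf_neq0.
by field; rewrite c0 pm xN.
Qed.

(** The condition on [c] says that reflection preserves the coefficient recursion
    [a_(k+N) = - c p^k a_k]. *)
Lemma theta_basis_reflect N c (sg m : int) x : c != 0 -> x != 0 -> c ^+ 2 * p ^ sg = p ^+ N ->
  x ^ sg * theta_basis N c m x^-1 = theta_basis N c (sg - m) x.
Proof.
move=> c0 x0 hc; have pm : p ^ m != 0 by rewrite expfz_neq0.
have xN : x ^+ N != 0 by rewrite expf_neq0.
have y0 : c * p ^ m * x^-1 ^+ N != 0.
  by rewrite !mulf_neq0 // expf_neq0 // invr_eq0.
have e : p ^+ N / (c * p ^ m * x^-1 ^+ N) = c * p ^ (sg - m) * x ^+ N.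
  rewrite -hc expfzDr // -invr_expz exprVn; field.
  by rewrite pm xN c0.
by rewrite /theta_basis -(theta_compl (expf_neq0 N p0) y0) e (expfzDr _ _ x0) exprz_inv mulrA.
Qed.

Lemma int_rec_eq (A B s : int -> K) : (forall l, s l != 0) ->
  (forall l, A (l + 1) = s l * A l) -> (forall l, B (l + 1) = s l * B l) ->
  A 0 = B 0 -> forall l, A l = B l.
Proof.
move=> s0 hA hB h0; elim=> [//|l IH|l IH]; first by rewrite intS addrC hA hB IH.
apply: (mulfI (s0 (- l.+1%:Z))); rewrite -hA -hB.
by rewrite (_ : - l.+1%:Z + 1 = - l%:Z) //; lia.
Qed.

(** On a residue class modulo [N] the recursion is the one satisfied by the
    coefficients of [theta(.; p^N)], so the class contributes a multiple of
    [theta_basis]. *)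
Lemma laurent_span N c (a : int -> K) f (w : int) : (0 < N)%N -> c != 0 ->
  laurent a f -> (forall k, a (k + N%:Z) = - c * p ^ k * a k) ->
  exists al : 'I_N -> K, forall x, x != 0 ->
    f x = \sum_(j < N) al j * theta_basis N c (w + j%:Z) x.
Proof.
move=> N0 c0 [ra ha] rec.
have q0 : p ^+ N != 0 by rewrite expf_neq0.
have q1 := normXn_lt1 p1 N0.
have [b [rb hb] [b0 brec]] := theta_laurent Kc q0 q1.
have coefE m l : a (m + N%:Z * l) = a m / b 0 * (b l * (c * p ^ m) ^ l).
  have pm : p ^ m != 0 by rewrite expfz_neq0.
  apply: (int_rec_eq (A := fun l => a (m + N%:Z * l))
    (B := fun l => a m / b 0 * (b l * (c * p ^ m) ^ l))
    (s := fun l => - c * p ^ (m + N%:Z * l))) => [k|k|k|].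
  - by rewrite mulf_neq0 ?oppr_eq0 ?expfz_neq0.
  - by rewrite -rec; congr a; ring.
  - rewrite brec expfzDr ?mulf_neq0 // expr1z expfzDr // -exprz_exp -exprnP; ring.
  - by rewrite mulr0 addr0 expr0z mulr1 divfK.
exists (fun j => a (w + j%:Z) / b 0) => x x0.
have [_ hs] := geom_shift_zsums Kc w (rapid_geom x0 ra) (ha x x0).
suff h (j : nat) : zsums (fun l => a (j%:Z + N%:Z * l + w) * x ^ (j%:Z + N%:Z * l + w))
    (a (w + j%:Z) / b 0 * theta_basis N c (w + j%:Z) x).
  exact: (zsums_residues N0 hs (fun j _ => h j)).
set m := w + j%:Z.
have y0 : c * p ^ m * x ^+ N != 0 by rewrite !mulf_neq0 ?expf_neq0 ?expfz_neq0.
rewrite /theta_basis mulrA; apply: zsums_ext (zsumsZ (hb _ y0)) => l.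
rewrite (_ : j%:Z + N%:Z * l + w = m + N%:Z * l); last by rewrite /m; ring.
rewrite coefE (expfzDr m (N%:Z * l) x0) -exprz_exp -exprnP [in LHS]expfzMl; ring.
Qed.

Lemma laurent_ext (a : int -> K) (f g : K -> K) : f =1 g -> laurent a f -> laurent a g.
Proof. by move=> /funext ->. Qed.

Lemma laurent_const1 : laurent (fun k : int => (k == 0)%:R : K) (fun=> 1).
Proof.
split=> [rho r1|x x0].
  exists 1 => k; case: eqP => [->|_]; first by rewrite normr1 expr0 mulr1.
  by rewrite normr0 mul0r ler01.
apply/(cvgn_shift 1); apply: (eq_cvgn _ (cvg_cst (1 : K))) => n.
rewrite addn1 /series /= big_nat_recl //= [zterm _ 0]/zterm /= expr0z mul0r mulr1 addr0.
by rewrite big1 ?addr0 // => i _; rewrite /zterm /= !mul0r addr0.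
Qed.

(** By induction on the number of factors, each of degree 1. *)
Lemma prod_theta_laurent (s : seq K) : all (fun a => a != 0) s ->
  exists2 a : int -> K, laurent a (fun x => \prod_(z <- s) theta (z * x) p) &
    forall k, a (k + (size s)%:Z) = (\prod_(z <- s) (- z)) * p ^ k * a k.
Proof.
elim: s => [_|z s IH /andP[z0 /IH [a la ra]]].
  exists (fun k : int => (k == 0)%:R).
    by apply: laurent_ext laurent_const1 => x; rewrite big_nil.
  move=> k; rewrite addr0 big_nil mul1r.
  by case: eqP => [->|_]; rewrite ?expr0z ?mulr0 ?mulr1.
have [b lb [_ rb]] := theta_laurent Kc p0 p1.
have [c [lc hc]] := laurentM Kc la (laurent_scale z0 lb).
exists c.
  by apply: laurent_ext lc => x; rewrite big_cons mulrC.
move=> k; rewrite big_cons mulrC [- z * _]mulrC mulrC /=.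
rewrite (_ : (size s).+1%:Z = (size s)%:Z + 1); last by rewrite -addn1 PoszD.
apply: (conv_recursion Kc (t := - z) p0 la.1 (laurent_scale z0 lb).1 ra _ hc) => l.
by rewrite rb expfzDr // expr1z; ring.
Qed.

(** The factor [x^-d] shifts all exponents by [d], which changes [c] by [p^d]. *)
Lemma prod_theta_span (s : seq K) (d : nat) (w : int) (c : K) :
  (0 < size s)%N -> all (fun a => a != 0) s ->
  c = - (\prod_(z <- s) (- z)) * p ^+ d ->
  exists al : 'I_(size s) -> K, forall x, x != 0 ->
    x ^- d * \prod_(z <- s) theta (z * x) p = \sum_j al j * theta_basis (size s) c (w + j%:Z) x.
Proof.
move=> s0 hs ec; have [a la ra] := prod_theta_laurent hs.
set P := \prod_(z <- s) (- z) in ec ra.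
have P0 : P != 0.
  rewrite prodf_seq_neq0; apply/allP => z zs /=; rewrite oppr_eq0; exact: (allP hs).
have [||al hal] := laurent_span (c := - P) (w + d%:Z) s0 _ la _.
- by rewrite oppr_eq0.
- by move=> k; rewrite opprK.
exists (fun j => al j) => x x0; rewrite hal // mulr_sumr; apply: eq_bigr => j _.
rewrite mulrCA; congr (_ * _); rewrite /theta_basis mulrA; congr (_ * theta (_ * _) _).
  rewrite addrAC [X in _ * X]expfzDr // mulrCA -exprnP mulVf ?mulr1 //.
  by rewrite expf_neq0.
by rewrite ec addrAC expfzDr // -exprnP; ring.
Qed.

End Span.

(** * Alternating functions of several variables *)

Section Alternating.
Variable F : numFieldType.
Variable n : nat.
Implicit Types (x b : 'I_n -> F) (i j : 'I_n).

Definition upd x i (y : F) : 'I_n -> F := fun j => if j == i then y else x j.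

Lemma upd_same x i : upd x i (x i) = x.
Proof. by apply/funext => j; rewrite /upd; case: eqP => [->|]. Qed.

Lemma upd_neq0 x i y : (forall j, x j != 0) -> y != 0 -> forall j, upd x i y j != 0.
Proof. by move=> hx hy j; rewrite /upd; case: (j == i); [exact: hy|exact: hx]. Qed.

Variable f : 'I_n -> F -> F.
Definition alternant x := \det (\matrix_(i, j) f j (x i)).
Definition coordwise_span (H : ('I_n -> F) -> F) := forall x i, (forall j, x j != 0) ->
  exists c : 'I_n -> F, forall y, y != 0 -> H (upd x i y) = \sum_j c j * f j y.

(** In each variable, [H] is determined by its values at the nodes [b i], because
    the matrix of the [f j (b i)] is invertible. So the variables can be replaced
    by nodes one at a time; once all of them are nodes, either two coincide or
    they form a permutation of [b]. *)
Lemma alternating_eq0 (H : ('I_n -> F) -> F) b : (forall i, b i != 0) ->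
  alternant b != 0 -> coordwise_span H ->
  (forall x i j, (forall k, x k != 0) -> i != j -> x i = x j -> H x = 0) ->
  (forall s : 'S_n, H (fun i => b (s i)) = 0) ->
  forall x, (forall i, x i != 0) -> H x = 0.
Proof.
move=> b0 db hspan halt hperm.
(* [m] bounds the indices of the variables that are not yet nodes. *)
suff key m x : (forall i, x i != 0) -> (forall i, (m <= i)%N -> exists k, x i = b k) -> H x = 0.
  by move=> x hx; apply: (key n x hx) => i; rewrite leqNgt ltn_ord.
elim: m x => [|m IH] x hx hm.
  have /choice [k hk] : forall i, exists k, x i = b k by move=> i; exact: hm.
  have [/injectiveP kinj|] := boolP (injectiveb k).
    rewrite -[RHS](hperm (perm kinj)); congr H; apply/funext => i.
    by rewrite permE.
  case/injectivePn => i [j ij e].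
  by apply: (halt x i j) => //; rewrite !hk e.
have [mn|nm] := ltnP m n; last first.
  by apply: IH => // i hi; have := ltn_ord i; rewrite ltnNge (leq_trans nm).
pose i := Ordinal mn.
have [c hc] := hspan x i hx.
have z k : H (upd x i (b k)) = 0.
  apply: IH => [|j mj]; first exact: upd_neq0.
  rewrite /upd; case: eqP => [_|/eqP ji]; first by exists k.
  by apply: hm; rewrite ltn_neqAle mj andbT; apply: contra_neq ji => e; exact: val_inj.
pose A := \matrix_(i, j) f j (b i); pose C := \col_j c j.
have factorA : A \in unitmx by rewrite unitmxE unitfE.
have AC : A *m C = 0.
  apply/matrixP => k l; rewrite !mxE -[RHS](z k) hc //.
  by apply: eq_bigr => j _; rewrite !mxE mulrC.
have C0 : C = 0 by rewrite -(mulKmx factorA C) AC mulmx0.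
rewrite -(upd_same x i) hc //; apply: big1 => j _.
by have := congr1 (fun M : 'cV_n => M j 0) C0; rewrite !mxE => ->; rewrite mul0r.
Qed.

Lemma alternant_perm x (s : 'S_n) : alternant (fun i => x (s i)) = (-1) ^+ s * alternant x.
Proof.
rewrite /alternant -det_perm -det_mulmx -row_permE; congr (\det _).
by apply/matrixP => i j; rewrite !mxE.
Qed.

Lemma alternant_eq0 x i j : i != j -> x i = x j -> alternant x = 0.
Proof.
move=> ij e; apply: (determinant_alternate ij) => k; by rewrite !mxE e.
Qed.

(** Expansion along row [i], whose cofactors do not involve [x i]. *)
Lemma alternant_span : coordwise_span alternant.
Proof.
move=> x i hx; exists (fun j => cofactor (\matrix_(i, j) f j (x i)) i j) => y _.
rewrite /alternant (expand_det_row _ i); apply: eq_bigr => j _.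
rewrite mxE /upd eqxx mulrC; congr (_ * _); rewrite /cofactor; congr (_ * \det _).
by apply/matrixP => k l; rewrite !mxE eq_sym (negbTE (neq_lift _ _)).
Qed.

(** The difference of the two sides is alternating and vanishes at [b]. *)
Lemma alternating_proportional (W : ('I_n -> F) -> F) b : (forall i, b i != 0) ->
  alternant b != 0 -> coordwise_span W ->
  (forall x i j, (forall k, x k != 0) -> i != j -> x i = x j -> W x = 0) ->
  (forall x (s : 'S_n), (forall k, x k != 0) -> W (fun i => x (s i)) = (-1) ^+ s * W x) ->
  forall x, (forall i, x i != 0) -> alternant x * W b = alternant b * W x.
Proof.
move=> b0 db hW halt hperm x hx; apply/eqP; rewrite -subr_eq0; apply/eqP.
apply: (alternating_eq0 (H := fun x => alternant x * W b - alternant b * W x) b0 db) => //.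
- move=> y i hy; have [c hc] := hW y i hy; have [d hd] := alternant_span i hy.
  exists (fun j => d j * W b - alternant b * c j) => z z0; rewrite hc // hd //.
  rewrite mulr_suml mulr_sumr -sumrB; apply: eq_bigr => j _; ring.
- by move=> y i j hy ij e; rewrite (halt _ _ _ hy ij e) (alternant_eq0 ij e) mul0r mulr0 subrr.
- by move=> s; rewrite alternant_perm hperm // (mulrCA (alternant b)) -mulrA subrr.
Qed.

End Alternating.

Section PairProducts.
Variable F : numFieldType.
Variable n : nat.
Implicit Types (x : 'I_n -> F) (u : F -> F -> F).

Definition pairprod u x := \prod_(i < n) \prod_(j < n | (i < j)%N) u (x i) (x j).

Lemma pairprod_eq0 u x i j : (forall y, y != 0 -> u y y = 0) -> (forall i, x i != 0) ->
  i != j -> x i = x j -> pairprod u x = 0.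
Proof.
move=> hu hx; wlog ij : i j / (i < j)%N => [H|] ne e.
  have [ij|ji] := ltnP i j; first exact: (H i j).
  apply: (H j i) => //; rewrite 1?eq_sym // ltn_neqAle ji andbT eq_sym.
  by apply: contra_neq ne => h; exact: val_inj.
by rewrite /pairprod (bigD1 i) //= (bigD1 j) //= e hu // !mul0r.
Qed.

(** The product is permuted up to a sign that is the same for all antisymmetric
    [u], so the sign can be read off from the Vandermonde determinant. *)
Lemma pairprod_perm u x (s : 'S_n) : (forall i, x i != 0) ->
  (forall y z, y != 0 -> z != 0 -> u z y = - u y z) ->
  pairprod u (fun i => x (s i)) = (-1) ^+ s * pairprod u x.
Proof.
move=> hx hu.
pose sg (p : 'I_n * 'I_n) : F := if (s p.1 < s p.2)%N then 1 else -1.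
pose eps := \prod_(p : 'I_n * 'I_n | (p.1 < p.2)%N) sg p.
have key (v : F -> F -> F) (y : 'I_n -> F) : (forall i j, v (y i) (y j) = - v (y j) (y i)) ->
    pairprod v (fun i => y (s i)) = eps * pairprod v y.
  move=> hv; rewrite /pairprod !pair_big_dep /=.
  (* [h] sorts the image of a pair under [s], and [h'] inverts it on sorted pairs. *)
  pose h (p : 'I_n * 'I_n) := if (s p.1 < s p.2)%N then (s p.1, s p.2) else (s p.2, s p.1).
  pose h' (p : 'I_n * 'I_n) := let q := ((s^-1)%g p.1, (s^-1)%g p.2) in
    if (q.1 < q.2)%N then q else (q.2, q.1).
  have sV i : s ((s^-1)%g i) = i by rewrite permKV.
  have Vs i : (s^-1)%g (s i) = i by rewrite permK.
  have hh' (p : 'I_n * 'I_n) : (p.1 < p.2)%N -> h (h' p) = p.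
    case: p => i j /= ij; rewrite /h' /=; case: ifP => _; rewrite /h /= !sV ?ij //.
    by rewrite ltnNge (ltnW ij).
  have hP (p : 'I_n * 'I_n) : ((h p).1 < (h p).2)%N && (h' (h p) == p) = (p.1 < p.2)%N.
    case: p => i j; rewrite /h /=; case: ifP => [sij|/negbT].
      rewrite sij /h' /= !Vs; case: ltnP => [_|ji] /=; first by rewrite eqxx.
      apply/eqP => -[e _]; move: ji; rewrite e leqnn.
      by move: sij; rewrite e ltnn.
    rewrite -leqNgt leq_eqVlt => /orP[/eqP/val_inj/perm_inj ->|sji].
      by rewrite !ltnn.
    rewrite sji /h' /= !Vs; case: (ltngtP i j) => [ij|ji|/val_inj e].
    - by rewrite eqxx.
    - by apply/negbTE/eqP => -[e _]; move: ji; rewrite e ltnn.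
    - by move: sji; rewrite e ltnn.
  rewrite [in RHS](reindex_onto h h' hh') /= (eq_bigl _ _ hP) /eps -big_split /=.
  apply: eq_bigr => -[i j] /= _; rewrite /sg /h /=; case: ifP => _; first by rewrite mul1r.
  by rewrite hv mulN1r.
have e : eps = (-1) ^+ s.
  pose a (i : 'I_n) : F := (i : nat)%:R; pose v (y z : F) := z - y.
  have VE (y : 'I_n -> F) : pairprod v y = alternant (fun (j : 'I_n) z => z ^+ j) y.
    rewrite /alternant -det_tr.
    have -> : (\matrix_(i < n, j < n) y i ^+ j)^T = Vandermonde n (\row_i y i).
      by apply/matrixP => i j; rewrite !mxE.
    rewrite det_Vandermonde; apply: eq_bigr => i _; apply: eq_bigr => j _.
    by rewrite !mxE.
  apply: (@mulIf _ (pairprod v a)).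
    apply/prodf_neq0 => i _; apply/prodf_neq0 => j ij.
    by rewrite /v subr_eq0 eqr_nat gtn_eqF.
  rewrite -key; first by rewrite !VE alternant_perm.
  by move=> i j; rewrite /v opprB.
by rewrite -e key // => i j; exact: hu.
Qed.

(** Only the pairs that contain [i] involve the new value, and antisymmetry brings
    it into the first place. *)
Lemma pairprod_upd u x i : (forall j, x j != 0) ->
  (forall y z, y != 0 -> z != 0 -> u z y = - u y z) ->
  exists C, forall y, y != 0 -> pairprod u (upd x i y) = C * \prod_(j < n | j != i) u y (x j).
Proof.
move=> hx hu.
exists (\prod_(k < n | k != i) ((if (k < i)%N then -1 else 1) *
  \prod_(j < n | (k < j)%N && (j != i)) u (x k) (x j))) => y y0.
have inner k : k != i -> \prod_(j < n | (k < j)%N) u (upd x i y k) (upd x i y j) =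
    ((if (k < i)%N then -1 else 1) * \prod_(j < n | (k < j)%N && (j != i)) u (x k) (x j)) *
    (if (k < i)%N then u y (x k) else 1).
  move=> ki; have e : \prod_(j < n | (k < j)%N && (j != i)) u (upd x i y k) (upd x i y j) =
      \prod_(j < n | (k < j)%N && (j != i)) u (x k) (x j).
    by apply: eq_bigr => j /andP[_ ji]; rewrite /upd (negbTE ki) (negbTE ji).
  case: ifP => hk.
    rewrite (bigD1 i) //= e {1}/upd (negbTE ki) {1}/upd eqxx (hu y) //.
    by rewrite !mulN1r mulrC mulrN mulNr.
  rewrite mul1r mulr1 -e; apply: eq_bigl => j; case: eqP => [->|]; rewrite ?hk ?andbT //.
rewrite /pairprod (bigD1 i) //= (eq_bigr _ inner) big_split /= mulrCA; congr (_ * _).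
rewrite [RHS](bigID (fun j : 'I_n => (i < j)%N)) /=; congr (_ * _).
  apply: eq_big => [j|j ij]; last by rewrite /upd eqxx; case: eqP ij => // ->; rewrite ltnn.
  by case: eqP => [->|_] //=; rewrite ltnn.
rewrite -big_mkcondr /=; apply: eq_bigl => j; case: eqP => //= /eqP ji.
by rewrite -leqNgt ltn_neqAle val_eqE ji.
Qed.

End PairProducts.

(** * The Macdonald denominators as alternating functions *)

Section Proportional.
Variable K : numFieldType.
Hypothesis Kc : geometric_complete K.
Variable p : K.
Hypotheses (p0 : p != 0) (p1 : `|p| < 1).
Implicit Types (y z : K).

Definition factorA y z : K := z * theta (y / z) p.
Definition factorD y z : K := y^-1 * thetapm y z p.

Lemma factorA_anti y z : y != 0 -> z != 0 -> factorA z y = - factorA y z.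
Proof.
move=> y0 z0; have yz : y / z != 0 by rewrite mulf_neq0 ?invr_eq0.
rewrite /factorA -[z / y]invf_div (thetaV Kc) // invf_div; field; exact: y0.
Qed.

Lemma factorA_diag y : y != 0 -> factorA y y = 0.
Proof. by move=> y0; rewrite /factorA mulfV // (theta1 Kc) // mulr0. Qed.

Lemma factorD_anti y z : y != 0 -> z != 0 -> factorD z y = - factorD y z.
Proof.
move=> y0 z0; have yz : y / z != 0 by rewrite mulf_neq0 ?invr_eq0.
rewrite /factorD /thetapm -[z / y]invf_div (thetaV Kc) // invf_div (mulrC z); field.
by rewrite y0 z0.
Qed.

Lemma factorD_diag y : y != 0 -> factorD y y = 0.
Proof. by move=> y0; rewrite /factorD /thetapm mulfV // (theta1 Kc) // !mulr0. Qed.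

Lemma factorD_inv y z : y != 0 -> z != 0 -> factorD y^-1 z = factorD y z.
Proof.
move=> y0 z0; have yz : y / z != 0 by rewrite mulf_neq0 ?invr_eq0.
have yz' : y * z != 0 by rewrite mulf_neq0.
rewrite /factorD /thetapm mulrC (_ : y^-1 * z = (y / z)^-1); last by rewrite invf_div mulrC.
rewrite -[y^-1 / z]invfM !(thetaV Kc) // invrK invf_div invfM; field.
by rewrite y0 z0.
Qed.

Lemma W_A_pairprod n (x : 'I_n -> K) : W_A p x = pairprod factorA x.
Proof. by []. Qed.

Lemma W_D_pairprod n (x : 'I_n -> K) : W_D p x = pairprod factorD x.
Proof. by []. Qed.

(** As a function of [x_i], the denominator is a product of [n] theta functions
    [theta(z x_i; p)] whose parameters [z] multiply to [t]. *)
Lemma WA_proportional n (t : K) b : (0 < n)%N -> t != 0 -> (forall i, b i != 0) ->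
  let f := fun (j : 'I_n) => theta_basis p n ((-1) ^+ (n - 1) * t) j%:Z in
  let W := fun x => theta (t * \prod_i x i) p * W_A p x in
  alternant f b != 0 -> forall x, (forall i, x i != 0) -> alternant f x * W b = alternant f b * W x.
Proof.
move=> n0 t0 b0 f W db; apply: alternating_proportional => //.
- move=> x i hx; rewrite /W.
  have [C hC] := pairprod_upd i hx factorA_anti.
  pose s := (t * \prod_(j < n | j != i) x j) :: [seq (x j)^-1 | j <- enum (predC1 i)].
  have prodx0 : \prod_(j < n | j != i) x j != 0 by apply/prodf_neq0.
  have s0 : all (fun a => a != 0) s.
    rewrite /s /= mulf_neq0 //=; apply/allP => z /mapP[j _ ->]; by rewrite invr_eq0.
  have ss : size s = n.
    by rewrite /s /= size_map -cardE cardC1 card_ord prednK.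
  have ec : (-1) ^+ (n - 1) * t = - (\prod_(z <- s) (- z)) * p ^+ 0.
    rewrite expr0 mulr1 /s big_cons big_map big_enum /=.
    have -> : \prod_(j < n | j != i) - (x j)^-1 = (-1) ^+ (n - 1) * (\prod_(j < n | j != i) x j)^-1.
      under eq_bigr do rewrite -mulN1r.
      by rewrite big_split /= prodr_const cardC1 card_ord prodfV subn1.
    by field; rewrite prodx0.
  have := prod_theta_span Kc p0 p1 0 (eq_ind_r (fun m => (0 < m)%N) n0 ss) s0 ec.
  rewrite ss => -[al hal].
  exists (fun j => C * \prod_(j < n | j != i) x j * al j) => y y0.
  transitivity (C * \prod_(j < n | j != i) x j * \sum_j al j * f j y); last first.
    by rewrite mulr_sumr; apply: eq_bigr => j _; rewrite mulrA.
  rewrite W_A_pairprod hC //.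
  have -> : \sum_j al j * f j y = \sum_j al j * theta_basis p n ((-1) ^+ (n - 1) * t) (0 + j%:Z) y.
    by apply: eq_bigr => j _; rewrite add0r.
  rewrite -hal // expr0 invr1 mul1r /s big_cons big_map big_enum /=.
  have -> : \prod_i0 upd x i y i0 = y * \prod_(j < n | j != i) x j.
    rewrite (bigD1 i) //= {1}/upd eqxx; congr (_ * _).
    by apply: eq_bigr => j /negbTE ji; rewrite /upd ji.
  have -> : \prod_(j < n | j != i) theta ((x j)^-1 * y) p = \prod_(j < n | j != i) theta (y / x j) p.
    by apply: eq_bigr => j _; rewrite mulrC.
  rewrite (_ : t * (y * _) = t * \prod_(j < n | j != i) x j * y); last by ring.
  rewrite /factorA big_split /=; ring.
- by move=> x i j hx ij e; rewrite /W W_A_pairprod (pairprod_eq0 factorA_diag hx ij e) mulr0.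
- move=> x s hx; rewrite /W !W_A_pairprod (pairprod_perm _ hx factorA_anti) mulrCA.
  have -> // : \prod_i x (s i) = \prod_i x i by rewrite [RHS](reindex_inj (@perm_inj _ s)).
Qed.

(** The common shape of the types other than A. The denominator is [W_D] times a
    product of [phi (x i)], where [phi] collects the factors [theta (z * y) p] with
    [z] in [pre]; it changes by [- eps] under the reflection [h -> y^sg h(1/y)],
    and [m0] is the exponent of the first column. *)
Section Symmetric.
Variables (n N : nat) (c eps : K) (sg m0 : int) (phi : K -> K) (pre : seq K) (d0 : nat).

Definition theta_symbasis (m : int) (y : K) : K := theta_basis p N c m y - eps * (y ^ sg * theta_basis p N c m y^-1).

Hypotheses (n0 : (0 < n)%N) (N0 : (0 < N)%N) (eN : (N = size pre + 2 * (n - 1))%N).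
Hypothesis pre0 : all (fun a => a != 0) pre.
Hypothesis phiE : forall y, y != 0 -> phi y = y ^- d0 * \prod_(z <- pre) theta (z * y) p.
Hypothesis ec : c = - (\prod_(z <- pre) (- z)) * p ^+ (d0 + (n - 1)).
Hypothesis c2 : c ^+ 2 * p ^ sg = p ^+ N.
Hypothesis eps2 : eps ^+ 2 = 1.
Hypothesis phi_sym : forall y, y != 0 -> y ^ sg * phi y^-1 = - eps * phi y.
(** This is why symmetrization leaves only the columns: in the second case it
    gives a multiple of a column, in the last two cases it gives zero. *)
Hypothesis cover : forall m : int, m0 <= m < m0 + N%:Z ->
  [\/ m0 <= m < m0 + n%:Z, m0 <= sg - m < m0 + n%:Z,
      m = sg - m /\ eps = 1 | [/\ m = sg - m + N%:Z, eps = 1 & c * p ^ (sg - m) = -1]].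

Let f (j : 'I_n) := theta_symbasis (m0 + j%:Z).
Let W (x : 'I_n -> K) := \prod_i phi (x i) * W_D p x.

Let c0 : c != 0.
Proof.
apply: contra_eq_neq c2 => ->; rewrite expr0n mul0r eq_sym.
by rewrite expf_neq0.
Qed.

Lemma theta_symbasisE m y : y != 0 -> theta_symbasis m y = theta_basis p N c m y - eps * theta_basis p N c (sg - m) y.
Proof. by move=> y0; rewrite /theta_symbasis (theta_basis_reflect p0 m c0 y0 c2). Qed.

Definition in_span (h : K -> K) := exists a : 'I_n -> K,
  forall y, y != 0 -> h y = \sum_j a j * f j y.

Lemma in_span_sum (I : Type) (r : seq I) (h : I -> K -> K) (a : I -> K) :
  (forall i, in_span (h i)) -> in_span (fun y => \sum_(i <- r) a i * h i y).
Proof.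
move=> hh; elim: r => [|i r [v hv]].
  by exists (fun=> 0) => y y0; rewrite big_nil big1 // => j _; rewrite mul0r.
have [u hu] := hh i; exists (fun j => a i * u j + v j) => y y0.
rewrite big_cons hv // hu // mulr_sumr -big_split /=; apply: eq_bigr => j _; ring.
Qed.

Lemma theta_symbasis_in_span m : m0 <= m < m0 + N%:Z -> in_span (theta_symbasis m).
Proof.
have chosen k : m0 <= k < m0 + n%:Z -> in_span (theta_symbasis k).
  move=> /andP[h1 h2]; have [j ej] : exists j : 'I_n, k = m0 + j%:Z.
    have hj : (`|k - m0| < n)%N by lia.
    by exists (Ordinal hj) => /=; lia.
  exists (fun i => (i == j)%:R) => y y0; rewrite (bigD1 j) //= eqxx mul1r ej big1 ?addr0 //.
  by move=> i /negbTE ->; rewrite mul0r.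
have zero k : (forall y, y != 0 -> theta_symbasis k y = 0) -> in_span (theta_symbasis k).
  by move=> h; exists (fun=> 0) => y y0; rewrite h // big1 // => i _; rewrite mul0r.
move=> /cover [h|h|[h e]|[h e1 e2]].
- exact: chosen.
- have [a ha] := chosen _ h; exists (fun j => - eps * a j) => y y0.
  transitivity (- eps * \sum_j a j * f j y); last first.
    by rewrite mulr_sumr; apply: eq_bigr => j _; rewrite mulrA.
  rewrite -ha // !theta_symbasisE // subKr -[X in X - _ = _]mul1r -eps2; ring.
- by apply: zero => y y0; rewrite theta_symbasisE // e mul1r -h subrr.
- apply: zero => y y0; rewrite theta_symbasisE // e1 mul1r.
  by rewrite {1}h (theta_basis_period Kc p0 p1 _ N0 c0 y0) e2 invrN invr1 opprK mul1r subrr.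
Qed.

(** As a function of [x_i], the denominator lies in the span of all the
    [theta_basis] functions and is [- eps] times its reflection, so it is half of
    its own symmetrization. *)
Lemma W_coordwise_span : coordwise_span f W.
Proof.
move=> x i hx.
have [C hC] := pairprod_upd i hx factorD_anti.
pose s := pre ++ [seq x j | j <- enum (predC1 i)] ++ [seq (x j)^-1 | j <- enum (predC1 i)].
have s0 : all (fun a => a != 0) s.
  rewrite !all_cat pre0 /=; apply/andP; split; apply/allP => z /mapP[j _ ->] //.
  by rewrite invr_eq0.
have ss : size s = N.
  by rewrite !size_cat !size_map -cardE cardC1 card_ord eN addnn mul2n subn1.
have ec' : c = - (\prod_(z <- s) (- z)) * p ^+ (d0 + (n - 1)).
  have e1 : \prod_(j <- enum (predC1 i)) (- x j) * \prod_(j <- enum (predC1 i)) (- (x j)^-1) = 1.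
    by rewrite -big_split /= big1 // => j _; rewrite mulrNN mulfV.
  by rewrite ec /s !big_cat !big_map /= e1 mulr1.
have ss0 : (0 < size s)%N by rewrite ss.
have := prod_theta_span Kc p0 p1 m0 ss0 s0 ec'; rewrite ss => -[al hal].
pose h y := phi y * \prod_(j < n | j != i) factorD y (x j).
have hE y : y != 0 -> h y = \sum_j al j * theta_basis p N c (m0 + j%:Z) y.
  move=> y0; rewrite -hal // /h phiE // /s !big_cat !big_map !big_enum /=.
  have -> : \prod_(j < n | j != i) factorD y (x j) = y ^- (n - 1) *
      (\prod_(j < n | j != i) theta (y * x j) p * \prod_(j < n | j != i) theta (y / x j) p).
    by rewrite -!big_split /= /factorD big_split /= prodr_const cardC1 card_ord exprVn subn1.
  rewrite exprD invfM.
  have -> : \prod_(j < n | j != i) theta (x j * y) p = \prod_(j < n | j != i) theta (y * x j) p.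
    by apply: eq_bigr => j _; rewrite mulrC.
  have -> : \prod_(j < n | j != i) theta ((x j)^-1 * y) p = \prod_(j < n | j != i) theta (y / x j) p.
    by apply: eq_bigr => j _; rewrite mulrC.
  ring.
have hsym y : y != 0 -> y ^ sg * h y^-1 = - eps * h y.
  move=> y0; rewrite /h mulrA phi_sym // mulrA; congr (_ * _).
  by apply: eq_bigr => j _; exact: factorD_inv.
have [a ha] : in_span h.
  have [a ha] : in_span (fun y => \sum_(j < N) al j / 2 * theta_symbasis (m0 + j%:Z) y).
    apply: in_span_sum => j; apply: theta_symbasis_in_span; have := ltn_ord j; lia.
  exists a => y y0; rewrite -ha //; transitivity ((h y + h y) / 2); first by field.
  have -> : h y + h y = h y - eps * (y ^ sg * h y^-1).
    by rewrite hsym // mulrA mulrN -expr2 eps2 mulN1r opprK.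
  rewrite !hE ?invr_eq0 // !mulr_sumr -sumrB mulr_suml; apply: eq_bigr => j _.
  rewrite /theta_symbasis; ring.
pose D := \prod_(j < n | j != i) phi (x j).
exists (fun j => D * C * a j) => y y0.
rewrite /W W_D_pairprod hC // (bigD1 i) //= {1}/upd eqxx.
have -> : \prod_(j < n | j != i) phi (upd x i y j) = D.
  by apply: eq_bigr => j /negbTE ji; rewrite /upd ji.
transitivity (D * C * \sum_j a j * f j y); first by rewrite -ha // /h; ring.
by rewrite mulr_sumr; apply: eq_bigr => j _; rewrite mulrA.
Qed.

Lemma W_proportional b : (forall i, b i != 0) -> alternant f b != 0 ->
  forall x, (forall i, x i != 0) -> alternant f x * W b = alternant f b * W x.
Proof.
move=> b0 db; apply: alternating_proportional => //; first exact: W_coordwise_span.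
- move=> x i j hx ij e.
  by rewrite /W W_D_pairprod (pairprod_eq0 factorD_diag hx ij e) mulr0.
- move=> x s hx; rewrite /W !W_D_pairprod (pairprod_perm _ hx factorD_anti) mulrCA.
  have -> // : \prod_i phi (x (s i)) = \prod_i phi (x i).
  by rewrite [RHS](reindex_inj (@perm_inj _ s)).
Qed.

End Symmetric.
End Proportional.

(** * Products over levels and products over nodes *)

Section InfiniteProducts.
Local Open Scope classical_set_scope.
Variable K : numFieldType.
Hypothesis Kc : geometric_complete K.
Implicit Types (F G : K -> K) (u q v w a z : K).

(** Infinite products are compared level by level, that is for each factor with
    [t = u q^l]. The parameters [u] and [q] vary because the bases [p], [p^2] and
    the square root of [p] all occur, as does [(p, p^2)] for odd powers. *)
Definition has_iprod u q F v :=
  (fun M => \prod_(0 <= l < M) F (u * q ^+ l)) @ \oo --> (v : K).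

Lemma has_iprod_uniq u q F v w : has_iprod u q F v -> has_iprod u q F w -> v = w.
Proof. exact: cvg_uniq. Qed.

Lemma has_iprodM u q F G v w : has_iprod u q F v -> has_iprod u q G w ->
  has_iprod u q (fun t => F t * G t) (v * w).
Proof.
move=> h1 h2; apply: (eq_cvgn _ (cvgM h1 h2)) => n.
by rewrite -[LHS]/(\prod_(0 <= l < n) F (u * q ^+ l) * \prod_(0 <= l < n) G (u * q ^+ l)) -big_split.
Qed.

Lemma has_iprod1 u q : has_iprod u q (fun=> 1) 1.
Proof. by apply: (eq_cvgn _ (cvg_cst (1 : K))) => n; rewrite big1. Qed.

Lemma has_iprod_prod (I : Type) (r : seq I) (P : pred I) u q (F : I -> K -> K) (v : I -> K) :
  (forall i, P i -> has_iprod u q (F i) (v i)) ->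
  has_iprod u q (fun t => \prod_(i <- r | P i) F i t) (\prod_(i <- r | P i) v i).
Proof.
move=> h.
have h2 : (fun n => \prod_(i <- r) \prod_(0 <= l < n) (if P i then F i (u * q ^+ l) else 1)) @ \oo -->
    (\prod_(i <- r) (if P i then v i else 1) : K).
  apply: cvgn_prod => i; case: (boolP (P i)) => [/h //|_].
  by apply: (eq_cvgn _ (cvg_cst (1 : K))) => n; rewrite big1.
rewrite -big_mkcond in h2; apply: (eq_cvgn _ h2) => n.
rewrite exchange_big /=; apply: eq_bigr => l _.
by rewrite [in RHS]big_mkcond.
Qed.

Lemma has_iprodX u q F v k : has_iprod u q F v -> has_iprod u q (fun t => F t ^+ k) (v ^+ k).
Proof.
move=> h; elim: k => [|k IH].
  by under eq_fun do rewrite expr0; exact: has_iprod1.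
rewrite exprS; apply: (eq_cvgn _ (has_iprodM h IH)) => n.
by apply: eq_bigr => l _; rewrite exprS.
Qed.

Lemma has_iprod_factor u q a k : q != 0 -> `|q| < 1 -> (0 < k)%N ->
  has_iprod u q (fun t => 1 - a * t ^+ k) (qpoch (a * u ^+ k) (q ^+ k)).
Proof.
move=> q0 q1 k0; have q0k : q ^+ k != 0 by rewrite expf_neq0.
have q1k := normXn_lt1 q1 k0.
apply: (eq_cvgn _ (@qpoch_cvg _ Kc _ q0k q1k (a * u ^+ k))) => n.
by apply: eq_bigr => l _; rewrite exprMn mulrA -!exprM mulnC.
Qed.

Lemma has_iprod_factor1 u q a : q != 0 -> `|q| < 1 ->
  has_iprod u q (fun t => 1 - t * a) (qpoch (u * a) q).
Proof.
move=> q0 q1; apply: (eq_cvgn _ (@qpoch_cvg _ Kc _ q0 q1 (u * a))) => n.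
by apply: eq_bigr => l _; rewrite mulrAC.
Qed.

Definition theta_tail z q := qpoch (q * z) q * qpoch (q / z) q.

Lemma theta_tailE q z : q != 0 -> `|q| < 1 -> theta z q = (1 - z) * theta_tail z q.
Proof. by move=> q0 q1; rewrite /theta (qpoch_rec Kc z q0 q1) mulrA. Qed.

Lemma has_iprod_theta_tail u q z : q != 0 -> `|q| < 1 ->
  has_iprod u q (fun t => (1 - t * z) * (1 - t / z)) (qpoch (u * z) q * qpoch (u / z) q).
Proof. by move=> q0 q1; apply: has_iprodM; exact: has_iprod_factor1. Qed.

End InfiniteProducts.

Section Nodes.
Local Open Scope classical_set_scope.
Variable K : numFieldType.
Variable n : nat.
Implicit Types (b : 'I_n -> K) (a q s : K).

Definition nodeprod b a := \prod_i ((1 - a * b i) * (1 - a / b i)).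
(** What the product of the [theta (b i * b j) p * theta (b i / b j) p] contributes
    at level [q]. *)
Definition nodepair b q := \prod_(i < n) \prod_(j < n | (i < j)%N)
  ((1 - q * (b i * b j)) * (1 - q / (b i * b j)) * ((1 - q * (b i / b j)) * (1 - q / (b i / b j)))).

Lemma prod_offdiag (T : 'I_n -> 'I_n -> K) : \prod_i \prod_j T i j =
  \prod_(i < n) \prod_(j < n | (i < j)%N) (T i j * T j i) * \prod_i T i i.
Proof.
have split_row i : \prod_j T i j =
    \prod_(j < n | (i < j)%N) T i j * \prod_(j < n | (j < i)%N) T i j * T i i.
  rewrite (bigD1 i) //= mulrC; congr (_ * _).
  rewrite (bigID (fun j : 'I_n => (i < j)%N)) /=; congr (_ * _); apply: eq_bigl => j.
    by case: eqP => [->|_] //=; rewrite ltnn.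
  by rewrite -leqNgt ltn_neqAle.
rewrite (eq_bigr _ (fun i _ => split_row i)) !big_split /=; congr (_ * _).
rewrite [X in _ * X = _](exchange_big_dep predT) //= -big_split /=.
by apply: eq_bigr => i _; rewrite -big_split.
Qed.

Lemma nodeprod_sqr b s : nodeprod (fun i => b i ^+ 2) (s ^+ 2) = nodeprod b s * nodeprod b (- s).
Proof.
rewrite /nodeprod -big_split; apply: eq_bigr => i _ /=.
rewrite -[X in 1 - X / _]/(s ^+ 2) -exprVn; ring.
Qed.

(** Both sides are the product of [1 - q z w] over all ordered pairs of elements
    of the family of nodes and inverses: a pair of distinct indices occurs twice,
    and index [i] alone gives [(1 - q)^2 (1 - q b_i^2) (1 - q / b_i^2)]. *)
Lemma nodepair_sqr b q : (forall i, b i != 0) ->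
  nodepair b q ^+ 2 * ((1 - q) ^+ n.*2 * nodeprod (fun i => b i ^+ 2) q) =
  \prod_i (nodeprod b (q * b i) * nodeprod b (q / b i)).
Proof.
move=> b0.
pose T i j := (1 - q * (b i * b j)) * (1 - q / (b i * b j)) * ((1 - q * (b i / b j)) * (1 - q / (b i / b j))).
have hT i j : T i j = T j i.
  by rewrite /T (mulrC (b j)) !invf_div; ring.
transitivity (\prod_i \prod_j T i j).
  have -> : nodepair b q ^+ 2 = \prod_(i < n) \prod_(j < n | (i < j)%N) (T i j * T j i).
    rewrite /nodepair -prodrXl; apply: eq_bigr => i _; rewrite -prodrXl.
    by apply: eq_bigr => j _; rewrite (hT j i) expr2.
  rewrite prod_offdiag; congr (_ * _); rewrite -mul2n mulnC exprM.
  rewrite -[n in (1 - q) ^+ n]card_ord -prodr_const -prodrXl -big_split /=; apply: eq_bigr => i _.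
  by rewrite /T mulfV // invr1 mulr1 expr2 [b i ^+ 2]expr2; ring.
apply: eq_bigr => i _; rewrite /nodeprod -big_split /=; apply: eq_bigr => j _.
by rewrite /T invf_div invfM; ring.
Qed.

Definition polyfun (F : K -> K) := exists P : {poly K}, forall q, F q = P.[q].

Lemma polyfun_cst a : polyfun (fun=> a).
Proof. by exists a%:P => q; rewrite hornerC. Qed.
Lemma polyfun_id : polyfun id.
Proof. by exists 'X => q; rewrite hornerX. Qed.
Lemma polyfunB F G : polyfun F -> polyfun G -> polyfun (fun q => F q - G q).
Proof. by move=> [P hP] [Q hQ]; exists (P - Q) => q; rewrite hP hQ !hornerE. Qed.
Lemma polyfunD F G : polyfun F -> polyfun G -> polyfun (fun q => F q + G q).
Proof. by move=> [P hP] [Q hQ]; exists (P + Q) => q; rewrite hP hQ !hornerE. Qed.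
Lemma polyfunM F G : polyfun F -> polyfun G -> polyfun (fun q => F q * G q).
Proof. by move=> [P hP] [Q hQ]; exists (P * Q) => q; rewrite hP hQ !hornerE. Qed.
Lemma polyfunX F k : polyfun F -> polyfun (fun q => F q ^+ k).
Proof. by move=> [P hP]; exists (P ^+ k) => q; rewrite hP horner_exp. Qed.
Lemma polyfun_prod (I : Type) (r : seq I) (P : pred I) (F : I -> K -> K) :
  (forall i, polyfun (F i)) -> polyfun (fun q => \prod_(i <- r | P i) F i q).
Proof.
move=> /choice [G hG]; exists (\prod_(i <- r | P i) G i) => q.
by rewrite horner_prod; apply: eq_bigr => i _.
Qed.

(** The polynomial [(P - Q) (P + Q)] has infinitely many roots, so [P = Q] or
    [P = - Q]; the values at 0 exclude the latter. *)
Lemma polyfun_eq_sqr F G : polyfun F -> polyfun G -> F 0 = 1 -> G 0 = 1 ->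
  (forall q, `|q| < 1 -> F q ^+ 2 = G q ^+ 2) -> forall q, F q = G q.
Proof.
move=> [P hP] [Q hQ] F0 G0 e.
have : (P - Q) * (P + Q) = 0.
  apply/eqP; apply: contraT => nz.
  (* As many distinct points of the unit disc as needed. *)
  pose rs := [seq (k.+2%:R : K)^-1 | k <- iota 0 (size ((P - Q) * (P + Q)))].
  have := max_poly_roots nz (rs := rs); rewrite size_map size_iota ltnn => -> //.
    apply/allP => _ /mapP[k _ ->]; rewrite /root -subr_sqr !hornerE ?horner_exp -hP -hQ e ?subrr //.
    by rewrite ger0_norm ?invr_ge0 ?ler0n // invf_lt1 ?ltr0n // ltr1n.
  rewrite map_inj_uniq ?iota_uniq // => k l /invr_inj/eqP; rewrite eqr_nat => /eqP.
  by case.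
move/eqP; rewrite mulf_eq0 subr_eq0 => /orP[/eqP PQ q|/eqP PQ].
  by rewrite hP hQ PQ.
have : (P + Q).[0] = 0 by rewrite PQ horner0.
by rewrite hornerE -hP -hQ F0 G0 => /eqP; rewrite (pnatr_eq0 _ 2).
Qed.

Lemma polyfun_nodepair b : polyfun (nodepair b).
Proof.
apply: polyfun_prod => i; apply: polyfun_prod => j.
have h c : polyfun (fun q => 1 - q * c).
  exact: polyfunB (polyfun_cst 1) (polyfunM polyfun_id (polyfun_cst c)).
by do !apply: polyfunM; exact: h.
Qed.

Lemma nodepair0 b : nodepair b 0 = 1.
Proof.
by rewrite /nodepair big1 // => i _; rewrite big1 // => j _; rewrite !mul0r subr0 !mulr1.
Qed.

Definition inv_sum (y : K) := y + y^-1.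
(** The factor [W_D] degenerates to this at [p = 0]. *)
Definition weylD b := \prod_(i < n) \prod_(j < n | (i < j)%N) (inv_sum (b i) - inv_sum (b j)).

Lemma weylDE b : (forall i, b i != 0) ->
  weylD b = \prod_(i < n) \prod_(j < n | (i < j)%N) ((b i)^-1 * ((1 - b i * b j) * (1 - b i / b j))).
Proof.
move=> b0; apply: eq_bigr => i _; apply: eq_bigr => j _; rewrite /inv_sum; field.
by rewrite !b0.
Qed.

(** The matrix is a Vandermonde matrix times the triangular matrix of the
    coefficients. Reversing both rows and columns does not change the sign. *)
Lemma det_poly_rev (P : nat -> {poly K}) (y : 'I_n -> K) : (forall k, size (P k) = k.+1) ->
  \det (\matrix_(i < n, j < n) (P (n - j.+1)%N).[y i]) =
  \prod_(k < n) lead_coef (P k) * \prod_(i < n) \prod_(j < n | (i < j)%N) (y i - y j).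
Proof.
move=> hs.
pose rv := perm (@rev_ord_inj n).
have -> : \matrix_(i < n, j < n) (P (n - j.+1)%N).[y i] =
    row_perm rv (col_perm rv (\matrix_(i < n, j < n) (P j).[y (rev_ord i)])).
  by apply/matrixP => i j; rewrite !mxE !permE /= rev_ordK.
rewrite row_permE col_permE !det_mulmx !det_perm odd_permV.
set V := Vandermonde n (\row_i y (rev_ord i)).
have -> : \matrix_(i < n, j < n) (P j).[y (rev_ord i)] =
   V^T *m (\matrix_(k < n, j < n) (P j)`_k).
  apply/matrixP => i j; rewrite !mxE (horner_coef_wide (n := n)) ?hs ?ltn_ord //.
  by apply: eq_bigr => k _; rewrite !mxE mulrC.
rewrite det_mulmx det_tr det_Vandermonde.
rewrite -[X in _ * (_ * X * _)]det_tr det_trig; last first.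
  apply/is_trig_mxP => i j ij; rewrite !mxE nth_default // hs //.
have -> : \prod_i (\matrix_(k < n, j < n) (P j)`_k)^T i i = \prod_(k < n) lead_coef (P k).
  by apply: eq_bigr => k _; rewrite !mxE lead_coefE hs.
have -> : \prod_(i < n) \prod_(j < n | (i < j)%N) ((\row_i y (rev_ord i)) 0 j - (\row_i y (rev_ord i)) 0 i)
   = \prod_(i < n) \prod_(j < n | (i < j)%N) (y i - y j).
  rewrite (exchange_big_dep predT) //= (reindex_inj rev_ord_inj) /=; apply: eq_bigr => i _.
  rewrite (reindex_inj rev_ord_inj) /=; apply: eq_big => [j|j _]; last by rewrite !mxE !rev_ordK.
  by have := ltn_ord i; have := ltn_ord j; lia.
by rewrite mulrCA mulrA -mulrA -expr2 sqrr_sign mulr1 mulrC.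
Qed.

End Nodes.

(** * Classical Weyl denominators and roots of unity *)

Section WeylDeterminants.
Local Open Scope classical_set_scope.
Variable K : numFieldType.
Variable n : nat.
Implicit Types (b : 'I_n -> K).

(** Chebyshev-like polynomials: both [y^-k] and [y^k] satisfy this recursion when
    ['X] is specialized to [y + y^-1]. *)
Fixpoint weylpoly (c0 c1 : K) k : {poly K} :=
  match k with
  | 0 => c0%:P
  | 1 => 'X + c1%:P
  | (m.+1 as l).+1 => weylpoly c0 c1 l * 'X - weylpoly c0 c1 m
  end.

Lemma weylpoly_size_lead c0 c1 k : c0 != 0 ->
  [/\ size (weylpoly c0 c1 k) = k.+1, size (weylpoly c0 c1 k.+1) = k.+2 &
      lead_coef (weylpoly c0 c1 k.+1) = 1].
Proof.
move=> c00; elim: k => [|k [s1 s2 l]].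
  by rewrite /= size_XaddC lead_coefXaddC size_polyC c00.
have nz : weylpoly c0 c1 k.+1 != 0 by rewrite -size_poly_eq0 s2.
have sX : size (weylpoly c0 c1 k.+1 * 'X) = k.+3 by rewrite size_mulX // s2.
have lt : (size (- weylpoly c0 c1 k) < size (weylpoly c0 c1 k.+1 * 'X)%R)%N.
  by rewrite size_polyN s1 sX.
split; first exact: s2.
  by rewrite -[LHS]/(size (weylpoly c0 c1 k.+1 * 'X - weylpoly c0 c1 k)) size_polyDl.
rewrite -[LHS]/(lead_coef (weylpoly c0 c1 k.+1 * 'X - weylpoly c0 c1 k)).
by rewrite lead_coefDl // lead_coefMX.
Qed.

Lemma weylpoly_eval c0 c1 (y g : K) (phi : nat -> K) :
  phi 0%N = g * c0 -> phi 1%N = g * (y + c1) ->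
  (forall k, phi k.+2 = y * phi k.+1 - phi k) ->
  forall k, phi k = g * (weylpoly c0 c1 k).[y].
Proof.
move=> h0 h1 h k; suff [] : phi k = g * (weylpoly c0 c1 k).[y] /\
  phi k.+1 = g * (weylpoly c0 c1 k.+1).[y] by [].
elim: k => [|k [e1 e2]]; first by rewrite /= !hornerE h0 h1.
split=> //; rewrite h e1 e2.
rewrite -[weylpoly c0 c1 k.+2]/(weylpoly c0 c1 k.+1 * 'X - weylpoly c0 c1 k) hornerD hornerN hornerMX.
ring.
Qed.

(** The recursion turns [phi k] into [g] times a polynomial of degree [k] in
    [inv_sum], so the determinant is that of [det_poly_rev]. *)
Lemma weyl_det c0 c1 (g : K -> K) (phi : nat -> K -> K) b : (0 < n)%N -> c0 != 0 ->
  (forall i, phi 0%N (b i) = g (b i) * c0) ->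
  (forall i, phi 1%N (b i) = g (b i) * (inv_sum (b i) + c1)) ->
  (forall i k, phi k.+2 (b i) = inv_sum (b i) * phi k.+1 (b i) - phi k (b i)) ->
  \det (\matrix_(i < n, j < n) phi (n - j.+1)%N (b i)) = c0 * \prod_i g (b i) * weylD b.
Proof.
move=> n0 c00 h0 h1 h2.
have -> : \matrix_(i < n, j < n) phi (n - j.+1)%N (b i) =
    diag_mx (\row_i g (b i)) *m \matrix_(i < n, j < n) (weylpoly c0 c1 (n - j.+1)%N).[inv_sum (b i)].
  apply/matrixP => i j; rewrite mul_diag_mx !mxE.
  exact: (weylpoly_eval (phi := phi^~ (b i)) (h0 i) (h1 i) (h2 i)).
rewrite det_mulmx det_diag (det_poly_rev (P := weylpoly c0 c1)); last first.
  by move=> k; have [] := weylpoly_size_lead c1 k c00.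
have -> : \prod_(k < n) lead_coef (weylpoly c0 c1 k) = c0.
  case: (n) n0 => // m _; rewrite big_ord_recl big1 ?mulr1 /= ?lead_coefC // => k _.
  by have [] := weylpoly_size_lead c1 k c00.
under eq_bigr do rewrite mxE.
by rewrite mulrCA mulrA.
Qed.

End WeylDeterminants.

Section Evaluation.
Local Open Scope classical_set_scope.
Variable K : numFieldType.
Hypothesis Kc : geometric_complete K.
Variable p : K.
Hypotheses (p0 : p != 0) (p1 : `|p| < 1).
Variable n : nat.
Implicit Types (b : 'I_n -> K).

Lemma W_D_nodes b v : (forall i, b i != 0) -> has_iprod p p (nodepair b) v ->
  W_D p b = weylD b * v.
Proof.
move=> b0 hv.
pose T (i j : 'I_n) := theta_tail (b i * b j) p * theta_tail (b i / b j) p.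
have hT : has_iprod p p (nodepair b) (\prod_(i < n) \prod_(j < n | (i < j)%N) T i j).
  apply: has_iprod_prod => i _; apply: has_iprod_prod => j _; apply: has_iprodM;
  exact: (has_iprod_theta_tail Kc).
rewrite (has_iprod_uniq hv hT) weylDE // -big_split; apply: eq_bigr => i _ /=.
rewrite -big_split; apply: eq_bigr => j _ /=.
by rewrite /thetapm !(theta_tailE Kc _ p0 p1) /T; ring.
Qed.

(** Since [eta] is its own inverse, the theta factors at [b i] and at its inverse
    agree, and only depend on the column. *)
Lemma alternant_nodes N c eps (sg m0 : int) b (eta : K) : (forall i, b i != 0) ->
  (forall i, b i ^+ N = eta) -> eta ^+ 2 = 1 ->
  alternant (fun j : 'I_n => theta_symbasis p N c eps sg (m0 + j%:Z)) b =
  \prod_(j < n) theta (eta * c * p ^ (m0 + j%:Z)) (p ^+ N) *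
  \det (\matrix_(i < n, j < n) (b i ^ (m0 + j%:Z) - eps * b i ^ (sg - (m0 + j%:Z)))).
Proof.
move=> b0 bN e2; rewrite mulrC.
have eV : eta^-1 = eta.
  have eta0 : eta != 0 by apply: contra_eq_neq e2 => ->; rewrite expr0n eq_sym oner_eq0.
  by apply: (mulfI eta0); rewrite mulfV // -expr2 e2.
have -> : \prod_(j < n) theta (eta * c * p ^ (m0 + j%:Z)) (p ^+ N) =
    \det (diag_mx (\row_(j < n) theta (eta * c * p ^ (m0 + j%:Z)) (p ^+ N))).
  by rewrite det_diag; apply: eq_bigr => j _; rewrite mxE.
rewrite -det_mulmx; congr (\det _); apply/matrixP => i j.
rewrite mul_mx_diag !mxE /theta_symbasis /theta_basis exprVn bN eV exprz_inv.
rewrite (expfzDr sg (- (m0 + j%:Z)) (b0 i)).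
rewrite (_ : c * p ^ (m0 + j%:Z) * eta = eta * c * p ^ (m0 + j%:Z)); last by ring.
ring.
Qed.

Lemma alternant_evaluation (f : 'I_n -> K -> K) (W : ('I_n -> K) -> K) b (K0 : K) :
  (alternant f b != 0 -> forall x, (forall i, x i != 0) -> alternant f x * W b = alternant f b * W x) ->
  alternant f b = K0 * W b -> alternant f b != 0 ->
  forall x, (forall i, x i != 0) -> alternant f x = K0 * W x.
Proof.
move=> h e nz x hx; have := h nz x hx; rewrite e mulrAC => /mulIf; apply.
by apply: contraNneq nz => e0; rewrite e e0 mulr0.
Qed.

End Evaluation.

Section Roots.
Local Open Scope classical_set_scope.
Variable K : numClosedFieldType.

Lemma prim_root_exists N : (0 < N)%N -> exists z : K, N.-primitive_root z.
Proof.
move=> N0; pose q : {poly K} := 'X^N - 1.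
have [r Dp] := closed_field_poly_normal q.
have monq : q \is monic by exact: monic_Xn_sub_1.
rewrite (monicP monq) scale1r in Dp.
have rn1 : all N.-unity_root r by apply/allP => z; rewrite -root_prod_XsubC -Dp.
have sz_r : (N < (size r).+1)%N by rewrite -(size_prod_XsubC r id) -Dp size_Xn_sub_1.
have [|z] := hasP (has_prim_root N0 rn1 _ sz_r); last by exists z.
by rewrite -separable_prod_XsubC -Dp separable_Xn_sub_1 // pnatr_eq0 -lt0n.
Qed.

Lemma prod_roots N (w a : K) : N.-primitive_root w -> \prod_(0 <= k < N) (1 - a * w ^+ k) = 1 - a ^+ N.
Proof.
move=> hw; have N0 := prim_order_gt0 hw.
have [->|a0] := eqVneq a 0.
  by rewrite expr0n gtn_eqF // subr0 big1 // => i _; rewrite mul0r subr0.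
have := congr1 (fun P => P.[a^-1]) (factor_Xn_sub_1 hw).
rewrite horner_prod !hornerE => e.
transitivity (a ^+ N * (a^-1 ^+ N - 1)); last first.
  by rewrite mulrBr mulr1 -exprMn mulfV // expr1n.
rewrite -e big_mkord -[N in a ^+ N]card_ord -prodr_const big_mkord -big_split /=.
by apply: eq_bigr => k _; rewrite !hornerE mulrBr mulfV.
Qed.

Lemma prim_root_half N (z : K) : (0 < N)%N -> (2 * N).-primitive_root z -> z ^+ N = -1.
Proof.
move=> N0 hz; have : (z ^+ N) ^+ 2 == 1 by rewrite -exprM mulnC prim_expr_order.
rewrite sqrf_eq1 -(prim_order_dvd hz) => /orP[|/eqP //].
by move=> /dvdn_leq; rewrite N0 => /(_ isT); lia.
Qed.

Lemma prim_root_sqr N (z : K) : (0 < N)%N -> (2 * N).-primitive_root z -> N.-primitive_root (z ^+ 2).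
Proof.
move=> N0 hz; have := exp_prim_root hz 2.
by rewrite (gcdn_idPl (dvdn_mulr N (dvdnn 2))) mulKn.
Qed.

(** When [z] is a primitive [2 N]-th root of unity, these are [N]-th roots of
    [(-1)^m]. *)
Definition nodes n (z : K) (m : nat) (i : 'I_n) := z ^+ (m + 2 * i).

Lemma prod_shifted_roots N (z a : K) m : (0 < N)%N -> (2 * N).-primitive_root z ->
  \prod_(0 <= k < N) (1 - a * z ^+ (m + 2 * k)) = 1 - (-1) ^+ m * a ^+ N.
Proof.
move=> N0 hz; have := prod_roots (a * z ^+ m) (prim_root_sqr N0 hz).
rewrite exprMn -exprM (mulnC m) exprM (prim_root_half N0 hz) (mulrC (a ^+ N)) => <-.
by apply: eq_bigr => k _; rewrite exprD exprM mulrA.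
Qed.

Lemma prim_root_neq1 N (z : K) k : (2 * N).-primitive_root z -> (0 < k)%N -> (k < 2 * N)%N -> z ^+ k != 1.
Proof.
by move=> hz k0 kN; rewrite -(prim_order_dvd hz); apply/negP => /dvdn_leq; rewrite k0 leqNgt kN => /(_ isT).
Qed.

Lemma prim_root_neq0 N (z : K) : (0 < N)%N -> N.-primitive_root z -> z != 0.
Proof.
move=> N0 hz; apply: contra_eq_neq (prim_expr_order hz) => ->.
by rewrite expr0n gtn_eqF // eq_sym oner_eq0.
Qed.

Lemma prod_rev_range (G : nat -> K) n M : (n <= M.+1)%N ->
  \prod_(i < n) G (M - i)%N = \prod_(M.+1 - n <= k < M.+1) G k.
Proof.
move=> nM; rewrite (reindex_inj rev_ord_inj) /= -[(M.+1 - n)%N]add0n.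
rewrite big_addn subKn // big_mkord; apply: eq_bigr => i _; congr G.
by have := ltn_ord i; lia.
Qed.

End Roots.

(** * The products over nodes in closed form *)

Section NodeTypes.
Variable K : numClosedFieldType.
Variables (n N m : nat) (z : K).
Hypotheses (n0 : (0 < n)%N) (N0 : (0 < N)%N) (hz : (2 * N).-primitive_root z).
Hypotheses (mN : (m <= N)%N) (nN : (n + m <= N.+1)%N).
Let b : 'I_n -> K := nodes z m.
Implicit Types (a q s : K).

Let z0 : z != 0.
Proof. by apply: prim_root_neq0 hz; rewrite muln_gt0. Qed.

Lemma nodes_neq0 i : b i != 0.
Proof. by rewrite expf_neq0. Qed.

Lemma nodes_exp i : b i ^+ N = (-1) ^+ m.
Proof.
by rewrite /b /nodes -exprM mulnC exprM (prim_root_half N0 hz) exprD exprM sqrrN !expr1n mulr1.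
Qed.

(** The inverse of the node of index [i] is the root of index [N - m - i], so nodes
    and inverses fill two ranges of roots. *)
Lemma nodeprod_nodes a : nodeprod b a =
  \prod_(0 <= k < n) (1 - a * z ^+ (m + 2 * k)) *
  \prod_((N - m).+1 - n <= k < (N - m).+1) (1 - a * z ^+ (m + 2 * k)).
Proof.
rewrite /nodeprod big_split /= big_mkord; congr (_ * _).
rewrite -(prod_rev_range (fun k => 1 - a * z ^+ (m + 2 * k))); last by lia.
apply: eq_bigr => i _; congr (1 - a * _).
apply: (mulfI (nodes_neq0 i)); rewrite mulfV ?nodes_neq0 // /b /nodes -exprD.
rewrite -[LHS](prim_expr_order hz); congr (z ^+ _); have := ltn_ord i; lia.
Qed.

Lemma weylD_nodes_neq0 : (forall i j, (i < j)%N -> (j < n)%N -> (0 < m + i + j < N)%N) ->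
  weylD b != 0.
Proof.
move=> hij; rewrite (weylDE nodes_neq0).
apply/prodf_neq0 => i _; apply/prodf_neq0 => j ij; have /andP[h1 h2] := hij _ _ ij (ltn_ord j).
rewrite !mulf_neq0 ?invr_eq0 ?nodes_neq0 // subr_eq0 eq_sym.
  by rewrite /b /nodes -exprD (prim_root_neq1 hz) //; lia.
have h3 : z ^+ (2 * (j - i)) != 1.
  by apply: (prim_root_neq1 hz); have := ltn_ord j; lia.
apply: contraNneq h3 => e.
have : b j = b i * z ^+ (2 * (j - i)) by rewrite /b /nodes -exprD; congr (z ^+ _); lia.
move=> e2; apply/eqP; apply: (mulfI (nodes_neq0 i)); rewrite -e2 mulr1.
by rewrite -[RHS](divfK (nodes_neq0 j)) e mul1r.
Qed.

Lemma nodes_neq1 : (0 < m)%N -> (m + 2 * n < 2 * N + 2)%N -> forall i, b i != 1.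
Proof. by move=> h1 h2 i; apply: (prim_root_neq1 hz); have := ltn_ord i; lia. Qed.

Lemma nodes_sqr_neq1 : (0 < m)%N -> (m + 2 * n < N + 2)%N -> forall i, b i ^+ 2 != 1.
Proof.
by move=> h1 h2 i; rewrite /b /nodes -exprM; apply: (prim_root_neq1 hz); have := ltn_ord i; lia.
Qed.

Lemma prod_roots_split (G : nat -> K) k : (k < N)%N ->
  \prod_(0 <= j < N) G j = \prod_(0 <= j < k) G j * G k * \prod_(k.+1 <= j < N) G j.
Proof.
move=> kN; rewrite (big_cat_nat _ (n := k)) //=; last exact: ltnW.
by rewrite [X in _ * X]big_ltn // mulrA.
Qed.

Lemma nodes_scaled q i : (q * b i) ^+ N = q ^+ N * (-1) ^+ m /\ (q / b i) ^+ N = q ^+ N * (-1) ^+ m.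
Proof.
rewrite !exprMn exprVn nodes_exp; split=> //; congr (_ * _).
by rewrite -exprVn invrN invr1.
Qed.

End NodeTypes.

Section SquareRoot.
Variable K : numClosedFieldType.
Variables (n : nat) (b : 'I_n -> K).

(** The sign of the square root is fixed at [q = 0]. *)
Lemma nodepair_sqrt (A B : K -> K) : polyfun A -> polyfun B -> A 0 = 1 -> B 0 = 1 ->
  (forall q, `|q| < 1 -> nodepair b q ^+ 2 * A q ^+ 2 = B q ^+ 2) ->
  forall q, nodepair b q * A q = B q.
Proof.
move=> pA pB A0 B0 h; apply: polyfun_eq_sqr => //.
- by apply: polyfunM => //; exact: polyfun_nodepair.
- by rewrite nodepair0 A0 mulr1.
- by move=> q q1; rewrite exprMn h.
Qed.

Lemma nodeprod_sqrtC q :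
  nodeprod (fun i => b i ^+ 2) q = nodeprod b (sqrtC q) * nodeprod b (- sqrtC q).
Proof. by rewrite -{1}[q]sqrtCK nodeprod_sqr. Qed.

Lemma polyfun_1subX k : polyfun (fun q : K => 1 - q ^+ k).
Proof. exact: polyfunB (polyfun_cst 1) (polyfunX k (polyfun_id K)). Qed.

Lemma polyfun_1addX k : polyfun (fun q : K => 1 + q ^+ k).
Proof. exact: polyfunD (polyfun_cst 1) (polyfunX k (polyfun_id K)). Qed.

Lemma polyfun_1sub : polyfun (fun q : K => 1 - q).
Proof. exact: polyfunB (polyfun_cst 1) (polyfun_id K). Qed.

Lemma polyfun_1add : polyfun (fun q : K => 1 + q).
Proof. exact: polyfunD (polyfun_cst 1) (polyfun_id K). Qed.

Lemma prod_scaled_nodeprod (c : K) q :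
  \prod_i ((1 - c * (q * b i)) * (1 - c * (q / b i))) = nodeprod b (c * q).
Proof. by apply: eq_bigr => i _; rewrite !mulrA. Qed.

Lemma prod_const_pair (x : K) : \prod_(i < n) (x * x) = x ^+ (2 * n).
Proof. by rewrite prodr_const card_ord -expr2 -exprM. Qed.

End SquareRoot.

Ltac prove_polyfun := repeat first
  [ apply: polyfunM | apply: polyfunX | exact: polyfun_1subX | exact: polyfun_1addX
  | exact: polyfun_1sub | exact: polyfun_1add ].

Section Nodes_2n.
Variable K : numClosedFieldType.
Variables (n : nat) (z : K).
Hypotheses (n0 : (0 < n)%N) (hz : (2 * (2 * n)).-primitive_root z).
Let b : 'I_n -> K := nodes z 1.

Let N0 : (0 < 2 * n)%N. Proof. by lia. Qed.

(** Nodes and inverses are all the [2n]-th roots of -1. *)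
Lemma nodeprod_2n a : nodeprod b a = 1 + a ^+ (2 * n).
Proof.
rewrite (nodeprod_nodes n0 N0 hz); try lia.
rewrite (_ : ((2 * n - 1).+1 - n = n)%N); last by lia.
rewrite (_ : ((2 * n - 1).+1 = 2 * n)%N); last by lia.
rewrite -(big_cat_nat _ (n := n)) //=; last by lia.
by rewrite (prod_shifted_roots _ _ N0 hz) expr1 mulN1r opprK.
Qed.

Lemma nodeprod_sq_2n q : nodeprod (fun i => b i ^+ 2) q = (1 + q ^+ n) ^+ 2.
Proof.
by rewrite nodeprod_sqrtC !nodeprod_2n !exprM sqrrN sqrtCK -expr2.
Qed.

Lemma nodepair_2n q : nodepair b q * ((1 - q) ^+ n * (1 + q ^+ n)) = (1 - q ^+ (2 * n)) ^+ n.
Proof.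
move: q; apply: nodepair_sqrt; [by prove_polyfun|by prove_polyfun| | |move=> q q1].
- by rewrite subr0 expr1n mul1r expr0n gtn_eqF // addr0.
- by rewrite expr0n gtn_eqF // subr0 expr1n.
have := nodepair_sqr q (nodes_neq0 1 N0 hz (n := n)); rewrite -/b nodeprod_sq_2n.
rewrite (eq_bigr (fun=> (1 - q ^+ (2 * n)) * (1 - q ^+ (2 * n)))); last first.
  move=> i _; rewrite !nodeprod_2n.
  by have [-> ->] := nodes_scaled 1 N0 hz q i; rewrite expr1 mulrN1.
by rewrite prod_const_pair => e; rewrite exprMn -exprM muln2 e -exprM mulnC.
Qed.
End Nodes_2n.

Section Nodes_2n_sub1.
Variable K : numClosedFieldType.
Variables (n : nat) (z : K).
Hypotheses (n0 : (0 < n)%N) (hz : (2 * (2 * n - 1)).-primitive_root z).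
Let b : 'I_n -> K := nodes z 1.

Let N0 : (0 < 2 * n - 1)%N. Proof. by lia. Qed.
Let sgnN : (-1 : K) ^+ (2 * n - 1) = -1.
Proof. by rewrite -signr_odd oddB ?oddM //=; lia. Qed.

(** Nodes and inverses are all the [(2n - 1)]-th roots of -1, and -1 occurs
    twice. *)
Lemma nodeprod_2n_sub1 a : nodeprod b a = (1 + a ^+ (2 * n - 1)) * (1 + a).
Proof.
rewrite (nodeprod_nodes n0 N0 hz); try lia.
rewrite (_ : ((2 * n - 1 - 1).+1 - n = n.-1)%N); last by lia.
rewrite (_ : ((2 * n - 1 - 1).+1 = 2 * n - 1)%N); last by lia.
rewrite [X in _ * X]big_ltn; last by lia.
rewrite (prednK n0) mulrCA -(big_cat_nat _ (n := n)) //=; last by lia.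
rewrite (prod_shifted_roots _ _ N0 hz) expr1 mulN1r opprK mulrC; congr (_ * _).
rewrite (_ : (1 + 2 * n.-1 = 2 * n - 1)%N); last by lia.
by rewrite (prim_root_half N0 hz) mulrN1 opprK.
Qed.

Lemma nodeprod_sq_2n_sub1 q : nodeprod (fun i => b i ^+ 2) q = (1 - q ^+ (2 * n - 1)) * (1 - q).
Proof.
rewrite nodeprod_sqrtC !nodeprod_2n_sub1 -[in RHS](sqrtCK q) exprNn sgnN.
by rewrite -exprM (mulnC 2 (2 * n - 1)%N) exprM; ring.
Qed.

Lemma nodepair_2n_sub1 q : nodepair b q * (1 - q) ^+ n = (1 - q ^+ (2 * n - 1)) ^+ n.
Proof.
move: q; apply: nodepair_sqrt; [by prove_polyfun|by prove_polyfun| | |move=> q q1].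
- by rewrite subr0 expr1n.
- by rewrite expr0n gtn_eqF // subr0 expr1n.
have := nodepair_sqr q (nodes_neq0 1 N0 hz (n := n)); rewrite -/b nodeprod_sq_2n_sub1.
rewrite (eq_bigr (fun i => (1 - q ^+ (2 * n - 1)) * (1 - q ^+ (2 * n - 1)) *
    ((1 - (-1) * (q * b i)) * (1 - (-1) * (q / b i))))); last first.
  move=> i _; rewrite !nodeprod_2n_sub1.
  have [-> ->] := nodes_scaled 1 N0 hz q i; rewrite expr1; ring.
rewrite big_split /= prod_const_pair prod_scaled_nodeprod nodeprod_2n_sub1 exprMn sgnN => e.
have h1 := subr1X_neq0 q1 N0; have h2 := subr1X_neq0 q1 (isT : (0 < 1)%N); rewrite expr1 in h2.
apply: (mulIf (mulf_neq0 h1 h2)); rewrite -mulrA -!exprM !muln2 e mul2n; ring.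
Qed.
End Nodes_2n_sub1.

Section Nodes_2n_add2.
Variable K : numClosedFieldType.
Variables (n : nat) (z : K).
Hypotheses (n0 : (0 < n)%N) (hz : (2 * (2 * n + 2)).-primitive_root z).
Let b : 'I_n -> K := nodes z 2.

Let N0 : (0 < 2 * n + 2)%N. Proof. by lia. Qed.

(** Nodes and inverses are the [(2n + 2)]-th roots of 1 other than 1 and -1. *)
Lemma nodeprod_2n_add2 a : nodeprod b a * (1 - a ^+ 2) = 1 - a ^+ (2 * n + 2).
Proof.
rewrite (nodeprod_nodes n0 N0 hz); try lia.
rewrite (_ : ((2 * n + 2 - 2).+1 - n = n.+1)%N); last by lia.
rewrite (_ : ((2 * n + 2 - 2).+1 = 2 * n + 1)%N); last by lia.
have := prod_shifted_roots a 2 N0 hz; rewrite sqrrN expr1n mul1r => <-.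
rewrite [RHS](prod_roots_split _ (k := n)); last by lia.
rewrite [X in _ = _ * X](big_cat_nat _ (n := (2 * n + 1)%N)) /=; [|lia|lia].
rewrite [X in _ = _ * (_ * X)](_ : _ = \prod_(2 * n + 1 <= k < (2 * n + 1).+1) (1 - a * z ^+ (2 + 2 * k))); last first.
  by congr (\prod_(_ <= k < _) _); lia.
rewrite big_nat1 (_ : (2 + 2 * n = 2 * n + 2)%N) ?(prim_root_half N0 hz); last by lia.
rewrite (_ : (2 + 2 * (2 * n + 1) = 2 * (2 * n + 2))%N) ?(prim_expr_order hz); last by lia.
ring.
Qed.

Lemma nodeprod_sq_2n_add2 q : nodeprod (fun i => b i ^+ 2) q * (1 - q) ^+ 2 = (1 - q ^+ n.+1) ^+ 2.
Proof.
have h1 := nodeprod_2n_add2 (sqrtC q); have h2 := nodeprod_2n_add2 (- sqrtC q).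
rewrite nodeprod_sqrtC; move: h1 h2; rewrite sqrrN sqrtCK.
rewrite (_ : (2 * n + 2 = 2 * n.+1)%N); last by lia.
rewrite !exprM sqrrN sqrtCK => h1 h2.
by rewrite expr2 mulrACA h1 h2 expr2.
Qed.

Lemma nodepair_2n_add2 q : nodepair b q * ((1 - q) ^+ n.-1 * (1 - q ^+ n.+1)) =
  (1 - q ^+ (2 * n + 2)) ^+ n.-1 * (1 - q ^+ 2).
Proof.
move: q; apply: nodepair_sqrt; [by prove_polyfun|by prove_polyfun| | |move=> q q1].
- by rewrite subr0 expr1n mul1r expr0n subr0.
- by rewrite !expr0n gtn_eqF // !subr0 expr1n mulr1.
have := nodepair_sqr q (nodes_neq0 2 N0 hz (n := n)); rewrite -/b.
set Pr := \prod_i _ => e.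
have hPr : Pr * (nodeprod b (1 * q) * nodeprod b (- 1 * q)) = (1 - q ^+ (2 * n + 2)) ^+ (2 * n).
  rewrite -!prod_scaled_nodeprod -!big_split /= -prod_const_pair; apply: eq_bigr => i _.
  have [h1 h2] := nodes_scaled 2 N0 hz q i; rewrite sqrrN expr1n mulr1 -/(b i) in h1 h2.
  rewrite -{1}h1 -h2 -!nodeprod_2n_add2; ring.
rewrite mul1r mulN1r in hPr.
have h1 := nodeprod_2n_add2 q; have := nodeprod_2n_add2 (- q); rewrite sqrrN.
rewrite (_ : (- q) ^+ (2 * n + 2) = q ^+ (2 * n + 2)); last first.
  by rewrite (_ : (2 * n + 2 = 2 * n.+1)%N) ?exprM ?sqrrN //; lia.
move=> h2; have h3 := nodeprod_sq_2n_add2 q.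
have nz := subr1X_neq0 q1 N0.
have hn : (n.*2 = 2 + n.-1 * 2)%N by lia.
have hX : (1 - q ^+ (2 * n + 2)) ^+ (2 * n) =
    (1 - q ^+ (2 * n + 2)) ^+ 2 * (1 - q ^+ (2 * n + 2)) ^+ (n.-1 * 2).
  by rewrite -exprD; congr (_ ^+ _); lia.
rewrite hn exprD in e.
apply: (mulIf (expf_neq0 2 nz)).
transitivity (Pr * ((1 - q ^+ (2 * n + 2)) * (1 - q ^+ (2 * n + 2)))).
  rewrite -e !exprMn -!exprM -h3; ring.
transitivity (Pr * (nodeprod b q * nodeprod b (- q)) * ((1 - q ^+ 2) * (1 - q ^+ 2))).
  by rewrite -{1}h1 -h2; ring.
rewrite hPr hX !exprMn -!exprM; ring.
Qed.
End Nodes_2n_add2.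

Section Nodes_2n_add1.
Variable K : numClosedFieldType.
Variables (n : nat) (z : K).
Hypotheses (n0 : (0 < n)%N) (hz : (2 * (2 * n + 1)).-primitive_root z).
Let b : 'I_n -> K := nodes z 2.

Let N0 : (0 < 2 * n + 1)%N. Proof. by lia. Qed.

(** Nodes and inverses are the [(2n + 1)]-th roots of 1 other than 1. *)
Lemma nodeprod_2n_add1 a : nodeprod b a * (1 - a) = 1 - a ^+ (2 * n + 1).
Proof.
rewrite (nodeprod_nodes n0 N0 hz); try lia.
rewrite (_ : ((2 * n + 1 - 2).+1 - n = n)%N); last by lia.
rewrite (_ : ((2 * n + 1 - 2).+1 = 2 * n)%N); last by lia.
have := prod_shifted_roots a 2 N0 hz; rewrite sqrrN expr1n mul1r => <-.
rewrite -(big_cat_nat _ (n := n)) //=; last by lia.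
rewrite addn1 big_nat_recr //=.
rewrite (_ : (2 + 2 * (2 * n) = 2 * (2 * n + 1))%N) ?(prim_expr_order hz) ?mulr1 //; lia.
Qed.

Lemma nodeprod_sq_2n_add1 q : nodeprod (fun i => b i ^+ 2) q * (1 - q) = 1 - q ^+ (2 * n + 1).
Proof.
rewrite nodeprod_sqrtC; move: (sqrtC q) (sqrtCK q) => s <-.
transitivity ((1 - s ^+ (2 * n + 1)) * (1 - (- s) ^+ (2 * n + 1))).
  by rewrite -!nodeprod_2n_add1; ring.
have e2 : (s ^+ 2) ^+ (2 * n + 1) = (s ^+ (2 * n + 1)) ^+ 2 by rewrite -!exprM mulnC.
have e3 : (- s) ^+ (2 * n + 1) = - s ^+ (2 * n + 1).
  by rewrite exprNn -signr_odd oddD oddM mulN1r.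
by rewrite e2 e3; ring.
Qed.

Lemma nodepair_2n_add1 q : nodepair b q * (1 - q) ^+ n.-1 = (1 - q ^+ (2 * n + 1)) ^+ n.-1.
Proof.
move: q; apply: nodepair_sqrt; [by prove_polyfun|by prove_polyfun| | |move=> q q1].
- by rewrite subr0 expr1n.
- by rewrite expr0n gtn_eqF // subr0 expr1n.
have := nodepair_sqr q (nodes_neq0 2 N0 hz (n := n)); rewrite -/b.
set Pr := \prod_i _ => e.
have hPr : Pr * nodeprod b (1 * q) = (1 - q ^+ (2 * n + 1)) ^+ (2 * n).
  rewrite -prod_scaled_nodeprod -big_split /= -prod_const_pair; apply: eq_bigr => i _.
  have [h1 h2] := nodes_scaled 2 N0 hz q i; rewrite sqrrN expr1n mulr1 -/(b i) in h1 h2.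
  rewrite -{1}h1 -h2 -!nodeprod_2n_add1; ring.
rewrite mul1r in hPr.
have h1 := nodeprod_2n_add1 q; have h3 := nodeprod_sq_2n_add1 q.
have nz := subr1X_neq0 q1 N0; have nz1 := subr1X_neq0 q1 (isT : (0 < 1)%N); rewrite expr1 in nz1.
have hn : (n.*2 = 2 + n.-1 * 2)%N by lia.
have hX : (1 - q ^+ (2 * n + 1)) ^+ (2 * n) =
    (1 - q ^+ (2 * n + 1)) ^+ 2 * (1 - q ^+ (2 * n + 1)) ^+ (n.-1 * 2).
  by rewrite -exprD; congr (_ ^+ _); lia.
rewrite hn exprD in e.
apply: (mulIf (mulf_neq0 nz1 (expf_neq0 2 nz))).
transitivity (Pr * (1 - q ^+ (2 * n + 1))).
  rewrite -e -!exprM -h3; ring.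
transitivity (Pr * nodeprod b q * (1 - q)); first by rewrite -h1; ring.
rewrite hPr hX -!exprM; ring.
Qed.
End Nodes_2n_add1.

Section Nodes_2n_sub2.
Variable K : numClosedFieldType.
Variables (n : nat) (z : K).
Hypotheses (n1 : (1 < n)%N) (hz : (2 * (2 * n - 2)).-primitive_root z).
Let b : 'I_n -> K := nodes z 0.

Let n0 : (0 < n)%N. Proof. by lia. Qed.
Let N0 : (0 < 2 * n - 2)%N. Proof. by lia. Qed.

(** Nodes and inverses are all the [(2n - 2)]-th roots of 1, and 1 and -1 occur
    twice. *)
Lemma nodeprod_2n_sub2 a : nodeprod b a = (1 - a ^+ (2 * n - 2)) * (1 - a ^+ 2).
Proof.
rewrite (nodeprod_nodes n0 N0 hz); try lia.
rewrite (_ : ((2 * n - 2 - 0).+1 - n = n.-1)%N); last by lia.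
rewrite subn0 big_nat_recr /=; last by lia.
rewrite [X in _ * (X * _)]big_ltn; last by lia.
rewrite (prednK n0).
have := prod_shifted_roots a 0 N0 hz; rewrite mul1r => <-.
rewrite [RHS]mulrC [X in _ = _ * X](big_cat_nat _ (n := n)) //=; last by lia.
rewrite (_ : (0 + 2 * n.-1 = 2 * n - 2)%N) ?(prim_root_half N0 hz); last by lia.
rewrite !add0n (prim_expr_order hz); ring.
Qed.

Lemma nodeprod_sq_2n_sub2 q : nodeprod (fun i => b i ^+ 2) q = (1 - q ^+ n.-1) ^+ 2 * (1 - q) ^+ 2.
Proof.
rewrite nodeprod_sqrtC !nodeprod_2n_sub2 (_ : (2 * n - 2 = 2 * n.-1)%N); last by lia.
by rewrite !exprM sqrrN sqrtCK; ring.
Qed.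

Lemma nodepair_2n_sub2 q : nodepair b q * (1 - q) ^+ n =
  (1 - q ^+ (2 * n - 2)) ^+ n * ((1 + q) * (1 + q ^+ n.-1)).
Proof.
move: q; apply: nodepair_sqrt; [by prove_polyfun|by prove_polyfun| | |move=> q q1].
- by rewrite subr0 expr1n.
- by rewrite !expr0n !gtn_eqF ?subr0 ?expr1n ?addr0 ?mulr1 //; lia.
have := nodepair_sqr q (nodes_neq0 0 N0 hz (n := n)); rewrite -/b nodeprod_sq_2n_sub2.
set Pr := \prod_i _ => e.
have hPr : Pr = (1 - q ^+ (2 * n - 2)) ^+ (2 * n) * (nodeprod b (1 * q) * nodeprod b (- 1 * q)).
  rewrite -!prod_scaled_nodeprod -prod_const_pair -!big_split /=; apply: eq_bigr => i _.
  have [h1 h2] := nodes_scaled 0 N0 hz q i; rewrite mulr1 -/(b i) in h1 h2.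
  rewrite !nodeprod_2n_sub2 h1 h2; ring.
rewrite mul1r mulN1r !nodeprod_2n_sub2 sqrrN in hPr.
have eN : (2 * n - 2 = 2 * n.-1)%N by lia.
have h0 : (- q) ^+ (2 * n - 2) = q ^+ (2 * n - 2) by rewrite eN !exprM sqrrN.
rewrite h0 in hPr.
have n10 : (0 < n.-1)%N by lia.
have nz := subr1X_neq0 q1 n10; have nz1 := subr1X_neq0 q1 (isT : (0 < 1)%N); rewrite expr1 in nz1.
apply: (mulIf (expf_neq0 2 (mulf_neq0 nz1 nz))).
transitivity Pr; first by rewrite -e -!exprM muln2; ring.
have hE : (1 - q ^+ (2 * n - 2)) ^+ (2 * n) = ((1 - q ^+ (2 * n - 2)) ^+ n) ^+ 2.
  by rewrite -exprM mulnC.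
have hM : q ^+ (2 * n - 2) = (q ^+ n.-1) ^+ 2 by rewrite -exprM eN mulnC.
rewrite hPr hE hM; ring.
Qed.
End Nodes_2n_sub2.

(** * The constant from the nodes *)

Section ConstantFromNodes.
Variable K : numClosedFieldType.
Hypothesis Kc : geometric_complete K.
Variable p : K.
Hypotheses (p0 : p != 0) (p1 : `|p| < 1).
Implicit Types (q u a : K).

Lemma qpoch_small_neq0 a q : q != 0 -> `|q| < 1 -> `|a| < 1 -> qpoch a q != 0.
Proof.
move=> q0 q1 a1; apply: (qpoch_neq0 Kc q0 q1) => j.
apply: contraTneq a1 => e; have : `|a| * `|q| ^+ j = 1 by rewrite -normrX -normrM e normr1.
move=> h; apply/negP => a1; have : `|a| * `|q| ^+ j < 1.
  by apply: le_lt_trans a1; rewrite ler_piMr // exprn_ile1 // ltW.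
by rewrite h ltxx.
Qed.

Lemma qpoch_bisect a q : q != 0 -> `|q| < 1 ->
  qpoch a q = qpoch a (q ^+ 2) * qpoch (a * q) (q ^+ 2).
Proof.
move=> q0 q1; rewrite -(qpoch_multisection Kc a q0 q1 (isT : 0 < 2)%N).
by rewrite big_ord_recl big_ord1 /= expr0 mulr1 expr1.
Qed.

Lemma qpoch_sqr_self q : q != 0 -> `|q| < 1 -> qpoch (q ^+ 2) (q ^+ 2) = qpoch q q * qpoch (- q) q.
Proof. exact: qpoch_sqr. Qed.

Section Levels.
Variables (u q : K).
Hypotheses (q0 : q != 0) (q1 : `|q| < 1).

Lemma iprod_sub : has_iprod u q (fun t => 1 - t) (qpoch u q).
Proof.
have := has_iprod_factor1 Kc (u := u) (a := 1) q0 q1; rewrite mulr1.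
by under eq_fun do rewrite mulr1.
Qed.

Lemma iprod_add : has_iprod u q (fun t => 1 + t) (qpoch (- u) q).
Proof.
have := has_iprod_factor1 Kc (u := u) (a := - 1) q0 q1; rewrite mulrN1.
by under eq_fun do rewrite mulrN1 opprK.
Qed.

Lemma iprod_subX k : (0 < k)%N -> has_iprod u q (fun t => 1 - t ^+ k) (qpoch (u ^+ k) (q ^+ k)).
Proof.
move=> k0; have := has_iprod_factor Kc (u := u) (a := 1) q0 q1 k0; rewrite mul1r.
by under eq_fun do rewrite mul1r.
Qed.

Lemma iprod_addX k : (0 < k)%N -> has_iprod u q (fun t => 1 + t ^+ k) (qpoch (- u ^+ k) (q ^+ k)).
Proof.
move=> k0; have := has_iprod_factor Kc (u := u) (a := - 1) q0 q1 k0; rewrite mulN1r.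
by under eq_fun do rewrite mulN1r opprK.
Qed.

End Levels.

Lemma iprod_eq u q (F G : K -> K) v w : (forall t, F t = G t) ->
  has_iprod u q F v -> has_iprod u q G w -> v = w.
Proof. by move=> /funext ->; exact: has_iprod_uniq. Qed.

Lemma nodepair_iprod n (b : 'I_n -> K) : exists v, has_iprod p p (nodepair b) v.
Proof.
exists (\prod_(i < n) \prod_(j < n | (i < j)%N) (theta_tail (b i * b j) p * theta_tail (b i / b j) p)).
apply: has_iprod_prod => i _; apply: has_iprod_prod => j _; apply: has_iprodM;
exact: (has_iprod_theta_tail Kc).
Qed.

Lemma nodeprod_iprod n (b : 'I_n -> K) u q : q != 0 -> `|q| < 1 ->
  has_iprod u q (nodeprod b) (\prod_i (qpoch (u * b i) q * qpoch (u / b i) q)).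
Proof. by move=> q0 q1; apply: has_iprod_prod => i _; exact: (has_iprod_theta_tail Kc). Qed.

(** At the nodes, the classical factor [G * weylD b] is common to the determinant
    and to the denominator. What remains is [X * kap] on one side, with [X] the
    product of the theta factors of the columns, and [vphi * vQ] on the other, the
    infinite products from [phi] and from [W_D]. *)
Lemma alternant_from_nodes n N (c eps : K) (sg m0 : int) (phi : K -> K) (pre : seq K) (d0 : nat)
    (b : 'I_n -> K) (eta kap G vphi vQ K0 X : K) :
  (0 < n)%N -> (0 < N)%N -> (N = size pre + 2 * (n - 1))%N -> all (fun a => a != 0) pre ->
  (forall y, y != 0 -> phi y = y ^- d0 * \prod_(z <- pre) theta (z * y) p) ->
  c = - (\prod_(z <- pre) (- z)) * p ^+ (d0 + (n - 1)) -> c ^+ 2 * p ^ sg = p ^+ N ->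
  eps ^+ 2 = 1 -> (forall y, y != 0 -> y ^ sg * phi y^-1 = - eps * phi y) ->
  (forall m : int, m0 <= m < m0 + N%:Z ->
    [\/ m0 <= m < m0 + n%:Z, m0 <= sg - m < m0 + n%:Z,
      m = sg - m /\ eps = 1 | [/\ m = sg - m + N%:Z, eps = 1 & c * p ^ (sg - m) = -1]]) ->
  (forall i, b i != 0) -> (forall i, b i ^+ N = eta) -> eta ^+ 2 = 1 -> weylD b != 0 ->
  \det (\matrix_(i < n, j < n) (b i ^ (m0 + j%:Z) - eps * b i ^ (sg - (m0 + j%:Z)))) =
    kap * G * weylD b ->
  kap != 0 -> G != 0 -> \prod_i phi (b i) = G * vphi -> has_iprod p p (nodepair b) vQ ->
  X = \prod_(j < n) theta (eta * c * p ^ (m0 + j%:Z)) (p ^+ N) -> X != 0 ->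
  X * kap = K0 * (vphi * vQ) ->
  forall x : 'I_n -> K, (forall i, x i != 0) ->
    alternant (fun j : 'I_n => theta_symbasis p N c eps sg (m0 + j%:Z)) x =
    K0 * (\prod_i phi (x i) * W_D p x).
Proof.
move=> n0 N0 eN pre0 phiE ec c2 eps2 phis cover b0 bN eta2 wD detE kap0 G0 phib hQ XE X0 XK.
have WDb := W_D_nodes Kc p0 p1 b0 hQ.
have fb := alternant_nodes p c eps sg m0 b0 bN eta2.
rewrite detE -XE in fb.
apply: (alternant_evaluation (b := b)).
- exact: (W_proportional Kc p0 p1 n0 N0 eN pre0 phiE ec c2 eps2 phis cover b0).
- rewrite fb phib WDb; transitivity (X * kap * (G * weylD b)); first by ring.
  rewrite XK; ring.
- by rewrite fb !mulf_neq0.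
Qed.

(** Theta constants of the columns. Each is a product of two of the
    [A k = (- p^k; p^N)_oo], whose indices sum to [N]; over the columns these
    indices nearly fill [0, ..., N]. *)
Section ThetaNodes.
Variable N : nat.
Hypothesis N0 : (0 < N)%N.
Let A k := qpoch (- p ^+ k) (p ^+ N).

Let q0 : p ^+ N != 0. Proof. by rewrite expf_neq0. Qed.
Let q1 : `|p ^+ N| < 1. Proof. exact: normXn_lt1. Qed.

Lemma theta_opp_pow k : (k <= N)%N -> theta (- p ^+ k) (p ^+ N) = A k * A (N - k).
Proof.
move=> kN; have pk : p ^+ k != 0 by rewrite expf_neq0.
have e : p ^+ N / (- p ^+ k) = - p ^+ (N - k).
  by rewrite -{1}(subnK kN) exprD invrN mulrN mulfK.
by rewrite /theta e.
Qed.

Lemma prod_qpoch_opp : \prod_(1 <= k < N.+1) A k = qpoch (- p) p.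
Proof.
rewrite -(qpoch_multisection Kc (- p) p0 p1 N0) big_add1 big_mkord.
by apply: eq_bigr => k _; rewrite /A exprS mulNr.
Qed.

Lemma qpoch_opp1 : A 0 = 2 * A N.
Proof. by rewrite /A expr0 (qpoch_rec Kc _ q0 q1) opprK mulrN1. Qed.

Lemma prod_qpoch_opp0 : \prod_(0 <= k < N.+1) A k = 2 * A N * qpoch (- p) p.
Proof. by rewrite big_ltn // prod_qpoch_opp qpoch_opp1. Qed.

Lemma prod_theta_opp_pow n (s : nat) : (s + n <= N.+1)%N ->
  \prod_(j < n) theta (- p ^+ (s + j)) (p ^+ N) =
  \prod_(s <= k < s + n) A k * \prod_((N - s).+1 - n <= k < (N - s).+1) A k.
Proof.
move=> h; rewrite (eq_bigr (fun j : 'I_n => A (s + j) * A (N - s - j))); last first.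
  by move=> j _; rewrite theta_opp_pow ?subnDA //; have := ltn_ord j; lia.
rewrite big_split /=; congr (_ * _); last first.
  by rewrite -(prod_rev_range (fun k => A k)) //; lia.
rewrite -[X in \prod_(X <= _ < _) _]add0n big_addn (addnC s n) addnK big_mkord.
by apply: eq_bigr => j _; rewrite addnC.
Qed.

End ThetaNodes.

Lemma qpoch_opp_neq0 k N : (0 < k)%N -> (0 < N)%N -> qpoch (- p ^+ k) (p ^+ N) != 0.
Proof.
move=> k0 N0; apply: qpoch_small_neq0; first by rewrite expf_neq0.
  exact: normXn_lt1.
by rewrite normrN normXn_lt1.
Qed.

Lemma qpoch_pow_neq0 k N : (0 < k)%N -> (0 < N)%N -> qpoch (p ^+ k) (p ^+ N) != 0.
Proof.
move=> k0 N0; apply: qpoch_small_neq0; first by rewrite expf_neq0.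
  exact: normXn_lt1.
by rewrite normXn_lt1.
Qed.

End ConstantFromNodes.

Section WeylTypes.
Variable K : numClosedFieldType.

Lemma weyl_det_B n (b : 'I_n -> K) (m0 : int) : (0 < n)%N -> (forall i, b i != 0) ->
  m0 = 1 - n%:Z ->
  \det (\matrix_(i < n, j < n) (b i ^ (m0 + j%:Z) - 1 * b i ^ (1 - (m0 + j%:Z)))) =
  1 * \prod_i (1 - b i) * weylD b.
Proof.
move=> n0 b0 ->.
rewrite -(weyl_det (c0 := 1) (c1 := 1) (g := fun y => 1 - y)
   (phi := fun k y => y ^- k - y ^+ k.+1)) ?oner_neq0 //.
- congr (\det _); apply/matrixP => i j; rewrite !mxE mul1r.
  have hj := ltn_ord j.
  rewrite (_ : 1 - n%:Z + j%:Z = - (n - j.+1)%:Z); last by lia.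
  by rewrite opprK -exprnN (_ : 1 + (n - j.+1)%:Z = (n - j.+1).+1%:Z) //; lia.
- by move=> i; rewrite expr0 invr1 mulr1.
- by move=> i; rewrite /inv_sum; field.
- by move=> i k; rewrite /inv_sum !exprS; field; rewrite b0 expf_neq0.
Qed.

Lemma weyl_det_C n (b : 'I_n -> K) (m0 : int) : (0 < n)%N -> (forall i, b i != 0) ->
  m0 = - n%:Z ->
  \det (\matrix_(i < n, j < n) (b i ^ (m0 + j%:Z) - 1 * b i ^ (0 - (m0 + j%:Z)))) =
  1 * \prod_i ((b i)^-1 - b i) * weylD b.
Proof.
move=> n0 b0 ->.
rewrite -(weyl_det (c0 := 1) (c1 := 0) (g := fun y => y^-1 - y)
   (phi := fun k y => y ^- k.+1 - y ^+ k.+1)) ?oner_neq0 //.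
- congr (\det _); apply/matrixP => i j; rewrite !mxE mul1r.
  have hj := ltn_ord j.
  rewrite (_ : - n%:Z + j%:Z = - (n - j.+1).+1%:Z); last by lia.
  by rewrite sub0r opprK -exprnN.
- by move=> i; rewrite expr1 mulr1.
- by move=> i; rewrite /inv_sum; field.
- by move=> i k; rewrite /inv_sum !exprS; field; rewrite b0 expf_neq0.
Qed.

Lemma weyl_det_D n (b : 'I_n -> K) (m0 : int) : (0 < n)%N -> (forall i, b i != 0) ->
  m0 = 1 - n%:Z ->
  \det (\matrix_(i < n, j < n) (b i ^ (m0 + j%:Z) - (- 1) * b i ^ (0 - (m0 + j%:Z)))) =
  2 * \prod_(i < n) 1 * weylD b.
Proof.
move=> n0 b0 ->.
rewrite -(weyl_det (c0 := 2) (c1 := 0) (g := fun=> 1)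
   (phi := fun k y => y ^- k + y ^+ k)) ?pnatr_eq0 //.
- congr (\det _); apply/matrixP => i j; rewrite !mxE mulN1r opprK.
  have hj := ltn_ord j.
  rewrite (_ : 1 - n%:Z + j%:Z = - (n - j.+1)%:Z); last by lia.
  by rewrite sub0r opprK -exprnN.
- by move=> i; rewrite expr0 invr1 mul1r.
- by move=> i; rewrite /inv_sum expr1 mul1r addr0 addrC.
- by move=> i k; rewrite /inv_sum !exprS; field; rewrite b0 expf_neq0.
Qed.

End WeylTypes.

Arguments iprod_sub {K} Kc u {q} q0 q1.
Arguments iprod_add {K} Kc u {q} q0 q1.
Arguments iprod_subX {K} Kc u {q} q0 q1 {k} k0.
Arguments iprod_addX {K} Kc u {q} q0 q1 {k} k0.
Arguments nodeprod_iprod {K} Kc {n} b u {q} q0 q1.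

(** * Type B *)

Section TypeB.
Variable K : numClosedFieldType.
Hypothesis Kc : geometric_complete K.
Variable p : K.
Hypotheses (p0 : p != 0) (p1 : `|p| < 1).
Variable n : nat.
Hypothesis n0 : (0 < n)%N.

Let pp0 : qpoch p p != 0.
Proof. exact: (qpoch_pow_neq0 Kc p0 p1 (isT : 0 < 1)%N (isT : 0 < 1)%N). Qed.

Lemma exprzn_mul (a k : nat) (l : int) : l = k%:Z - a%:Z -> p ^+ a * p ^ l = p ^+ k.
Proof. by move=> ->; rewrite !exprnP -expfzDr // addrC subrK. Qed.

Lemma prod_theta_tails q (b : 'I_n -> K) : q != 0 -> `|q| < 1 ->
  \prod_i theta (b i) q = \prod_i (1 - b i) * \prod_i (qpoch (q * b i) q * qpoch (q / b i) q).
Proof.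
by move=> q0 q1; rewrite -big_split; apply: eq_bigr => i _; rewrite (theta_tailE Kc).
Qed.

Lemma prod_theta_sqr_tails q (b : 'I_n -> K) : q != 0 -> `|q| < 1 -> (forall i, b i != 0) ->
  \prod_i ((b i)^-1 * theta (b i ^+ 2) q) = \prod_i ((b i)^-1 - b i) *
    \prod_i (qpoch (q * b i ^+ 2) q * qpoch (q / b i ^+ 2) q).
Proof.
move=> q0 q1 b0; rewrite -big_split; apply: eq_bigr => i _ /=.
by rewrite (theta_tailE Kc) // /theta_tail; field.
Qed.

(** The nodes satisfy [b^(2n-1) = -1]; the value 1 would annihilate the first
    column. *)
Lemma alternant_B (x : 'I_n -> K) : (forall i, x i != 0) ->
  alternant (fun j : 'I_n => theta_symbasis p (2 * n - 1) (p ^+ (n - 1)) 1 1 (1 - n%:Z + j%:Z)) x =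
  2 * qpoch p p ^+ n / qpoch (p ^+ (2 * n - 1)) (p ^+ (2 * n - 1)) ^+ n * W_B p x.
Proof.
move=> hx; have N0 : (0 < 2 * n - 1)%N by lia.
have M0 : (0 < 2 * (2 * n - 1))%N by lia.
have [z hz] := prim_root_exists K M0.
pose b : 'I_n -> K := nodes z 1.
have b0 : forall i, b i != 0 by exact: (nodes_neq0 1 N0 hz).
have [vQ hQ] := nodepair_iprod Kc p0 p1 b.
have eQ := iprod_eq (nodepair_2n_sub1 n0 hz) (has_iprodM hQ (has_iprodX (k := n) (iprod_sub Kc p p0 p1)))
  (has_iprodX (k := n) (iprod_subX Kc p p0 p1 N0)).
have ephi := iprod_eq (nodeprod_2n_sub1 n0 hz) (nodeprod_iprod Kc b p p0 p1)
  (has_iprodM (iprod_addX Kc p p0 p1 N0) (iprod_add Kc p p0 p1)).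
have nA := qpoch_opp_neq0 Kc p0 p1 N0 N0; have nS := qpoch_pow_neq0 Kc p0 p1 N0 N0.
have nA1 := qpoch_opp_neq0 Kc p0 p1 (isT : (0 < 1)%N) (isT : (0 < 1)%N); rewrite expr1 in nA1.
pose X := 2 * qpoch (- p ^+ (2 * n - 1)) (p ^+ (2 * n - 1)) * qpoch (- p) p.
rewrite /W_B; apply: (alternant_from_nodes Kc p0 p1 (phi := fun y => theta y p) (pre := [:: 1]) (d0 := 0)
  (b := b) (eta := -1) (kap := 1) (G := \prod_i (1 - b i)) (vQ := vQ) (X := X)
  (vphi := \prod_i (qpoch (p * b i) p * qpoch (p / b i) p))) => //.
- by rewrite /=; clear -n0; lia.
- by rewrite /= oner_neq0.
- by move=> y y0; rewrite big_seq1 expr0 invr1 !mul1r.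
- by rewrite big_seq1 opprK mul1r.
- by rewrite -exprM -exprSr; congr (p ^+ _); clear -n0; lia.
- by rewrite expr1n.
- by move=> y y0; rewrite (thetaV Kc) // expr1z; field.
- move=> m hm; have [m1|m1] := lerP m 0; [apply: Or41|apply: Or42]; clear -m1 hm; lia.
- by move=> i; rewrite (nodes_exp 1 N0 hz) expr1.
- by rewrite sqrrN expr1n.
- by apply: (weylD_nodes_neq0 n0 N0 hz) => [||i j ij jn]; clear -n0 ij jn || clear -n0; lia.
- exact: weyl_det_B.
- by apply/prodf_neq0 => i _; rewrite subr_eq0 eq_sym (nodes_neq1 n0 N0 hz) //; clear -n0; lia.
- exact: prod_theta_tails.
- rewrite /X; transitivity (\prod_(j < n) theta (- p ^+ (0 + j)) (p ^+ (2 * n - 1))); last first.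
    apply: eq_bigr => j _; rewrite add0n mulN1r mulNr (exprzn_mul (k := j)) //; clear -n0; lia.
  rewrite (prod_theta_opp_pow p0 p1 N0) //; last by clear -n0; lia.
  rewrite add0n (_ : ((2 * n - 1 - 0).+1 - n = n)%N); last by clear -n0; lia.
  rewrite -big_cat_nat /=; [|clear; lia|clear -n0; lia].
  by rewrite subn0 (prod_qpoch_opp0 Kc p0 p1 N0).
- by rewrite /X !mulf_neq0 ?pnatr_eq0.
- rewrite /X ephi mulr1.
  have -> : vQ = qpoch (p ^+ (2 * n - 1)) (p ^+ (2 * n - 1)) ^+ n / qpoch p p ^+ n.
    by rewrite -eQ mulfK // expf_neq0.
  by field; rewrite !expf_neq0.
Qed.

End TypeB.

(** * Types B-dual, C, C-dual, BC and D *)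

Section OtherTypes.
Variable K : numClosedFieldType.
Hypothesis Kc : geometric_complete K.
Variable p : K.
Hypotheses (p0 : p != 0) (p1 : `|p| < 1).
Variable n : nat.
Hypothesis n0 : (0 < n)%N.

Let pp0 : qpoch p p != 0.
Proof. exact: (qpoch_pow_neq0 Kc p0 p1 (isT : 0 < 1)%N (isT : 0 < 1)%N). Qed.

Let oppp0 : qpoch (- p) p != 0.
Proof. exact: (qpoch_opp_neq0 Kc p0 p1 (isT : 0 < 1)%N (isT : 0 < 1)%N). Qed.

(** Euler: partitions into odd parts correspond to partitions into distinct
    parts. *)
Lemma qpoch_odd (q : K) : q != 0 -> `|q| < 1 -> qpoch q (q ^+ 2) * qpoch (- q) q = 1.
Proof.
move=> q0 q1; apply: (mulfI (qpoch_small_neq0 Kc q0 q1 q1)).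
by rewrite mulr1 [RHS](qpoch_bisect Kc q q0 q1) -expr2 (qpoch_sqr_self Kc q0 q1); ring.
Qed.

Lemma prod_inv_sub_neq0 (b : 'I_n -> K) : (forall i, b i != 0) -> (forall i, b i ^+ 2 != 1) ->
  \prod_i ((b i)^-1 - b i) != 0.
Proof.
move=> b0 b2; apply/prodf_neq0 => i _.
rewrite (_ : _ - _ = (b i)^-1 * (1 - b i ^+ 2)); last by field.
by rewrite mulf_neq0 ?invr_eq0 // subr_eq0 eq_sym.
Qed.

(** The nodes satisfy [b^(2n) = -1]; the value 1 would annihilate the first
    column. *)
Lemma alternant_Bv (x : 'I_n -> K) : (forall i, x i != 0) ->
  alternant (fun j : 'I_n => theta_symbasis p (2 * n) (p ^+ n) 1 0 (- n%:Z + j%:Z)) x =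
  2 * qpoch (p ^+ 2) (p ^+ 2) * qpoch p p ^+ (n - 1) / qpoch (p ^+ (2 * n)) (p ^+ (2 * n)) ^+ n * W_Bv p x.
Proof.
move=> hx; have N0 : (0 < 2 * n)%N by lia.
have M0 : (0 < 2 * (2 * n))%N by lia.
have [z hz] := prim_root_exists K M0.
pose b : 'I_n -> K := nodes z 1.
have b0 : forall i, b i != 0 by exact: (nodes_neq0 1 N0 hz).
have q0 : p ^+ 2 != 0 by rewrite expf_neq0.
have q1 : `|p ^+ 2| < 1 by exact: normXn_lt1.
have [vQ hQ] := nodepair_iprod Kc p0 p1 b.
have eQ := iprod_eq (nodepair_2n n0 hz) (has_iprodM hQ
   (has_iprodM (has_iprodX (k := n) (iprod_sub Kc p p0 p1)) (iprod_addX Kc p p0 p1 n0)))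
  (has_iprodX (k := n) (iprod_subX Kc p p0 p1 N0)).
have ephi := iprod_eq (nodeprod_sq_2n n0 hz) (nodeprod_iprod Kc (fun i => b i ^+ 2) (p ^+ 2) q0 q1)
  (has_iprodX (k := 2) (iprod_addX Kc (p ^+ 2) q0 q1 n0)).
have nA := qpoch_opp_neq0 Kc p0 p1 N0 N0; have nS := qpoch_pow_neq0 Kc p0 p1 N0 N0.
have nAn := qpoch_opp_neq0 Kc p0 p1 n0 N0.
rewrite -exprM in ephi.
have e2 := qpoch_bisect Kc (- p ^+ n) (expf_neq0 n p0) (normXn_lt1 p1 n0).
rewrite mulNr -expr2 -exprM mulnC in e2.
pose X := 2 * qpoch (- p ^+ (2 * n)) (p ^+ (2 * n)) * qpoch (- p) p / qpoch (- p ^+ n) (p ^+ (2 * n)).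
rewrite /W_Bv; apply: (alternant_from_nodes Kc p0 p1 (phi := fun y => y^-1 * theta (y ^+ 2) (p ^+ 2))
  (pre := [:: 1; -1]) (d0 := 1)
  (b := b) (eta := -1) (kap := 1) (G := \prod_i ((b i)^-1 - b i)) (vQ := vQ) (X := X)
  (vphi := \prod_i (qpoch (p ^+ 2 * b i ^+ 2) (p ^+ 2) * qpoch (p ^+ 2 / b i ^+ 2) (p ^+ 2)))) => //.
- by rewrite /=; clear -n0; lia.
- by rewrite /= oppr_eq0 oner_neq0.
- by move=> y y0; rewrite !big_cons big_nil mulr1 mul1r mulN1r (theta_sqr Kc) // expr1.
- by rewrite !big_cons big_nil opprK !mulr1 opprK mul1r add1n subn1 prednK.
- by rewrite expr0z mulr1 -exprM mulnC.
- by rewrite expr1n.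
- move=> y y0; rewrite expr0z mul1r exprVn (thetaV Kc) ?expf_neq0 // invrK.
  by field.
- move=> m hm; have [m1|m1|m1] := ltrgtP m 0; [apply: Or41|apply: Or42|apply: Or43]; [clear -m1 hm; lia|clear -m1 hm; lia|].
  by rewrite m1.
- by move=> i; rewrite (nodes_exp 1 N0 hz) expr1.
- by rewrite sqrrN expr1n.
- by apply: (weylD_nodes_neq0 n0 N0 hz) => [||i j ij jn]; clear -n0 ij jn || clear -n0; lia.
- exact: weyl_det_C.
- by apply: prod_inv_sub_neq0 => // i; rewrite (nodes_sqr_neq1 n0 N0 hz) //; clear -n0; lia.
- exact: (prod_theta_sqr_tails Kc).
- transitivity (\prod_(j < n) theta (- p ^+ (0 + j)) (p ^+ (2 * n))); last first.
    apply: eq_bigr => j _; rewrite add0n mulN1r mulNr (exprzn_mul p0 (k := j)) //; clear; lia.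
  rewrite (prod_theta_opp_pow p0 p1 N0) //; last by clear -n0; lia.
  apply: (canLR (mulfK nAn)); rewrite -(prod_qpoch_opp0 Kc p0 p1 N0).
  rewrite add0n subn0 (_ : ((2 * n).+1 - n = n.+1)%N); last by clear -n0; lia.
  rewrite mulrAC -mulrA (big_cat_nat _ (n := n)) //=; last by clear -n0; lia.
  by rewrite [X in _ * X = _]big_ltn //; clear -n0; lia.
- by rewrite /X !mulf_neq0 ?invr_eq0 ?pnatr_eq0.
- rewrite ephi (qpoch_sqr_self Kc p0 p1) mulr1.
  have -> : vQ = qpoch (p ^+ (2 * n)) (p ^+ (2 * n)) ^+ n /
      (qpoch p p ^+ n * (qpoch (- p ^+ n) (p ^+ (2 * n)) * qpoch (- p ^+ (2 * n)) (p ^+ (2 * n)))).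
    by rewrite -e2 -eQ mulfK // e2 !mulf_neq0 // expf_neq0.
  have -> : qpoch p p ^+ n = qpoch p p * qpoch p p ^+ (n - 1) by rewrite -exprS subn1 prednK.
  by rewrite /X; field; rewrite !expf_neq0 // pp0 nA nAn.
Qed.

(** The nodes satisfy [b^(2n+2) = 1]; the roots 1 and -1 are left out because all
    columns vanish there. *)
Lemma alternant_C (r : K) (x : 'I_n -> K) : r ^+ 2 = p -> (forall i, x i != 0) ->
  alternant (fun j : 'I_n => theta_symbasis p (2 * n + 2) (- p ^+ n.+1) 1 0 (- n%:Z + j%:Z)) x =
  qpoch p p ^+ n / qpoch (p ^+ (2 * n + 2)) (p ^+ (2 * n + 2)) ^+ n * W_C p x.
Proof.
move=> hr hx; have N0 : (0 < 2 * n + 2)%N by lia.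
have r0 : r != 0 by apply: contra_neq p0 => r0; rewrite -hr r0 expr0n.
have r1 : `|r| < 1 by rewrite -(@expr_lt1 _ 2) // -normrX hr.
have M0 : (0 < 2 * (2 * n + 2))%N by lia.
have [z hz] := prim_root_exists K M0.
pose b : 'I_n -> K := nodes z 2.
have b0 : forall i, b i != 0 by exact: (nodes_neq0 2 N0 hz).
have [vQ hQ] := nodepair_iprod Kc p0 p1 b.
have eQ := iprod_eq (nodepair_2n_add2 n0 hz) (has_iprodM hQ
   (has_iprodM (has_iprodX (k := n.-1) (iprod_sub Kc p p0 p1)) (iprod_subX Kc p p0 p1 (ltn0Sn n))))
  (has_iprodM (has_iprodX (k := n.-1) (iprod_subX Kc p p0 p1 N0)) (iprod_subX Kc p p0 p1 (isT : 0 < 2)%N)).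
have ephi := iprod_eq (nodeprod_sq_2n_add2 n0 hz)
  (has_iprodM (nodeprod_iprod Kc (fun i => b i ^+ 2) p p0 p1) (has_iprodX (k := 2) (iprod_sub Kc p p0 p1)))
  (has_iprodX (k := 2) (iprod_subX Kc p p0 p1 (ltn0Sn n))).
have nA := qpoch_opp_neq0 Kc p0 p1 N0 N0; have nS := qpoch_pow_neq0 Kc p0 p1 N0 N0.
have nA' := qpoch_opp_neq0 Kc p0 p1 (ltn0Sn n) N0; have nS1 := qpoch_pow_neq0 Kc p0 p1 (ltn0Sn n) (ltn0Sn n).
have nH := qpoch_opp_neq0 Kc p0 p1 (ltn0Sn n) (ltn0Sn n).
have eN : (2 * n + 2 = n.+1 * 2)%N by clear; lia.
have eH := qpoch_bisect Kc (- p ^+ n.+1) (expf_neq0 n.+1 p0) (normXn_lt1 p1 (ltn0Sn n)).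
rewrite mulNr -expr2 -exprM -eN in eH.
have eS := qpoch_sqr_self Kc (expf_neq0 n.+1 p0) (normXn_lt1 p1 (ltn0Sn n)).
rewrite -exprM -eN in eS.
have ep := qpoch_sqr_self Kc p0 p1.
pose X := qpoch (- p) p / qpoch (- p ^+ n.+1) (p ^+ n.+1).
rewrite /W_C; apply: (alternant_from_nodes Kc p0 p1 (phi := fun y => y^-1 * theta (y ^+ 2) p)
  (pre := [:: 1; -1; r; - r]) (d0 := 1)
  (b := b) (eta := 1) (kap := 1) (G := \prod_i ((b i)^-1 - b i)) (vQ := vQ) (X := X)
  (vphi := \prod_i (qpoch (p * b i ^+ 2) p * qpoch (p / b i ^+ 2) p))) => //.
- by rewrite /=; clear -n0; lia.
- by rewrite /= !oppr_eq0 oner_neq0 r0.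
- move=> y y0; rewrite !big_cons big_nil mulr1 mul1r mulN1r expr1; congr (_ * _).
  rewrite -{1}hr (theta_sqr Kc) // !(theta_sqrt Kc p0 p1 hr) ?oppr_eq0 // mulrN mulNr; ring.
- by rewrite !big_cons big_nil add1n subn1 prednK // exprS -{1}hr; ring.
- by rewrite expr0z mulr1 sqrrN -exprM eN.
- by rewrite expr1n.
- move=> y y0; rewrite expr0z mul1r exprVn (thetaV Kc) ?expf_neq0 // invrK.
  by field.
- move=> m hm; have [m1|m1|m1] := ltrgtP m 0; [apply: Or41; clear -m1 hm; lia| |by apply: Or43; rewrite m1].
  have [m2|m2] := lerP m n%:Z; first by apply: Or42; clear -m1 m2 hm; lia.
  have -> : m = n.+1%:Z by clear -m2 hm; lia.
  apply: Or44; split=> //; first by clear; lia.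
  by rewrite sub0r mulNr -exprnN mulfV // expf_neq0.
- by move=> i; rewrite (nodes_exp 2 N0 hz) sqrrN expr1n.
- by rewrite expr1n.
- by apply: (weylD_nodes_neq0 n0 N0 hz) => [||i j ij jn]; clear -n0 ij jn || clear -n0; lia.
- exact: weyl_det_C.
- by apply: prod_inv_sub_neq0 => // i; rewrite (nodes_sqr_neq1 n0 N0 hz) //; clear -n0; lia.
- exact: (prod_theta_sqr_tails Kc).
- transitivity (\prod_(j < n) theta (- p ^+ (1 + j)) (p ^+ (2 * n + 2))); last first.
    apply: eq_bigr => j _; rewrite mul1r mulNr (exprzn_mul p0 (k := (1 + j)%N)) //; clear; lia.
  rewrite (prod_theta_opp_pow p0 p1 N0) //; last by clear -n0; lia.
  apply: (canLR (mulfK nH)); rewrite -(prod_qpoch_opp Kc p0 p1 N0) eH.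
  rewrite (_ : ((2 * n + 2 - 1).+1 - n = n.+2)%N); last by clear -n0; lia.
  rewrite (_ : ((2 * n + 2 - 1).+1 = 2 * n + 2)%N); last by clear -n0; lia.
  rewrite add1n (big_cat_nat _ (n := n.+1)) //=; last by clear -n0; lia.
  rewrite [X in _ * X = _]big_ltn; last by clear -n0; lia.
  by rewrite [X in _ * (_ * X) = _]big_nat_recr /=; [ring|clear -n0; lia].
- by rewrite /X !mulf_neq0 ?invr_eq0.
- set V := \prod_i _ in ephi *.
  have -> : V = qpoch (p ^+ n.+1) (p ^+ n.+1) ^+ 2 / qpoch p p ^+ 2.
    by rewrite -ephi mulfK // expf_neq0.
  have -> : vQ = qpoch (p ^+ (2 * n + 2)) (p ^+ (2 * n + 2)) ^+ n.-1 * qpoch (p ^+ 2) (p ^+ 2) /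
      (qpoch p p ^+ n.-1 * qpoch (p ^+ n.+1) (p ^+ n.+1)).
    by rewrite -eQ mulfK // !mulf_neq0 // expf_neq0.
  have eX (a : K) : a ^+ n = a * a ^+ n.-1 by rewrite -exprS prednK.
  rewrite /X ep !eX eS; field.
  by rewrite pp0 nH nS1 !expf_neq0 // mulf_neq0.
Qed.

Lemma prod_fold (G : nat -> K) :
  \prod_(j < n) (G j * G ((2 * n).-1 - j)%N) = \prod_(j < 2 * n) G j.
Proof.
rewrite big_split /= (prod_rev_range G) /=; last by clear -n0; lia.
rewrite prednK ?muln_gt0 // (_ : (2 * n - n = n)%N); last by clear; lia.
by rewrite -(big_mkord xpredT G) -big_cat_nat ?big_mkord //=; clear; lia.
Qed.

(** The nodes satisfy [b^(2n) = -1]. *)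
Lemma alternant_Cv (r : K) (x : 'I_n -> K) : r ^+ 2 = p -> (forall i, x i != 0) ->
  alternant (fun j : 'I_n => theta_symbasis p (2 * n) (- r * p ^+ (n - 1)) 1 1 (1 - n%:Z + j%:Z)) x =
  qpoch r r * qpoch p p ^+ (n - 1) / qpoch (p ^+ (2 * n)) (p ^+ (2 * n)) ^+ n * W_Cv p r x.
Proof.
move=> hr hx; have N0 : (0 < 2 * n)%N by lia.
have r0 : r != 0 by apply: contra_neq p0 => r0; rewrite -hr r0 expr0n.
have r1 : `|r| < 1 by rewrite -(@expr_lt1 _ 2) // -normrX hr.
have M0 : (0 < 2 * (2 * n))%N by lia.
have [z hz] := prim_root_exists K M0.
pose b : 'I_n -> K := nodes z 1.
have b0 : forall i, b i != 0 by exact: (nodes_neq0 1 N0 hz).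
have [vQ hQ] := nodepair_iprod Kc p0 p1 b.
have eQ := iprod_eq (nodepair_2n n0 hz) (has_iprodM hQ
   (has_iprodM (has_iprodX (k := n) (iprod_sub Kc p p0 p1)) (iprod_addX Kc p p0 p1 n0)))
  (has_iprodX (k := n) (iprod_subX Kc p p0 p1 N0)).
have ephi := iprod_eq (nodeprod_2n n0 hz) (nodeprod_iprod Kc b r r0 r1)
  (iprod_addX Kc r r0 r1 N0).
rewrite exprM hr in ephi.
have nS := qpoch_pow_neq0 Kc p0 p1 N0 N0; have nH := qpoch_opp_neq0 Kc p0 p1 n0 n0.
have er := qpoch_bisect Kc r r0 r1; rewrite -expr2 hr in er.
have nr : qpoch r p != 0 by exact: (qpoch_small_neq0 Kc p0 p1 r1).
rewrite /W_Cv; apply: (alternant_from_nodes Kc p0 p1 (phi := fun y => theta y r)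
  (pre := [:: 1; r]) (d0 := 0)
  (b := b) (eta := -1) (kap := 1) (G := \prod_i (1 - b i)) (vQ := vQ) (X := qpoch r p)
  (vphi := \prod_i (qpoch (r * b i) r * qpoch (r / b i) r))) => //.
- by rewrite /=; clear -n0; lia.
- by rewrite /= oner_neq0 r0.
- by move=> y y0; rewrite !big_cons big_nil mulr1 mul1r expr0 invr1 mul1r (theta_sqrt Kc p0 p1 hr).
- by rewrite !big_cons big_nil mulr1 mulN1r opprK.
- by rewrite exprMn sqrrN hr expr1z -exprM mulrC -!exprS; congr (p ^+ _); clear -n0; lia.
- by rewrite expr1n.
- by move=> y y0; rewrite (thetaV Kc) // expr1z; field.
- move=> m hm; have [m1|m1] := lerP m 0; [apply: Or41|apply: Or42]; clear -m1 hm; lia.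
- by move=> i; rewrite (nodes_exp 1 N0 hz) expr1.
- by rewrite sqrrN expr1n.
- by apply: (weylD_nodes_neq0 n0 N0 hz) => [||i j ij jn]; clear -n0 ij jn || clear -n0; lia.
- exact: weyl_det_B.
- by apply/prodf_neq0 => i _; rewrite subr_eq0 eq_sym (nodes_neq1 n0 N0 hz) //; clear -n0; lia.
- exact: (prod_theta_tails Kc).
- pose tB k := qpoch (r * p ^+ k) (p ^+ (2 * n)).
  rewrite (eq_bigr (fun j : 'I_n => tB j * tB ((2 * n).-1 - j)%N)); last first.
    move=> j _; rewrite (_ : _ * _ * _ = r * (p ^+ (n - 1) * p ^ (1 - n%:Z + j%:Z))); last by ring.
    rewrite (exprzn_mul p0 (k := j)); last by clear -n0; lia.
    rewrite /theta /tB; have pj : p ^+ j != 0 by rewrite expf_neq0.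
    have e : p ^+ (2 * n) / (r * p ^+ j) = r * p ^+ ((2 * n).-1 - j).
      have -> : (2 * n = ((2 * n).-1 - j + j).+1)%N by have := ltn_ord j; clear; lia.
      by rewrite /= addnK exprS exprD -{1}hr; field; rewrite r0 pj.
    by rewrite e.
  by rewrite prod_fold; exact/esym/(qpoch_multisection Kc).
- rewrite ephi er mulr1.
  have -> : vQ = qpoch (p ^+ (2 * n)) (p ^+ (2 * n)) ^+ n / (qpoch p p ^+ n * qpoch (- p ^+ n) (p ^+ n)).
    by rewrite -eQ mulfK // mulf_neq0 // expf_neq0.
  have -> : qpoch p p ^+ n = qpoch p p * qpoch p p ^+ (n - 1) by rewrite -exprS subn1 prednK.
  by field; rewrite !expf_neq0 // pp0 nH.
Qed.

(** The nodes satisfy [b^(2n+1) = 1]; the root 1 is left out because all columns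
    vanish there. *)
Lemma alternant_BC (r : K) (x : 'I_n -> K) : r ^+ 2 = p -> (forall i, x i != 0) ->
  alternant (fun j : 'I_n => theta_symbasis p (2 * n + 1) (- p ^+ n) 1 1 (1 - n%:Z + j%:Z)) x =
  qpoch p p ^+ n / qpoch (p ^+ (2 * n + 1)) (p ^+ (2 * n + 1)) ^+ n * W_BC p x.
Proof.
move=> hr hx; have N0 : (0 < 2 * n + 1)%N by lia.
have r0 : r != 0 by apply: contra_neq p0 => r0; rewrite -hr r0 expr0n.
have M0 : (0 < 2 * (2 * n + 1))%N by lia.
have [z hz] := prim_root_exists K M0.
pose b : 'I_n -> K := nodes z 2.
have b0 : forall i, b i != 0 by exact: (nodes_neq0 2 N0 hz).
have q0 : p ^+ 2 != 0 by rewrite expf_neq0.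
have q1 : `|p ^+ 2| < 1 by exact: normXn_lt1.
have [vQ hQ] := nodepair_iprod Kc p0 p1 b.
have eQ := iprod_eq (nodepair_2n_add1 n0 hz) (has_iprodM hQ (has_iprodX (k := n.-1) (iprod_sub Kc p p0 p1)))
  (has_iprodX (k := n.-1) (iprod_subX Kc p p0 p1 N0)).
have ephi1 := iprod_eq (nodeprod_2n_add1 n0 hz) (has_iprodM (nodeprod_iprod Kc b p p0 p1) (iprod_sub Kc p p0 p1))
  (iprod_subX Kc p p0 p1 N0).
have ephi2 := iprod_eq (nodeprod_sq_2n_add1 n0 hz)
  (has_iprodM (nodeprod_iprod Kc (fun i => b i ^+ 2) p q0 q1) (iprod_sub Kc p q0 q1))
  (iprod_subX Kc p q0 q1 N0).
have nA := qpoch_opp_neq0 Kc p0 p1 N0 N0; have nS := qpoch_pow_neq0 Kc p0 p1 N0 N0.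
have o1 := qpoch_odd p0 p1; have oN := qpoch_odd (expf_neq0 (2 * n + 1) p0) (normXn_lt1 p1 N0).
rewrite -exprM (mulnC _ 2%N) exprM in oN.
pose X := qpoch (- p) p / qpoch (- p ^+ (2 * n + 1)) (p ^+ (2 * n + 1)).
rewrite /W_BC; apply: (alternant_from_nodes Kc p0 p1 (phi := fun y => theta y p * theta (p * y ^+ 2) (p ^+ 2))
  (pre := [:: 1; r; - r]) (d0 := 0)
  (b := b) (eta := 1) (kap := 1) (G := \prod_i (1 - b i)) (vQ := vQ) (X := X)
  (vphi := \prod_i (qpoch (p * b i) p * qpoch (p / b i) p) *
           \prod_i (qpoch (p * b i ^+ 2) (p ^+ 2) * qpoch (p / b i ^+ 2) (p ^+ 2)))) => //.
- by rewrite /=; clear -n0; lia.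
- by rewrite /= oppr_eq0 oner_neq0 r0.
- move=> y y0; rewrite !big_cons big_nil mulr1 mul1r mulNr expr0 invr1 mul1r; congr (_ * _).
  by rewrite -(theta_sqr Kc) // exprMn hr.
- rewrite !big_cons big_nil opprK mulr1 mulN1r opprK mulNr -expr2 hr.
  by rewrite mulNr -exprS add0n subn1 prednK.
- by rewrite sqrrN -exprM expr1z -exprSr; congr (p ^+ _); clear; lia.
- by rewrite expr1n.
- move=> y y0; rewrite (thetaV Kc) // expr1z -(theta_compl q0 (x := p * y^-1 ^+ 2)); last first.
    by rewrite mulf_neq0 ?expf_neq0 ?invr_eq0.
  have -> : p ^+ 2 / (p * y^-1 ^+ 2) = p * y ^+ 2 by field; rewrite p0 y0.
  by field.
- move=> m hm; have [m1|m1] := lerP m 0; first by apply: Or41; clear -m1 hm; lia.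
  have [m2|m2] := lerP m n%:Z; first by apply: Or42; clear -m1 m2 hm; lia.
  have -> : m = n.+1%:Z by clear -m2 hm; lia.
  apply: Or44; split=> //; first by clear; lia.
  rewrite (_ : 1 - n.+1%:Z = - n%:Z); last by clear; lia.
  by rewrite mulNr -exprnN mulfV // expf_neq0.
- by move=> i; rewrite (nodes_exp 2 N0 hz) sqrrN expr1n.
- by rewrite expr1n.
- by apply: (weylD_nodes_neq0 n0 N0 hz) => [||i j ij jn]; clear -n0 ij jn || clear -n0; lia.
- exact: weyl_det_B.
- by apply/prodf_neq0 => i _; rewrite subr_eq0 eq_sym (nodes_neq1 n0 N0 hz) //; clear -n0; lia.
- rewrite big_split /= (prod_theta_tails Kc) // -mulrA; congr (_ * (_ * _)).
  apply: eq_bigr => i _; rewrite /theta.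
  have -> // : p ^+ 2 / (p * b i ^+ 2) = p / b i ^+ 2 by field; rewrite p0 b0.
- transitivity (\prod_(j < n) theta (- p ^+ (1 + j)) (p ^+ (2 * n + 1))); last first.
    apply: eq_bigr => j _; rewrite mul1r mulNr (exprzn_mul p0 (k := (1 + j)%N)) //; clear; lia.
  rewrite (prod_theta_opp_pow p0 p1 N0) //; last by clear -n0; lia.
  apply: (canLR (mulfK nA)); rewrite -(prod_qpoch_opp Kc p0 p1 N0).
  rewrite (_ : ((2 * n + 1 - 1).+1 - n = n.+1)%N); last by clear -n0; lia.
  rewrite (_ : ((2 * n + 1 - 1).+1 = 2 * n + 1)%N); last by clear -n0; lia.
  rewrite add1n -big_cat_nat //=; last by clear -n0; lia.
  by rewrite [LHS]big_nat_recr //=; clear; lia.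
- by rewrite /X !mulf_neq0 ?invr_eq0.
- set V1 := \prod_i _ in ephi1 *; set V2 := \prod_i _ in ephi2 *.
  have hV1 : V1 = qpoch (p ^+ (2 * n + 1)) (p ^+ (2 * n + 1)) / qpoch p p by rewrite -ephi1 mulfK.
  have hV2 : V2 * qpoch (- p ^+ (2 * n + 1)) (p ^+ (2 * n + 1)) = qpoch (- p) p.
    rewrite -[RHS]mul1r -oN -ephi2 -[LHS]mulr1 -o1; ring.
  have -> : vQ = qpoch (p ^+ (2 * n + 1)) (p ^+ (2 * n + 1)) ^+ n.-1 / qpoch p p ^+ n.-1.
    by rewrite -eQ mulfK // expf_neq0.
  have eX (a : K) : a ^+ n = a * a ^+ n.-1 by rewrite -exprS prednK.
  rewrite hV1 /X -hV2 !eX; field.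
  by rewrite pp0 nA nS !expf_neq0.
Qed.

(** The nodes satisfy [b^(2n-2) = 1], both 1 and -1 included; the value -1 would
    annihilate the first column. *)
Lemma alternant_D (x : 'I_n -> K) : (1 < n)%N -> (forall i, x i != 0) ->
  alternant (fun j : 'I_n => theta_symbasis p (2 * n - 2) (- p ^+ (n - 1)) (- 1) 0 (1 - n%:Z + j%:Z)) x =
  4 * qpoch p p ^+ n / qpoch (p ^+ (2 * n - 2)) (p ^+ (2 * n - 2)) ^+ n * W_D p x.
Proof.
move=> n1 hx; have N0 : (0 < 2 * n - 2)%N by lia.
have M0 : (0 < 2 * (2 * n - 2))%N by lia.
have np : (0 < n.-1)%N by lia.
have [z hz] := prim_root_exists K M0.
pose b : 'I_n -> K := nodes z 0.
have b0 : forall i, b i != 0 by exact: (nodes_neq0 0 N0 hz).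
have [vQ hQ] := nodepair_iprod Kc p0 p1 b.
have eQ := iprod_eq (nodepair_2n_sub2 n1 hz) (has_iprodM hQ (has_iprodX (k := n) (iprod_sub Kc p p0 p1)))
  (has_iprodM (has_iprodX (k := n) (iprod_subX Kc p p0 p1 N0))
     (has_iprodM (iprod_add Kc p p0 p1) (iprod_addX Kc p p0 p1 np))).
have nS := qpoch_pow_neq0 Kc p0 p1 N0 N0.
have nH := qpoch_opp_neq0 Kc p0 p1 np np.
have eN : (2 * n - 2 = n.-1 * 2)%N by clear; lia.
have eH := qpoch_bisect Kc (- p ^+ n.-1) (expf_neq0 n.-1 p0) (normXn_lt1 p1 np).
rewrite mulNr -expr2 -exprM -eN in eH.
pose X := 2 * qpoch (- p ^+ n.-1) (p ^+ n.-1) * qpoch (- p) p.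
rewrite (_ : W_D p x = (\prod_(i < n) 1) * W_D p x); last by rewrite big1 // mul1r.
apply: (alternant_from_nodes Kc p0 p1 (phi := fun=> 1) (pre := [::]) (d0 := 0)
  (b := b) (eta := 1) (kap := 2) (G := \prod_(i < n) 1) (vQ := vQ) (X := X) (vphi := 1)) => //.
- by rewrite /=; clear -n1; lia.
- by move=> y y0; rewrite big_nil expr0 invr1 mulr1.
- by rewrite big_nil mulN1r.
- by rewrite expr0z mulr1 sqrrN -exprM eN subn1.
- by rewrite sqrrN expr1n.
- by move=> y y0; rewrite expr0z opprK.
- move=> m hm; have [m1|m1] := lerP m 0; [apply: Or41|apply: Or42]; clear -m1 hm n1; lia.
- by move=> i; rewrite (nodes_exp 0 N0 hz).
- by rewrite expr1n.
- by apply: (weylD_nodes_neq0 n0 N0 hz) => [||i j ij jn]; clear -n1 ij jn || clear -n1; lia.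
- exact: weyl_det_D.
- by rewrite big1 // oner_neq0.
- by rewrite mulr1.
- transitivity (\prod_(j < n) theta (- p ^+ (0 + j)) (p ^+ (2 * n - 2))); last first.
    apply: eq_bigr => j _; rewrite add0n mul1r mulNr (exprzn_mul p0 (k := j)) //; clear -n1; lia.
  rewrite (prod_theta_opp_pow p0 p1 N0) //; last by clear -n1; lia.
  rewrite add0n subn0 (_ : ((2 * n - 2).+1 - n = n.-1)%N); last by clear -n1; lia.
  rewrite /X eH; transitivity (qpoch (- p ^+ n.-1) (p ^+ (2 * n - 2)) *
    (2 * qpoch (- p ^+ (2 * n - 2)) (p ^+ (2 * n - 2)) * qpoch (- p) p)); first by ring.
  rewrite -(prod_qpoch_opp0 Kc p0 p1 N0) [X in _ = _ * X]big_ltn; last by clear -n1; lia.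
  rewrite (prednK n0) mulrCA; congr (_ * _).
  by rewrite (big_cat_nat _ (n := n)) //=; clear -n1; lia.
- by rewrite /X !mulf_neq0 ?pnatr_eq0.
- have -> : vQ = qpoch (p ^+ (2 * n - 2)) (p ^+ (2 * n - 2)) ^+ n *
      (qpoch (- p) p * qpoch (- p ^+ n.-1) (p ^+ n.-1)) / qpoch p p ^+ n.
    by rewrite -eQ mulfK // expf_neq0.
  by rewrite /X; field; rewrite !expf_neq0.
Qed.

End OtherTypes.

(** * Type A *)

Section TypeA.
Variable K : numClosedFieldType.
Hypothesis Kc : geometric_complete K.
Variable p : K.
Hypotheses (p0 : p != 0) (p1 : `|p| < 1).
Variable n : nat.
Hypothesis n0 : (0 < n)%N.

(** The nodes are [rho w^i] with [w] a primitive [n]-th root of unity. The choice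
    of [rho] makes the product of [t] and all nodes equal to -1, which is not a
    power of [p]. *)
Lemma alternant_A (t : K) (x : 'I_n -> K) : t != 0 -> (forall i, x i != 0) ->
  alternant (fun j : 'I_n => theta_basis p n ((-1) ^+ (n - 1) * t) j%:Z) x =
  qpoch p p ^+ n / qpoch (p ^+ n) (p ^+ n) ^+ n * (theta (t * \prod_i x i) p * W_A p x).
Proof.
move=> t0 hx; have [w hw] := prim_root_exists K n0.
pose rho := n.-root ((-1) ^+ n / t).
have rhoN : rho ^+ n = (-1) ^+ n / t by rewrite /rho rootCK.
have rho0 : rho != 0.
  apply: contra_eq_neq rhoN => ->; rewrite expr0n gtn_eqF // eq_sym.
  by rewrite mulf_neq0 ?invr_eq0 // signr_eq0.
have w0 : w != 0 by exact: prim_root_neq0 hw.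
pose b (i : 'I_n) := rho * w ^+ i.
have b0 i : b i != 0 by rewrite mulf_neq0 ?expf_neq0.
have wn i : (w ^+ i) ^+ n = 1 by rewrite -exprM mulnC exprM (prim_expr_order hw) expr1n.
have bN i : b i ^+ n = (-1) ^+ n / t by rewrite exprMn wn mulr1.
have sg : (-1 : K) ^+ (n - 1) * (-1) ^+ n = -1.
  by rewrite -exprD -signr_odd (_ : odd _); [rewrite expr1|rewrite oddD oddB // addbC addbA addbb].
have key (u : K) : (-1) ^+ (n - 1) * t * u * ((-1) ^+ n / t) = - u.
  transitivity ((-1) ^+ (n - 1) * (-1) ^+ n * u * (t / t)).
    by move: ((-1) ^+ (n - 1)) ((-1) ^+ n) => s1 s2; ring.
  by rewrite sg mulfV // mulr1 mulN1r.
have pw : \prod_(i < n) w ^+ i = (-1) ^+ (n - 1).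
  have := congr1 (fun P => P.[0]) (factor_Xn_sub_1 hw).
  rewrite horner_prod !hornerE expr0n gtn_eqF // sub0r big_mkord.
  rewrite (eq_bigr (fun i : 'I_n => -1 * w ^+ i)); last by move=> i _; rewrite hornerXsubC sub0r mulN1r.
  rewrite big_split /= prodr_const card_ord => e.
  by apply: (mulfI (negbT (signr_eq0 K n))); rewrite e mulrC sg.
pose v := \prod_(i < n) \prod_(j < n | (i < j)%N) (qpoch (p * (b i / b j)) p * qpoch (p / (b i / b j)) p).
pose PA q := \prod_(i < n) \prod_(j < n | (i < j)%N) ((1 - q * (b i / b j)) * (1 - q / (b i / b j))).
have hv : has_iprod p p PA v.
  by apply: has_iprod_prod => i _; apply: has_iprod_prod => j _; exact: (has_iprod_theta_tail Kc).
have hPA q : PA q * (1 - q) ^+ n = (1 - q ^+ n) ^+ n.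
  pose T (i j : 'I_n) := 1 - q * (b j / b i).
  have e1 : PA q = \prod_(i < n) \prod_(j < n | (i < j)%N) (T i j * T j i).
    by apply: eq_bigr => i _; apply: eq_bigr => j _; rewrite /T invf_div mulrC.
  have e2 : (1 - q) ^+ n = \prod_(i < n) T i i.
    rewrite -[n in _ ^+ n]card_ord -prodr_const; apply: eq_bigr => i _.
    by rewrite /T mulfV // mulr1.
  rewrite e1 e2 -prod_offdiag -[n in RHS]card_ord -prodr_const card_ord; apply: eq_bigr => i _.
  transitivity (\prod_(0 <= k < n) (1 - q / w ^+ i * w ^+ k)).
    rewrite big_mkord; apply: eq_bigr => j _; rewrite /T /b; field.
    by rewrite rho0 expf_neq0.
  by rewrite (prod_roots _ hw) exprMn exprVn wn invr1 mulr1.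
have ev := iprod_eq hPA (has_iprodM hv (has_iprodX (k := n) (iprod_sub Kc p p0 p1)))
  (has_iprodX (k := n) (iprod_subX Kc p p0 p1 n0)).
have pp0 := qpoch_pow_neq0 Kc p0 p1 (isT : (0 < 1)%N) (isT : (0 < 1)%N); rewrite expr1 in pp0.
have pn0 := qpoch_pow_neq0 Kc p0 p1 n0 n0.
pose V := pairprod (fun y z => z - y) b.
have thN : theta (- 1) p != 0 by exact: (thetaN1_neq0 Kc p0 p1).
have V0 : V != 0.
  apply/prodf_neq0 => i _; apply/prodf_neq0 => j ij; rewrite /b -mulrBr mulf_neq0 // subr_eq0.
  rewrite (eq_prim_root_expr hw) !modn_small ?ltn_ord // gtn_eqF //.
have fb : alternant (fun j : 'I_n => theta_basis p n ((-1) ^+ (n - 1) * t) j%:Z) b = theta (- 1) p * V.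
  rewrite -(theta_multisection Kc p0 p1 n0 (a := - 1)) ?oppr_eq0 ?oner_eq0 //.
  have -> : \prod_(j < n) theta (- 1 * p ^+ j) (p ^+ n) =
      \det (diag_mx (\row_(j < n) theta (- 1 * p ^+ j) (p ^+ n))).
    by rewrite det_diag; apply: eq_bigr => j _; rewrite mxE.
  have -> : V = \det (Vandermonde n (\row_i b i)).
    rewrite det_Vandermonde; apply: eq_bigr => i _; apply: eq_bigr => j _.
    by rewrite !mxE.
  rewrite -det_mulmx -det_tr; congr (\det _); apply/matrixP => j i.
  by rewrite mul_diag_mx !mxE /theta_basis bN mulrC -!exprnP key mulN1r.
have Wb : theta (t * \prod_i b i) p * W_A p b = theta (- 1) p * (V * v).
  have -> : t * \prod_i b i = - 1.
    rewrite big_split /= prodr_const card_ord rhoN pw -[RHS](key 1).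
    by move: ((-1) ^+ (n - 1)) ((-1) ^+ n) => s1 s2; ring.
  congr (_ * _).
  rewrite /V /v -big_split; apply: eq_bigr => i _ /=; rewrite -big_split; apply: eq_bigr => j _ /=.
  rewrite (theta_tailE Kc _ p0 p1) /theta_tail; field; exact: b0.
apply: (alternant_evaluation (b := b) (W := fun x => theta (t * \prod_i x i) p * W_A p x)) => //.
- exact: (WA_proportional Kc p0 p1 n0 t0 b0).
- rewrite Wb fb; have -> : qpoch (p ^+ n) (p ^+ n) ^+ n = v * qpoch p p ^+ n by [].
  have v0 : v != 0 by apply: contra_eq_neq ev => ->; rewrite mul0r eq_sym expf_neq0.
  by field; rewrite v0 expf_neq0.
- by rewrite fb mulf_neq0.
Qed.

End TypeA.

(** * The determinant evaluations *)

Lemma theta_symbasis_entry (K : numFieldType) (p : K) (N : nat) (c eps C y : K)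
    (sg m e1 e2 eN eN' : int) : y != 0 -> C = c * p ^ m ->
  e1 = m -> e2 = sg - m -> eN = N%:Z -> eN' = - N%:Z ->
  y ^ e1 * theta (C * y ^ eN) (p ^+ N) - eps * (y ^ e2 * theta (C * y ^ eN') (p ^+ N)) =
  theta_symbasis p N c eps sg m y.
Proof.
move=> y0 -> -> -> -> ->.
by rewrite /theta_symbasis /theta_basis (expfzDr sg (- m) y0) exprz_inv exprVn -exprnN -exprnP mulrA.
Qed.

Section Determinants.
Variable K : numClosedFieldType.
Hypothesis Kc : geometric_complete K.
Variable p : K.
Hypotheses (p0 : p != 0) (hp1 : `|p| < 1).
Variable n : nat.
Hypothesis hn : (0 < n)%N.
Variable x : 'I_n -> K.
Hypothesis hx : forall i, x i != 0.

Lemma det_A (t : K) (ht : t != 0) :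
  (\det (\matrix_(i < n, j < n)
     (x i ^ (j.+1%:Z - 1)
        * theta ((-1) ^+ (n - 1) * p ^+ j * t * x i ^+ n) (p ^+ n)))
   = qpoch p p ^+ n / qpoch (p ^+ n) (p ^+ n) ^+ n
     * theta (t * \prod_(i < n) x i) p * W_A p x).
Proof.
rewrite -mulrA -(alternant_A Kc p0 hp1 hn ht hx); congr (\det _).
  apply/matrixP => i j; rewrite !mxE /theta_basis.
  rewrite (_ : j.+1%:Z - 1 = j%:Z); last by clear; lia.
  by rewrite -!exprnP [(-1) ^+ _ * t * _]mulrAC.
Qed.

Lemma det_B :
  (\det (\matrix_(i < n, j < n)
     (x i ^ (j.+1%:Z - n%:Z)
        * theta (p ^+ j * x i ^ (2 * n%:Z - 1)) (p ^+ (2 * n - 1))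
      - x i ^ (n%:Z + 1 - j.+1%:Z)
        * theta (p ^+ j * x i ^ (1 - 2 * n%:Z)) (p ^+ (2 * n - 1))))
   = 2 * qpoch p p ^+ n
     / qpoch (p ^+ (2 * n - 1)) (p ^+ (2 * n - 1)) ^+ n * W_B p x).
Proof.
rewrite -(alternant_B Kc p0 hp1 hn hx); congr (\det _).
  apply/matrixP => i j; rewrite !mxE -[X in _ - X]mul1r.
  apply: (theta_symbasis_entry _ (hx i)); [by rewrite (exprzn_mul p0 (k := j)) //; clear -hn; lia| clear -hn; lia ..].
Qed.

Lemma det_Bv :
  (\det (\matrix_(i < n, j < n)
     (x i ^ (j.+1%:Z - n%:Z - 1)
        * theta (p ^+ j * x i ^ (2 * n%:Z)) (p ^+ (2 * n))
      - x i ^ (n%:Z + 1 - j.+1%:Z)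
        * theta (p ^+ j * x i ^ (- (2 * n%:Z))) (p ^+ (2 * n))))
   = 2 * qpoch (p ^+ 2) (p ^+ 2) * qpoch p p ^+ (n - 1)
     / qpoch (p ^+ (2 * n)) (p ^+ (2 * n)) ^+ n * W_Bv p x).
Proof.
rewrite -(alternant_Bv Kc p0 hp1 hn hx); congr (\det _).
  apply/matrixP => i j; rewrite !mxE -[X in _ - X]mul1r.
  apply: (theta_symbasis_entry _ (hx i)); [by rewrite (exprzn_mul p0 (k := j)) //; clear; lia| clear; lia ..].
Qed.

Lemma det_C (r : K) (hr : r ^+ 2 = p) :
  (\det (\matrix_(i < n, j < n)
     (x i ^ (j.+1%:Z - n%:Z - 1)
        * theta (- p ^+ j.+1 * x i ^ (2 * n%:Z + 2)) (p ^+ (2 * n + 2))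
      - x i ^ (n%:Z + 1 - j.+1%:Z)
        * theta (- p ^+ j.+1 * x i ^ (- (2 * n%:Z) - 2)) (p ^+ (2 * n + 2))))
   = qpoch p p ^+ n
     / qpoch (p ^+ (2 * n + 2)) (p ^+ (2 * n + 2)) ^+ n * W_C p x).
Proof.
rewrite -(alternant_C Kc p0 hp1 hn hr hx); congr (\det _).
  apply/matrixP => i j; rewrite !mxE -[X in _ - X]mul1r.
  apply: (theta_symbasis_entry _ (hx i)); [by rewrite mulNr (exprzn_mul p0 (k := j.+1)) //; clear; lia| clear; lia ..].
Qed.

Lemma det_Cv (r : K) (hr : r ^+ 2 = p) :
  (\det (\matrix_(i < n, j < n)
     (x i ^ (j.+1%:Z - n%:Z)
        * theta (- (p ^+ j * r) * x i ^ (2 * n%:Z)) (p ^+ (2 * n))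
      - x i ^ (n%:Z + 1 - j.+1%:Z)
        * theta (- (p ^+ j * r) * x i ^ (- (2 * n%:Z))) (p ^+ (2 * n))))
   = qpoch r r * qpoch p p ^+ (n - 1)
     / qpoch (p ^+ (2 * n)) (p ^+ (2 * n)) ^+ n * W_Cv p r x).
Proof.
rewrite -(alternant_Cv Kc p0 hp1 hn hr hx); congr (\det _).
  apply/matrixP => i j; rewrite !mxE -[X in _ - X]mul1r.
  apply: (theta_symbasis_entry _ (hx i)); [|clear; lia ..].
  by rewrite !mulNr -mulrA (exprzn_mul p0 (k := j)) 1?mulrC //; clear -hn; lia.
Qed.

Lemma det_BC (r : K) (hr : r ^+ 2 = p) :
  (\det (\matrix_(i < n, j < n)
     (x i ^ (j.+1%:Z - n%:Z)
        * theta (- p ^+ j.+1 * x i ^ (2 * n%:Z + 1)) (p ^+ (2 * n + 1))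
      - x i ^ (n%:Z + 1 - j.+1%:Z)
        * theta (- p ^+ j.+1 * x i ^ (- (2 * n%:Z) - 1)) (p ^+ (2 * n + 1))))
   = qpoch p p ^+ n
     / qpoch (p ^+ (2 * n + 1)) (p ^+ (2 * n + 1)) ^+ n * W_BC p x).
Proof.
rewrite -(alternant_BC Kc p0 hp1 hn hr hx); congr (\det _).
  apply/matrixP => i j; rewrite !mxE -[X in _ - X]mul1r.
  apply: (theta_symbasis_entry _ (hx i)); [by rewrite mulNr (exprzn_mul p0 (k := j.+1)) //; clear; lia| clear; lia ..].
Qed.

Lemma det_D :
  ((2 <= n)%N ->
   \det (\matrix_(i < n, j < n)
     (x i ^ (j.+1%:Z - n%:Z)
        * theta (- p ^+ j * x i ^ (2 * n%:Z - 2)) (p ^+ (2 * n - 2))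
      + x i ^ (n%:Z - j.+1%:Z)
        * theta (- p ^+ j * x i ^ (2 - 2 * n%:Z)) (p ^+ (2 * n - 2))))
   = 4 * qpoch p p ^+ n
     / qpoch (p ^+ (2 * n - 2)) (p ^+ (2 * n - 2)) ^+ n * W_D p x).
Proof.
move=> n1; rewrite -(alternant_D Kc p0 hp1 hn n1 hx); congr (\det _).
  apply/matrixP => i j; rewrite !mxE (_ : forall a b : K, a + b = a - (- 1) * b); last by move=> a b; ring.
  apply: (theta_symbasis_entry _ (hx i)); [by rewrite mulNr (exprzn_mul p0 (k := j)) //; clear -hn; lia| clear -n1; lia ..].
Qed.

End Determinants.

Theorem proposition6p1 (R : realType) (p r : R[i])
    (hp0 : 0 < `|p|) (hp1 : `|p| < 1) (hr : r ^+ 2 = p)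
    (n : nat) (hn : (1 <= n)%N)
    (x : 'I_n -> R[i]) (hx : forall i, x i != 0) (t : R[i]) (ht : t != 0) :
  (\det (\matrix_(i < n, j < n)
     (x i ^ (j.+1%:Z - 1)
        * theta ((-1) ^+ (n - 1) * p ^+ j * t * x i ^+ n) (p ^+ n)))
   = qpoch p p ^+ n / qpoch (p ^+ n) (p ^+ n) ^+ n
     * theta (t * \prod_(i < n) x i) p * W_A p x)
  /\
  (\det (\matrix_(i < n, j < n)
     (x i ^ (j.+1%:Z - n%:Z)
        * theta (p ^+ j * x i ^ (2 * n%:Z - 1)) (p ^+ (2 * n - 1))
      - x i ^ (n%:Z + 1 - j.+1%:Z)
        * theta (p ^+ j * x i ^ (1 - 2 * n%:Z)) (p ^+ (2 * n - 1))))
   = 2 * qpoch p p ^+ n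
     / qpoch (p ^+ (2 * n - 1)) (p ^+ (2 * n - 1)) ^+ n * W_B p x)
  /\
  (\det (\matrix_(i < n, j < n)
     (x i ^ (j.+1%:Z - n%:Z - 1)
        * theta (p ^+ j * x i ^ (2 * n%:Z)) (p ^+ (2 * n))
      - x i ^ (n%:Z + 1 - j.+1%:Z)
        * theta (p ^+ j * x i ^ (- (2 * n%:Z))) (p ^+ (2 * n))))
   = 2 * qpoch (p ^+ 2) (p ^+ 2) * qpoch p p ^+ (n - 1)
     / qpoch (p ^+ (2 * n)) (p ^+ (2 * n)) ^+ n * W_Bv p x)
  /\
  (\det (\matrix_(i < n, j < n)
     (x i ^ (j.+1%:Z - n%:Z - 1)
        * theta (- p ^+ j.+1 * x i ^ (2 * n%:Z + 2)) (p ^+ (2 * n + 2))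
      - x i ^ (n%:Z + 1 - j.+1%:Z)
        * theta (- p ^+ j.+1 * x i ^ (- (2 * n%:Z) - 2)) (p ^+ (2 * n + 2))))
   = qpoch p p ^+ n
     / qpoch (p ^+ (2 * n + 2)) (p ^+ (2 * n + 2)) ^+ n * W_C p x)
  /\
  (\det (\matrix_(i < n, j < n)
     (x i ^ (j.+1%:Z - n%:Z)
        * theta (- (p ^+ j * r) * x i ^ (2 * n%:Z)) (p ^+ (2 * n))
      - x i ^ (n%:Z + 1 - j.+1%:Z)
        * theta (- (p ^+ j * r) * x i ^ (- (2 * n%:Z))) (p ^+ (2 * n))))
   = qpoch r r * qpoch p p ^+ (n - 1)
     / qpoch (p ^+ (2 * n)) (p ^+ (2 * n)) ^+ n * W_Cv p r x)
  /\
  (\det (\matrix_(i < n, j < n)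
     (x i ^ (j.+1%:Z - n%:Z)
        * theta (- p ^+ j.+1 * x i ^ (2 * n%:Z + 1)) (p ^+ (2 * n + 1))
      - x i ^ (n%:Z + 1 - j.+1%:Z)
        * theta (- p ^+ j.+1 * x i ^ (- (2 * n%:Z) - 1)) (p ^+ (2 * n + 1))))
   = qpoch p p ^+ n
     / qpoch (p ^+ (2 * n + 1)) (p ^+ (2 * n + 1)) ^+ n * W_BC p x)
  /\
  ((2 <= n)%N ->
   \det (\matrix_(i < n, j < n)
     (x i ^ (j.+1%:Z - n%:Z)
        * theta (- p ^+ j * x i ^ (2 * n%:Z - 2)) (p ^+ (2 * n - 2))
      + x i ^ (n%:Z - j.+1%:Z)
        * theta (- p ^+ j * x i ^ (2 - 2 * n%:Z)) (p ^+ (2 * n - 2))))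
   = 4 * qpoch p p ^+ n
     / qpoch (p ^+ (2 * n - 2)) (p ^+ (2 * n - 2)) ^+ n * W_D p x).
Proof.
have p0 : p != 0 by rewrite -normr_gt0.
have Kc := @geometric_complete_complex R.
split; first exact: (det_A Kc p0 hp1 hn hx ht).
split; first exact: (det_B Kc p0 hp1 hn hx).
split; first exact: (det_Bv Kc p0 hp1 hn hx).
split; first exact: (det_C Kc p0 hp1 hn hx hr).
split; first exact: (det_Cv Kc p0 hp1 hn hx hr).
split; first exact: (det_BC Kc p0 hp1 hn hx hr).
exact: (det_D Kc p0 hp1 hn hx).
Qed.
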